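(* Let $q\in\mathbb{C}^{*}$ with $0<|q|<1$ and let $a,b$ be such that $a/b$ is not an integer power of $q$. For any $\lambda,\mu\in\mathbb{C}^{*}$ and any $x\in\mathbb{C}^{*}\setminus\left([1;q]\cup[-\mu/a;q]\cup[-\mu/b;q]\cup[-\lambda;q]\right)$, we have $$\begin{pmatrix}{}_2f_0(a,b;\lambda,q,x)\\ {}_2f_1(a,b;q,x)\end{pmatrix}=\begin{pmatrix}C_\mu^\lambda(a,b;q,x)&C_\mu^\lambda(b,a;q,x)\\ C_\mu(a,b;q,x)&C_\mu(b,a;q,x)\end{pmatrix}\begin{pmatrix}S_\mu(a,b;q,x)\\ S_\mu(b,a;q,x)\end{pmatrix}.$$
   Context: Notation: $(a;q)_0=1$, $(a;q)_n=(1-a)(1-aq)\cdots(1-aq^{n-1})$ for $n\ge1$, $(a;q)_\infty=\lim_{n\to\infty}(a;q)_n$, $(a_1,\dots,a_m;q)_\infty=(a_1;q)_\infty\cdots(a_m;q)_\infty$; $\theta(x)=\sum_{n\in\mathbb{Z}}q^{n(n-1)/2}x^n=(q,-x,-q/x;q)_\infty$ for $x\in\mathbb{C}^{*}$; $[\lambda;q]=\lambda q^{\mathbb{Z}}=\{\lambda q^k:k\in\mathbb{Z}\}$. ${}_2\varphi_1(A,B;C;q,y)=\sum_{n\ge0}\frac{(A;q)_n(B;q)_n}{(C;q)_n(q;q)_n}y^n$ (continued analytically in $y$ where necessary), and ${}_2\varphi_0(a,b;-;q,x)=\sum_{n\ge0}\frac{(a;q)_n(b;q)_n}{(q;q)_n}\left[(-1)^nq^{n(n-1)/2}\right]^{-1}x^n$,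 a divergent series. For a series $f(x)=\sum_{n\ge0}a_nx^n$, the $q$-Borel transformation is $(\mathcal{B}_q^+f)(\xi)=\sum_{n\ge0}a_nq^{n(n-1)/2}\xi^n$, and the $q$-Laplace transformation of a function $\varphi$ is $(\mathcal{L}_{q,\lambda}^+\varphi)(x)=\sum_{n\in\mathbb{Z}}\frac{\varphi(q^n\lambda)}{\theta(q^n\lambda/x)}$. Define ${}_2f_0(a,b;\lambda,q,x)=\mathcal{L}_{q,\lambda}^+\circ\mathcal{B}_q^+\,{}_2\varphi_0(a,b;-;q,x)$ (with the $q$-Borel transform continued analytically where necessary). Define $${}_2f_1(a,b;q,x)=\frac{(abx;q)_\infty}{\theta(-qx)}\,{}_2\varphi_1\left(\frac{q}{a},\frac{q}{b};0;q,abx\right),$$ $$S_\mu(a,b;q,x)=\frac{\theta(a\mu x)}{\theta(\mu x)}\,{}_2\varphi_1\left(a,0;\frac{aq}{b};q,\frac{q}{abx}\right)\quad\text{for } \mu\in\mathbb{C}^{*},\ x\in\mathbb{C}^{*}\setminus[-\mu;q],$$ $$C_\mu^\lambda(a,b;q,x)=\frac{(b;q)_\infty}{\left(\frac{b}{a};q\right)_\infty}\frac{\theta(a\lambda)}{\theta(\lambda)}\frac{\theta\left(\frac{qax}{\lambda}\right)}{\theta\left(\frac{qx}{\lambda}\right)}\frac{\theta(\mu x)}{\theta(a\mu x)},\qquad C_\mu(a,b;q,x)=\frac{\left(\frac{q}{a};q\right)_\infty}{\left(\frac{b}{a},q;q\right)_\infty}\frac{\theta(-aqx)}{\theta(-qx)}\frac{\theta(\mu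 x)}{\theta(a\mu x)}.$$ The functions $C_\mu^\lambda(b,a;q,x)$, $C_\mu(b,a;q,x)$, $S_\mu(b,a;q,x)$ are obtained by exchanging $a$ and $b$.
   Formalization: Added so that all terms are defined: a, b nonzero, λ not in [-1;q], x not in [-1/μ;q], [-1/(aμ);q], [-1/(bμ);q] (zeros of θ(μx), θ(aμx), θ(bμx), missed by the printed exclusions), and x not equal to q^(k+1)/(ab), k≥0 (poles of the 2φ1 in S_μ). *)

(* Defs.v *)
(* Stdlib world: complex numbers are Coquelicot's C. *)
From Stdlib Require Import Reals ZArith ClassicalEpsilon.
From Coquelicot Require Import Coquelicot.

Open Scope C_scope.

(** * Sequences and series of complex numbers *)

Definition Clim (u : nat -> C) : C :=
  (real (Lim_seq (fun n => Re (u n))), real (Lim_seq (fun n => Im (u n)))).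

Definition CSeries (u : nat -> C) : C :=
  (Series (fun n => Re (u n)), Series (fun n => Im (u n))).

(* Sum over all of Z: the indices 0, 1, 2, ... and the indices -1, -2, ... *)
Definition CSeriesZ (u : Z -> C) : C :=
  CSeries (fun n => u (Z.of_nat n)) + CSeries (fun n => u (- Z.of_nat (S n))%Z).

Definition CpowZ (z : C) (k : Z) : C :=
  match k with
  | Z0 => 1
  | Zpos p => z ^ Pos.to_nat p
  | Zneg p => / z ^ Pos.to_nat p
  end.

(** * Analytic continuation *)

Definition analytic_at (g : C -> C) (z : C) : Prop :=
  exists (a : nat -> C) (r : R), (0 < r)%R /\
    forall y : C, (Cmod (y - z) < r)%R ->
      @is_pseries C_AbsRing C_NormedModule a (y - z) (g y).

Definition connected (D : C -> Prop) : Prop :=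
  forall U V : C -> Prop,
    @open C_UniformSpace U -> @open C_UniformSpace V ->
    (forall z, D z -> U z \/ V z) ->
    (exists z, D z /\ U z) -> (exists z, D z /\ V z) ->
    exists z, D z /\ U z /\ V z.

(* [w] is the value at [z] of an analytic continuation, to some connected open
   set containing [0] and [z], of the germ of [f] at [0]. *)
Definition is_continuation (f : C -> C) (z w : C) : Prop :=
  exists (D : C -> Prop) (g : C -> C),
    @open C_UniformSpace D /\ connected D /\ D 0 /\ D z /\
    (forall y, D y -> analytic_at g y) /\
    @locally C_UniformSpace (RtoC 0) (fun y => g y = f y) /\
    g z = w.

(* The germs continued below extend meromorphically to the whole plane, so the
   value does not depend on the chosen domain; it is unspecified at a point to
   which there is no continuation, i.e. at a pole. *)
Definition continuation (f : C -> C) (z : C) : C :=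
  epsilon (inhabits (0 : C)) (is_continuation f z).

(** * q-calculus *)

Fixpoint qpoch (q a : C) (n : nat) : C :=
  match n with
  | O => 1
  | S m => qpoch q a m * (1 - a * q ^ m)
  end.

Definition qpoch_inf (q a : C) : C := Clim (qpoch q a).

Definition theta (q x : C) : C :=
  CSeriesZ (fun n => CpowZ q (n * (n - 1) / 2)%Z * CpowZ x n).

(* [x] belongs to [l; q] = l q^Z. *)
Definition in_spiral (q l x : C) : Prop := exists k : Z, x = l * CpowZ q k.

(* q^(n(n-1)/2) *)
Definition qtri (q : C) (n : nat) : C := q ^ (n * (n - 1) / 2)%nat.

Definition power_series (c : nat -> C) (y : C) : C :=
  CSeries (fun n => c n * y ^ n).

Definition phi21 (q A B K y : C) : C :=
  continuation
    (power_series (fun n =>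
       (qpoch q A n * qpoch q B n) / (qpoch q K n * qpoch q q n))) y.

(* 2phi0(a,b;-;q,x) diverges: it is represented by its coefficient sequence. *)
Definition phi20 (q a b : C) : nat -> C := fun n =>
  (qpoch q a n * qpoch q b n) / qpoch q q n * / ((- (1)) ^ n * qtri q n).

Definition qBorel (q : C) (c : nat -> C) : nat -> C := fun n => c n * qtri q n.

Definition qLaplace (q lam : C) (phi : C -> C) (x : C) : C :=
  CSeriesZ (fun n =>
    phi (CpowZ q n * lam) / theta q (CpowZ q n * lam / x)).

Definition f20 (q a b lam x : C) : C :=
  qLaplace q lam (continuation (power_series (qBorel q (phi20 q a b)))) x.

(* The product (y;q)_oo 2phi1(q/a,q/b;0;q,y) is continued as a whole: its value
   is the product of the values wherever 2phi1 is regular, and the poles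
   y = q^(-k), k >= 0, of 2phi1 are cancelled by the zeros of (y;q)_oo. *)
Definition f21 (q a b x : C) : C :=
  continuation (fun y => qpoch_inf q y * phi21 q (q / a) (q / b) 0 y)
    (a * b * x) / theta q (- q * x).

Definition Smu (q mu a b x : C) : C :=
  theta q (a * mu * x) / theta q (mu * x)
  * phi21 q a 0 (a * q / b) (q / (a * b * x)).

Definition Clammu (q lam mu a b x : C) : C :=
  qpoch_inf q b / qpoch_inf q (b / a)
  * (theta q (a * lam) / theta q lam)
  * (theta q (q * a * x / lam) / theta q (q * x / lam))
  * (theta q (mu * x) / theta q (a * mu * x)).

Definition Cmu (q mu a b x : C) : C :=
  qpoch_inf q (q / a) / (qpoch_inf q (b / a) * qpoch_inf q q)
  * (theta q (- a * q * x) / theta q (- q * x))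
  * (theta q (mu * x) / theta q (a * mu * x)).

(* Main.v *)
Require Import Defs.
From Stdlib Require Import Reals ZArith Lra Lia ClassicalEpsilon Classical
  FunctionalExtensionality.
From Coquelicot Require Import Coquelicot.
Open Scope C_scope.

(** Write [E(z) = (z)_oo 2phi1(A, B; 0; q, z)], where all products have base [q].

    The function [E] is entire and satisfies a [q]-difference equation of second
    order.  The same equation holds for the two functions
    [theta(-A z) 2phi1(q/B, 0; A q/B; q, q/z)] and its image under [A <-> B].  Their
    Laurent coefficients are explicit values of a [1phi1] series ([branch]), and
    they solve one three-term recurrence.  A combination of the two solutions which
    vanishes at the index [-1] vanishes at all negative indices, because the leading
    factor of the recurrence is zero at the next index; it is then determined by its
    value at [0], and is the Taylor expansion of [E] if this value is [1].  The
    first condition fixes the ratio of the two weights by the summation [phi11_sum]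
    of [1phi1(al; c; q, c/al)]; the second is the evaluation of a Casoratian, which
    satisfies a first-order recurrence and has a known limit ([casoratian_value]).

    Summing the Laurent series by columns gives the formula for [E] near infinity
    as a combination of two [2phi1] in [q/z].  Multiplied by [(q/z)_oo], these become
    the entire functions [1phi1(A; A q/B; q, q^2/(B z))], and the [q]-difference
    equation then extends the formula to the punctured plane ([connection]).  The
    case [A = 1] is the triple product identity, which yields the zeros of theta.

    The second row of the theorem is [connection] for [A = q/a], [B = q/b] and
    [z = a b x].  For the first row take [A = a] and [B = b].  The continued Borel
    transform at [xi] is [E(-xi) / (-xi)_oo], a combination of the two quotients
    [theta(A xi) / theta(xi)] times a [1phi1] in [1/xi].  On a spiral [xi = lam q^n] such a
    quotient is a constant times [A^(-n)], so the Laplace transform of each power of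
    [1/xi] is again a theta function, and the powers add up to
    [2phi1(a, 0; a q/b; q, q/(a b x))].  This exchange of sums is legitimate for large
    [x]; a [q]-difference equation in [x], obtained from that of the Borel transform,
    gives the other values ([lap_sum_formula]).

    Analytic continuation is handled once, in [continuation_quotient]: all the
    continued germs are quotients [E / P] of entire functions with [P 0 <> 0].  The
    complement of the zeros of [P] is open and connected, which provides a
    continuation, and for any other continuation [g] the identity theorem gives
    [g P = E]. *)

(** * Complex series *)

Definition csum (u : nat -> C) (l : C) : Prop :=
  @is_series C_AbsRing C_NormedModule u l.

Lemma csum_ext (u v : nat -> C) (l : C) :
  (forall n, u n = v n) -> csum u l -> csum v l.
Proof. exact (is_series_ext u v l). Qed.

Lemma csum_plus (u v : nat -> C) (l m : C) :
  csum u l -> csum v m -> csum (fun n => u n + v n) (l + m).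
Proof. exact (is_series_plus u v l m). Qed.

Lemma csum_scal (c : C) (u : nat -> C) (l : C) :
  csum u l -> csum (fun n => c * u n) (c * l).
Proof. exact (is_series_scal c u l). Qed.

Lemma csum_minus (u v : nat -> C) (l m : C) :
  csum u l -> csum v m -> csum (fun n => u n - v n) (l - m).
Proof. exact (is_series_minus u v l m). Qed.

Lemma csum_unique (u : nat -> C) (l m : C) : csum u l -> csum u m -> l = m.
Proof.
  intros H1 H2.
  exact (@filterlim_locally_unique nat C_AbsRing C_NormedModule _ _ _ _ _ H1 H2).
Qed.

Lemma csum_behead (u : nat -> C) (l : C) :
  csum u l -> csum (fun n => u (S n)) (l - u O).
Proof.
  intros H. apply (is_series_incr_1 (V := C_NormedModule)).
  match goal with |- is_series _ ?x => replace x with (l : C_NormedModule) end;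
    [exact H|].
  change (l = l - u O + u O). ring.
Qed.

Lemma csum_cons (u : nat -> C) (l : C) :
  csum (fun n => u (S n)) l -> csum u (u O + l).
Proof.
  intros H. apply (is_series_decr_1 (V := C_NormedModule)).
  match goal with |- is_series _ ?x => replace x with (l : C_NormedModule) end;
    [exact H|].
  change (l = u O + l + - u O). ring.
Qed.

Lemma csum_zero : csum (fun _ => 0) 0.
Proof.
  unfold csum, is_series.
  apply filterlim_ext with (fun _ : nat => zero : C_NormedModule).
  - intros n. induction n as [|n IH]; [now rewrite sum_O|].
    rewrite sum_Sn, <- IH. symmetry. exact (Cplus_0_r 0).
  - apply filterlim_const.
Qed.

Lemma csum_first (u : nat -> C) : (forall n, u (S n) = 0) -> csum u (u O).
Proof.
  intros H. replace (u O) with (u O + 0) by ring.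
  apply csum_cons. apply csum_ext with (fun _ => 0); [auto|apply csum_zero].
Qed.

Lemma Re_sum_n (u : nat -> C) (n : nat) :
  Re (@sum_n C_NormedModule u n) = sum_n (fun k => Re (u k)) n
  /\ Im (@sum_n C_NormedModule u n) = sum_n (fun k => Im (u k)) n.
Proof.
  induction n as [|n [IH1 IH2]].
  - now rewrite !sum_O.
  - rewrite !sum_Sn, <- IH1, <- IH2. split; reflexivity.
Qed.

Lemma csum_Re_Im (u : nat -> C) (l : C) :
  csum u l ->
  is_series (fun n => Re (u n)) (Re l) /\ is_series (fun n => Im (u n)) (Im l).
Proof.
  intros H. split; unfold is_series.
  - apply filterlim_ext with (fun n => fst (@sum_n C_NormedModule u n)).
    { intros n. apply Re_sum_n. }
    eapply filterlim_comp; [exact H|].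
    intros P [e He]. exists e. intros y [Hy _]. now apply He.
  - apply filterlim_ext with (fun n => snd (@sum_n C_NormedModule u n)).
    { intros n. apply Re_sum_n. }
    eapply filterlim_comp; [exact H|].
    intros P [e He]. exists e. intros y [_ Hy]. now apply He.
Qed.

Lemma csum_CSeries (u : nat -> C) (l : C) : csum u l -> CSeries u = l.
Proof.
  intros H. destruct (csum_Re_Im u l H) as [H1 H2]. unfold CSeries.
  rewrite (is_series_unique _ _ H1), (is_series_unique _ _ H2).
  now destruct l.
Qed.

Lemma csum_dominated (u : nat -> C) (v : nat -> R) :
  (forall n, (Cmod (u n) <= v n)%R) -> ex_series v ->
  csum u (CSeries u) /\ (Cmod (CSeries u) <= Series v)%R.
Proof.
  intros Hle Hv.
  assert (Hex : exists l : C, csum u l).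
  { exact (@ex_series_le C_AbsRing C_CompleteNormedModule u v Hle Hv). }
  destruct Hex as [l Hl].
  rewrite (csum_CSeries u l Hl). split; [exact Hl|].
  apply Rnot_lt_le. intros Hlt.
  set (e := (Cmod l - Series v)%R). assert (He : (0 < e)%R) by (unfold e; lra).
  assert (Hb : forall n, (Cmod (@sum_n C_NormedModule u n) <= Series v)%R).
  { intros n. apply Rle_trans with (sum_n v n).
    - induction n as [|n IH].
      + rewrite !sum_O. apply Hle.
      + rewrite !sum_Sn. eapply Rle_trans; [apply Cmod_triangle|].
        apply Rplus_le_compat; auto.
    - apply Series_correct in Hv.
      apply (is_lim_seq_incr_compare (sum_n v) (Series v)); [exact Hv|].
      intros m. rewrite sum_Sn. change (sum_n v m <= sum_n v m + v (S m))%R.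
      pose proof (Hle (S m)). pose proof (Cmod_ge_0 (u (S m))). lra. }
  assert (Hn : exists n, (Cmod (@sum_n C_NormedModule u n - l) < e)%R).
  { assert (Hloc := proj1 (filterlim_locally_ball_norm (K := C_AbsRing)
      (U := C_NormedModule) (sum_n u) l) Hl (mkposreal e He)).
    destruct Hloc as [N HN]. exists N.
    apply (HN N). lia. }
  destruct Hn as [n Hn]. specialize (Hb n).
  pose proof (Cmod_triangle (@sum_n C_NormedModule u n)
    (- (@sum_n C_NormedModule u n - l))) as Ht.
  rewrite Cmod_opp in Ht.
  replace (@sum_n C_NormedModule u n + - (@sum_n C_NormedModule u n - l)) with l in Ht.
  - unfold e in Hn. lra.
  - generalize (@sum_n C_NormedModule u n). intros s.
    change (l = s + - (s - l) :> C). ring.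
Qed.

Lemma csum_bound (u : nat -> C) (v : nat -> R) (l : C) :
  (forall n, (Cmod (u n) <= v n)%R) -> ex_series v -> csum u l ->
  (Cmod l <= Series v)%R.
Proof.
  intros H1 H2 H3. destruct (csum_dominated u v H1 H2) as [H4 H5].
  now rewrite (csum_unique _ _ _ H3 H4).
Qed.

Fixpoint psum (u : nat -> C) (n : nat) : C :=
  match n with O => 0 | S m => psum u m + u m end.

Lemma psum_sum_n (u : nat -> C) (n : nat) :
  @sum_n C_NormedModule u n = psum u (S n).
Proof.
  induction n as [|n IH].
  - rewrite sum_O. simpl. ring.
  - rewrite sum_Sn, IH. reflexivity.
Qed.

Definition clim (u : nat -> C) (l : C) : Prop :=
  forall e : R, (0 < e)%R ->
    exists N, forall n, (N <= n)%nat -> (Cmod (u n - l) < e)%R.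

Lemma csum_clim (u : nat -> C) (l : C) : csum u l <-> clim (psum u) l.
Proof.
  unfold csum, is_series. split.
  - intros H e He.
    destruct (proj1 (filterlim_locally_ball_norm (K := C_AbsRing)
      (U := C_NormedModule) (sum_n u) l) H (mkposreal e He)) as [N HN].
    exists (S N). intros [|n] Hn; [lia|].
    rewrite <- psum_sum_n. apply HN. lia.
  - intros H. apply (proj2 (filterlim_locally_ball_norm (K := C_AbsRing)
      (U := C_NormedModule) (sum_n u) l)).
    intros [e He]. destruct (H e He) as [N HN]. exists N. intros n Hn.
    unfold ball_norm. rewrite psum_sum_n. apply HN. lia.
Qed.

Lemma clim_unique (u : nat -> C) (l m : C) : clim u l -> clim u m -> l = m.
Proof.
  intros H1 H2. destruct (Req_dec (Cmod (l - m)) 0) as [H|H].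
  - apply Cmod_eq_0 in H. replace l with (l - m + m) by ring. rewrite H. ring.
  - pose proof (Cmod_ge_0 (l - m)). set (e := (Cmod (l - m) / 2)%R).
    destruct (H1 e) as [N1 HN1]; [unfold e; lra|].
    destruct (H2 e) as [N2 HN2]; [unfold e; lra|].
    specialize (HN1 (N1 + N2)%nat ltac:(lia)).
    specialize (HN2 (N1 + N2)%nat ltac:(lia)).
    pose proof (Cmod_triangle (- (u (N1+N2)%nat - l)) (u (N1+N2)%nat - m)) as Ht.
    rewrite Cmod_opp in Ht.
    replace (- (u (N1 + N2)%nat - l) + (u (N1 + N2)%nat - m)) with (l - m) in Ht by ring.
    unfold e in *. lra.
Qed.

Lemma clim_Clim (u : nat -> C) (l : C) : clim u l -> Clim u = l.
Proof.
  intros H. unfold Clim.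
  assert (H1 : is_lim_seq (fun n => Re (u n)) (Re l)).
  { apply is_lim_seq_spec. intros [e He]. destruct (H e He) as [N HN].
    exists N. intros n Hn. simpl. eapply Rle_lt_trans; [|apply (HN n Hn)].
    exact (re_le_Cmod (u n - l)). }
  assert (H2 : is_lim_seq (fun n => Im (u n)) (Im l)).
  { apply is_lim_seq_spec. intros [e He]. destruct (H e He) as [N HN].
    exists N. intros n Hn. simpl. eapply Rle_lt_trans; [|apply (HN n Hn)].
    eapply Rle_trans; [|apply Rmax_Cmod]. exact (Rmax_r _ (Rabs (Im (u n) - Im l))). }
  rewrite (is_lim_seq_unique _ _ H1), (is_lim_seq_unique _ _ H2).
  now destruct l.
Qed.

Lemma clim_ext (u v : nat -> C) (l : C) :
  (forall n, u n = v n) -> clim u l -> clim v l.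
Proof.
  intros H1 H2 e He. destruct (H2 e He) as [N HN]. exists N.
  intros n Hn. rewrite <- H1. auto.
Qed.

Lemma clim_const (c : C) : clim (fun _ => c) c.
Proof.
  intros e He. exists O. intros n _. replace (c - c) with (RtoC 0) by ring.
  now rewrite Cmod_0.
Qed.

Lemma clim_plus (u v : nat -> C) (l m : C) :
  clim u l -> clim v m -> clim (fun n => u n + v n) (l + m).
Proof.
  intros H1 H2 e He.
  destruct (H1 (e/2)%R) as [N1 HN1]; [lra|].
  destruct (H2 (e/2)%R) as [N2 HN2]; [lra|].
  exists (N1 + N2)%nat. intros n Hn.
  replace (u n + v n - (l + m)) with ((u n - l) + (v n - m)) by ring.
  eapply Rle_lt_trans; [apply Cmod_triangle|].
  specialize (HN1 n ltac:(lia)). specialize (HN2 n ltac:(lia)). lra.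
Qed.

Lemma clim_mult (u v : nat -> C) (l m : C) :
  clim u l -> clim v m -> clim (fun n => u n * v n) (l * m).
Proof.
  intros H1 H2 e He.
  pose proof (Cmod_ge_0 l) as Hl. pose proof (Cmod_ge_0 m) as Hm.
  set (d := Rmin 1 (e / (Cmod l + Cmod m + 2))).
  assert (Hd : (0 < d)%R).
  { apply Rmin_pos; [lra|]. apply Rdiv_lt_0_compat; lra. }
  destruct (H1 d Hd) as [N1 HN1]. destruct (H2 d Hd) as [N2 HN2].
  exists (N1 + N2)%nat. intros n Hn.
  specialize (HN1 n ltac:(lia)). specialize (HN2 n ltac:(lia)).
  replace (u n * v n - l * m)
    with ((u n - l) * (v n - m) + ((u n - l) * m + l * (v n - m))) by ring.
  assert (Hd1 : (d <= 1)%R) by apply Rmin_l.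
  assert (Hd2 : (d * (Cmod l + Cmod m + 2) <= e)%R).
  { apply Rle_trans with (e / (Cmod l + Cmod m + 2) * (Cmod l + Cmod m + 2))%R.
    - apply Rmult_le_compat_r; [lra|apply Rmin_r].
    - apply Req_le. field. lra. }
  pose proof (Cmod_ge_0 (u n - l)). pose proof (Cmod_ge_0 (v n - m)).
  eapply Rle_lt_trans; [eapply Rle_trans;
    [apply Cmod_triangle|apply Rplus_le_compat_l; apply Cmod_triangle]|].
  rewrite !Cmod_mult. nra.
Qed.

Lemma clim_inv (u : nat -> C) (l : C) :
  l <> 0 -> clim u l -> clim (fun n => / u n) (/ l).
Proof.
  intros Hl Hu e He.
  assert (Hp : (0 < Cmod l)%R) by now apply Cmod_gt_0.
  set (d := Rmin (Cmod l / 2) (e * (Cmod l * Cmod l) / 2)).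
  destruct (Hu d) as [N HN].
  { apply Rmin_pos; [lra|]. apply Rmult_lt_0_compat; [|lra].
    apply Rmult_lt_0_compat; [exact He|nra]. }
  exists N. intros n Hn. specialize (HN n Hn).
  assert (H1 : (Cmod (u n - l) < Cmod l / 2)%R) by (eapply Rlt_le_trans; [exact HN|apply Rmin_l]).
  assert (H2 : (Cmod (u n - l) < e * (Cmod l * Cmod l) / 2)%R)
    by (eapply Rlt_le_trans; [exact HN|apply Rmin_r]).
  pose proof (Cmod_triangle (- (u n - l)) (u n)) as T. rewrite Cmod_opp in T.
  replace (- (u n - l) + u n) with l in T by ring.
  assert (Hun : u n <> 0) by (apply Cmod_gt_0; lra).
  replace (/ u n - / l) with (- (u n - l) / (u n * l)) by (field; auto).
  rewrite Cmod_div by now apply Cmult_neq_0. rewrite Cmod_opp, Cmod_mult.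
  assert (Hul : (0 < Cmod (u n) * Cmod l)%R) by (apply Rmult_lt_0_compat; lra).
  apply Rmult_lt_reg_r with (Cmod (u n) * Cmod l)%R; [exact Hul|].
  unfold Rdiv. rewrite Rmult_assoc, Rinv_l by lra.
  assert (0 <= (e * Cmod l) * (Cmod (u n) - Cmod l / 2))%R.
  { apply Rmult_le_pos; [apply Rmult_le_pos|]; lra. }
  lra.
Qed.

Lemma clim_shift (u : nat -> C) (l : C) : clim u l -> clim (fun n => u (S n)) l.
Proof.
  intros H e He. destruct (H e He) as [N HN]. exists N. intros n Hn.
  apply HN. lia.
Qed.

Lemma clim_le (u : nat -> C) (l : C) (v : nat -> R) :
  (forall n, (Cmod (u n - l) <= v n)%R) -> is_lim_seq v 0 -> clim u l.
Proof.
  intros H Hv e He.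
  destruct (proj2 (is_lim_seq_spec _ _) Hv (mkposreal e He)) as [N HN].
  exists N. intros n Hn. eapply Rle_lt_trans; [apply H|].
  specialize (HN n Hn). simpl in HN. rewrite Rminus_0_r in HN.
  eapply Rle_lt_trans; [apply Rle_abs|exact HN].
Qed.

Lemma eventually_bounded (u : nat -> R) (N : nat) (B : R) :
  (forall n, (N <= n)%nat -> (u n <= B)%R) ->
  exists M, (0 <= M)%R /\ forall n, (u n <= M)%R.
Proof.
  revert B. induction N as [|N IH]; intros B H.
  - exists (Rmax 0 B). split; [apply Rmax_l|]. intros n.
    eapply Rle_trans; [apply H; lia|apply Rmax_r].
  - apply (IH (Rmax B (u N))). intros n Hn.
    destruct (Nat.eq_dec n N) as [->|]; [apply Rmax_r|].
    eapply Rle_trans; [apply H; lia|apply Rmax_l].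
Qed.

Lemma clim_bounded (u : nat -> C) (l : C) :
  clim u l -> exists M, (0 <= M)%R /\ forall n, (Cmod (u n) <= M)%R.
Proof.
  intros H. destruct (H 1%R ltac:(lra)) as [N HN].
  apply (eventually_bounded (fun n => Cmod (u n)) N (1 + Cmod l)).
  intros n Hn. specialize (HN n Hn). pose proof (Cmod_triangle (u n - l) l) as T.
  replace (u n - l + l) with (u n) in T by ring. lra.
Qed.

Lemma csum_terms_bounded (u : nat -> C) (l : C) :
  csum u l -> exists M, (0 <= M)%R /\ forall n, (Cmod (u n) <= M)%R.
Proof.
  intros H. destruct (clim_bounded _ _ (proj1 (csum_clim u l) H)) as [M [HM Hb]].
  exists (2 * M)%R. split; [lra|]. intros n.
  pose proof (Cmod_triangle (psum u (S n)) (- psum u n)) as T. rewrite Cmod_opp in T.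
  replace (psum u (S n) + - psum u n) with (u n) in T by (simpl; ring).
  pose proof (Hb n). pose proof (Hb (S n)). lra.
Qed.

Lemma mult_lt_of_lt_div (x k e : R) : (0 < k)%R -> (x < e / k)%R -> (x * k < e)%R.
Proof.
  intros Hk H. apply Rmult_lt_compat_r with (r := k) in H; [|exact Hk].
  replace (e / k * k)%R with e in H by (field; lra). exact H.
Qed.

Lemma csum_psum (u : nat -> nat -> C) (f : nat -> C) (N : nat) :
  (forall n, csum (u n) (f n)) ->
  csum (fun m => psum (fun n => u n m) N) (psum f N).
Proof.
  intros H. induction N as [|N IH]; simpl.
  - apply csum_zero.
  - now apply csum_plus.
Qed.

Lemma ex_series_mult_l (c : R) (a : nat -> R) :
  ex_series a -> ex_series (fun n => c * a n)%R.
Proof. exact (ex_series_scal c a). Qed.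

Lemma csum_psum_tail (u : nat -> C) (al : nat -> R) (l : C) (K : R) (N : nat) :
  (0 <= K)%R ->
  (forall n, (Cmod (u n) <= al n * K)%R) -> ex_series al -> csum u l ->
  (Cmod (l - psum u N) <= (Series al - sum_n al N + al N) * K)%R.
Proof.
  intros HK Hu Hal Hl.
  assert (Hs : csum (fun n => u (N + n)%nat) (l - psum u N)).
  { clear Hu Hal. induction N as [|N IH].
    - simpl. replace (l - 0) with l by ring. exact Hl.
    - apply csum_behead in IH. simpl in *.
      replace (l - (psum u N + u N)) with (l - psum u N - u (N + 0)%nat).
      + eapply csum_ext; [|exact IH]. intros n. simpl. f_equal. lia.
      + rewrite Nat.add_0_r. ring. }
  eapply Rle_trans;
    [apply (csum_bound _ (fun n => K * al (N + n)%nat)%R) with (3 := Hs)|].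
  - intros n. rewrite Rmult_comm. apply Hu.
  - apply ex_series_mult_l. now apply ex_series_incr_n.
  - rewrite Series_scal_l, Rmult_comm. apply Rmult_le_compat_r; [exact HK|].
    apply Req_le. destruct N as [|N].
    + rewrite sum_O. rewrite (Series_ext (fun n => al (0 + n)%nat) al); [ring|auto].
    + rewrite (Series_incr_n al (S N)); [|lia|exact Hal]. simpl pred.
      rewrite <- sum_n_Reals, sum_Sn. change (@plus R_AbelianMonoid) with Rplus. 
      unfold plus; simpl. ring.
Qed.

(** Truncating the sum over [n] leaves an error bounded by the tail of [al] times
    the total of [be].  All the double series below have a majorant of this
    product form. *)
Lemma csum_interchange (u : nat -> nat -> C) (al be : nat -> R) (f g : nat -> C) :
  (forall n, (0 <= al n)%R) -> (forall m, (0 <= be m)%R) ->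
  ex_series al -> ex_series be ->
  (forall n m, (Cmod (u n m) <= al n * be m)%R) ->
  (forall n, csum (u n) (f n)) ->
  (forall m, csum (fun n => u n m) (g m)) ->
  exists S, csum f S /\ csum g S.
Proof.
  intros Hal0 Hbe0 Hal Hbe Hu Hf Hg.
  assert (Hgb : forall m, (Cmod (g m) <= Series al * be m)%R).
  { intros m. eapply Rle_trans;
      [apply (csum_bound _ (fun n => be m * al n)%R _) with (3 := Hg m)|].
    - intros n. rewrite Rmult_comm. apply Hu.
    - now apply ex_series_mult_l.
    - rewrite Series_scal_l. lra. }
  destruct (csum_dominated g (fun m => Series al * be m)%R Hgb) as [Hgs _].
  { now apply ex_series_mult_l. }
  exists (CSeries g). split; [|exact Hgs].
  apply csum_clim.
  apply clim_le with (fun N => (Series al - sum_n al N + al N) * Series be)%R.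
  - intros N.
    pose proof (csum_psum u f N Hf) as H1.
    pose proof (csum_minus _ _ _ _ Hgs H1) as H2.
    replace (psum f N - CSeries g) with (- (CSeries g - psum f N)) by ring.
    rewrite Cmod_opp.
    eapply Rle_trans; [eapply csum_bound with
      (v := fun m => ((Series al - sum_n al N + al N) * be m)%R); [| |exact H2]|].
    + intros m. simpl. apply csum_psum_tail; auto.
    + now apply ex_series_mult_l.
    + rewrite Series_scal_l. lra.
  - replace (Finite 0) with (Finite ((Series al - Series al + 0) * Series be)%R).
    2:{ f_equal. ring. }
    apply is_lim_seq_mult'; [|apply is_lim_seq_const].
    apply is_lim_seq_plus'.
    + apply is_lim_seq_minus'; [apply is_lim_seq_const|].
      exact (Series_correct _ Hal).
    + now apply ex_series_lim_0.
Qed.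

(** * Power series *)

Lemma csum_shift (v : nat -> C) (l : C) (n : nat) :
  csum v l -> csum (fun N => if (n <=? N)%nat then v (N - n)%nat else 0) l.
Proof.
  intros H. induction n as [|n IH].
  - eapply csum_ext; [|exact H]. intros N. simpl. f_equal. lia.
  - replace l with (0 + l) by ring.
    apply (csum_cons (fun N => if (S n <=? N)%nat then v (N - S n)%nat else 0)).
    exact IH.
Qed.

Lemma csum_finite (u : nat -> C) (N : nat) :
  (forall n, (N <= n)%nat -> u n = 0) -> csum u (psum u N).
Proof.
  intros H. apply csum_clim. intros e He. exists N. intros n Hn.
  replace (psum u n) with (psum u N).
  - replace (psum u N - psum u N) with (RtoC 0) by ring. now rewrite Cmod_0.
  - induction n as [|n IH]; [now replace N with O by lia|].
    destruct (Nat.eq_dec N (S n)) as [->|]; [reflexivity|].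
    simpl. rewrite <- IH by lia. rewrite H by lia. ring.
Qed.

Lemma psum_ext_lt (u v : nat -> C) n :
  (forall k, (k < n)%nat -> u k = v k) -> psum u n = psum v n.
Proof.
  intros H. induction n; simpl; [auto|].
  rewrite IHn by (intros; apply H; lia). now rewrite H by lia.
Qed.

Lemma psum_scal (c : C) (u : nat -> C) n : psum (fun k => c * u k) n = c * psum u n.
Proof. induction n; simpl; [ring|]. rewrite IHn. ring. Qed.

Lemma psum_head (u : nat -> C) n : psum u (S n) = u O + psum (fun k => u (S k)) n.
Proof.
  induction n; [simpl; ring|].
  change (psum u (S (S n))) with (psum u (S n) + u (S n)). rewrite IHn.
  simpl. ring.
Qed.

Definition geom_bounded (c : nat -> C) (M s : R) : Prop :=
  (0 <= M)%R /\ (0 < s)%R /\ forall n, (Cmod (c n) <= M * s ^ n)%R.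

Lemma ex_series_geometric (M rho : R) :
  (0 <= rho < 1)%R -> ex_series (fun n => M * rho ^ n)%R.
Proof.
  intros H. apply ex_series_mult_l. apply ex_series_geom.
  rewrite Rabs_pos_eq; lra.
Qed.

Lemma csum_geom (u : nat -> C) (M rho : R) :
  (0 <= rho < 1)%R -> (forall n, (Cmod (u n) <= M * rho ^ n)%R) ->
  csum u (CSeries u) /\ (Cmod (CSeries u) <= M * / (1 - rho))%R.
Proof.
  intros Hr Hu.
  destruct (csum_dominated u (fun n => M * rho ^ n)%R Hu) as [H1 H2].
  { now apply ex_series_geometric. }
  split; [exact H1|]. rewrite Series_scal_l in H2.
  rewrite Series_geom in H2; [exact H2|]. rewrite Rabs_pos_eq; lra.
Qed.

Lemma csum_power_series (c : nat -> C) (M s : R) (y : C) :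
  geom_bounded c M s -> (Cmod y * s < 1)%R ->
  csum (fun n => c n * y ^ n) (power_series c y).
Proof.
  intros (HM & Hs & Hc) Hy.
  apply (csum_geom _ M (Cmod y * s)).
  - split; [|exact Hy]. apply Rmult_le_pos; [apply Cmod_ge_0|lra].
  - intros n. rewrite Cmod_mult, Cmod_pow, Rpow_mult_distr.
    pose proof (pow_le (Cmod y) n (Cmod_ge_0 y)). specialize (Hc n). nra.
Qed.

Lemma power_series_0 (c : nat -> C) : power_series c 0 = c O.
Proof.
  rewrite <- (Cmult_1_r (c O)). apply csum_CSeries.
  apply (csum_first (fun n => c n * 0 ^ n)). intros n. simpl. ring.
Qed.

Lemma power_series_pow_mult (c : nat -> C) (t y : C) :
  power_series (fun n => c n * t ^ n) y = power_series c (t * y).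
Proof.
  unfold power_series. f_equal. apply functional_extensionality. intros n.
  rewrite Cpow_mult_l. ring.
Qed.

Definition conv (a b : nat -> C) (n : nat) : C :=
  psum (fun k => a k * b (n - k)%nat) (S n).

Lemma csum_product (a b : nat -> C) (M M' s : R) (y : C) :
  geom_bounded a M s -> geom_bounded b M' s -> (Cmod y * s < 1)%R ->
  csum (fun n => conv a b n * y ^ n) (power_series a y * power_series b y).
Proof.
  intros Ha Hb Hy.
  pose proof (csum_power_series a M s y Ha Hy) as Sa.
  pose proof (csum_power_series b M' s y Hb Hy) as Sb.
  destruct Ha as (HM & Hs & Ha). destruct Hb as (HM' & _ & Hb).
  set (rho := (Cmod y * s)%R) in *.
  assert (Hrho : (0 <= rho)%R).
  { apply Rmult_le_pos; [apply Cmod_ge_0|lra]. }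
  (* The (n, N) term is at most M M' rho^N, and rho^N <= sg^n sg^N as n <= N. *)
  set (sg := sqrt rho).
  assert (Hsg : (0 <= sg < 1)%R).
  { split; [apply sqrt_pos|]. rewrite <- sqrt_1. apply sqrt_lt_1; lra. }
  assert (Hsg2 : (sg * sg = rho)%R) by (apply sqrt_sqrt; lra).
  destruct (csum_interchange
    (fun n N => if (n <=? N)%nat then a n * b (N - n)%nat * y ^ N else 0)
    (fun n => M * sg ^ n)%R (fun N => M' * sg ^ N)%R
    (fun n => a n * y ^ n * power_series b y)
    (fun N => conv a b N * y ^ N)) as [S [H1 H2]].
  - intros n. apply Rmult_le_pos; [lra|]. apply pow_le. lra.
  - intros n. apply Rmult_le_pos; [lra|]. apply pow_le. lra.
  - now apply ex_series_geometric.
  - now apply ex_series_geometric.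
  - intros n N. destruct (Nat.leb_spec n N) as [H|H].
    + rewrite !Cmod_mult, Cmod_pow.
      apply Rle_trans with ((M * s ^ n) * (M' * s ^ (N - n)) * Cmod y ^ N)%R.
      * apply Rmult_le_compat_r; [apply pow_le, Cmod_ge_0|].
        apply Rmult_le_compat; auto using Cmod_ge_0.
      * replace ((M * s ^ n) * (M' * s ^ (N - n)) * Cmod y ^ N)%R
          with (M * M' * rho ^ N)%R.
        2:{ unfold rho. rewrite Rpow_mult_distr.
            replace (s ^ N)%R with (s ^ n * s ^ (N - n))%R; [ring|].
            rewrite <- pow_add. f_equal. lia. }
        rewrite <- Hsg2, Rpow_mult_distr.
        assert (sg ^ N <= sg ^ n)%R.
        { replace N with (n + (N - n))%nat by lia. rewrite pow_add.
          rewrite <- (Rmult_1_r (sg ^ n)) at 2.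
          apply Rmult_le_compat_l; [apply pow_le; lra|].
          rewrite <- (pow1 (N - n)). apply pow_incr. lra. }
        pose proof (pow_le sg N (proj1 Hsg)).
        assert (0 <= M * M')%R by (apply Rmult_le_pos; lra).
        replace (M * sg ^ n * (M' * sg ^ N))%R
          with (M * M' * (sg ^ n * sg ^ N))%R by ring.
        apply Rmult_le_compat_l; [assumption|]. nra.
    + rewrite Cmod_0. apply Rmult_le_pos; (apply Rmult_le_pos; [lra|apply pow_le; lra]).
  - intros n.
    apply csum_ext with (fun N => a n * y ^ n *
      (if (n <=? N)%nat then b (N - n)%nat * y ^ (N - n)%nat else 0)).
    + intros N. destruct (Nat.leb_spec n N) as [H|H]; [|ring].
      replace (y ^ N) with (y ^ n * y ^ (N - n)); [ring|].
      rewrite <- Cpow_add_r. f_equal. lia.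
    + apply csum_scal. exact (csum_shift (fun k => b k * y ^ k) _ n Sb).
  - intros N.
    set (u := fun n => if (n <=? N)%nat then a n * b (N - n)%nat * y ^ N else 0).
    replace (conv a b N * y ^ N) with (psum u (S N)).
    + apply csum_finite. intros n Hn. unfold u.
      destruct (Nat.leb_spec n N); [lia|reflexivity].
    + unfold conv. rewrite Cmult_comm, <- psum_scal.
      apply psum_ext_lt. intros k Hk. unfold u.
      destruct (Nat.leb_spec k N); [ring|lia].
  - replace (power_series a y * power_series b y) with S; [exact H2|].
    apply (csum_unique _ _ _ H1).
    apply csum_ext with (fun n => power_series b y * (a n * y ^ n)).
    { intros n. ring. }
    rewrite Cmult_comm. now apply csum_scal.
Qed.

Lemma geom_bounded_conv (a b : nat -> C) (M M' s : R) :
  geom_bounded a M s -> geom_bounded b M' s ->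
  geom_bounded (conv a b) (M * M') (2 * s).
Proof.
  intros (HM & Hs & Ha) (HM' & _ & Hb). repeat split.
  - now apply Rmult_le_pos.
  - lra.
  - intros n. unfold conv.
    assert (H : forall m, (m <= S n)%nat ->
      (Cmod (psum (fun k => a k * b (n - k)%nat)%C m) <= INR m * (M * M' * s ^ n))%R).
    { induction m as [|m IH]; intros Hm; simpl psum.
      - rewrite Cmod_0. simpl. lra.
      - rewrite S_INR. eapply Rle_trans; [apply Cmod_triangle|].
        specialize (IH ltac:(lia)). rewrite Cmod_mult.
        assert (Cmod (a m) * Cmod (b (n - m)%nat) <= M * M' * s ^ n)%R.
        { replace (s ^ n)%R with (s ^ m * s ^ (n - m))%R.
          - replace (M * M' * (s ^ m * s ^ (n - m)))%R
              with ((M * s ^ m) * (M' * s ^ (n - m)))%R by ring.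
            apply Rmult_le_compat; auto using Cmod_ge_0.
          - rewrite <- pow_add. f_equal. lia. }
        lra. }
    eapply Rle_trans; [apply H; lia|].
    rewrite Rpow_mult_distr.
    assert (INR (S n) <= 2 ^ n)%R.
    { clear. induction n as [|n IH]; [simpl; lra|].
      rewrite S_INR. simpl pow. assert (1 <= 2 ^ n)%R by (apply pow_R1_Rle; lra). lra. }
    assert (0 <= M * M')%R by (apply Rmult_le_pos; lra).
    pose proof (pow_le s n (Rlt_le _ _ Hs)).
    assert (0 <= M * M' * s ^ n)%R by (apply Rmult_le_pos; lra). nra.
Qed.

Lemma geom_bounded_weaken (a : nat -> C) (M s t : R) :
  geom_bounded a M s -> (s <= t)%R -> geom_bounded a M t.
Proof.
  intros (HM & Hs & Ha) Ht. repeat split; [lra|lra|]. intros n.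
  eapply Rle_trans; [apply Ha|]. apply Rmult_le_compat_l; [lra|].
  apply pow_incr. lra.
Qed.

(** ** Reciprocal of a power series *)

(** A coefficient of [1 / p] depends on all the earlier ones, so the recursion
    builds the whole table: only its entries up to index [n] are meaningful. *)
Fixpoint inv_table (p : nat -> C) (n : nat) : nat -> C :=
  match n with
  | O => fun _ => / p O
  | S m => fun k =>
      if (k <=? m)%nat then inv_table p m k
      else - / p O * psum (fun j => p (S j) * inv_table p m (m - j)%nat) (S m)
  end.

Definition inv_coef (p : nat -> C) (n : nat) : C := inv_table p n n.

Lemma inv_table_stable (p : nat -> C) n k : (k <= n)%nat -> inv_table p n k = inv_coef p k.
Proof.
  induction n as [|n IH]; intros H.
  - now replace k with O by lia.
  - destruct (Nat.eq_dec k (S n)) as [->|]; [reflexivity|].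
    simpl. destruct (Nat.leb_spec k n); [apply IH; lia|lia].
Qed.

Lemma inv_coef_S (p : nat -> C) n :
  inv_coef p (S n)
  = - / p O * psum (fun j => p (S j) * inv_coef p (n - j)%nat) (S n).
Proof.
  unfold inv_coef at 1.
  change (inv_table p (S n) (S n)) with (if (S n <=? n)%nat then inv_table p n (S n)
    else - / p O * psum (fun j => p (S j) * inv_table p n (n - j)%nat) (S n)).
  destruct (Nat.leb_spec (S n) n); [lia|].
  f_equal. apply psum_ext_lt. intros k Hk. f_equal. apply inv_table_stable. lia.
Qed.

Lemma conv_inv_coef (p : nat -> C) n :
  p O <> 0 -> conv p (inv_coef p) n = match n with O => 1 | _ => 0 end.
Proof.
  intros Hp. unfold conv. rewrite psum_head. destruct n as [|n].
  - simpl. unfold inv_coef. simpl. field. exact Hp.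
  - rewrite Nat.sub_0_r, inv_coef_S. simpl Nat.sub. field. exact Hp.
Qed.

Lemma geom_bounded_inv (p : nat -> C) (M s : R) :
  p O <> 0 -> geom_bounded p M s ->
  exists t, (s <= t)%R /\ geom_bounded (inv_coef p) (/ Cmod (p O)) t.
Proof.
  intros Hp (HM & Hs & Hb).
  assert (H0 : (0 < Cmod (p O))%R) by now apply Cmod_gt_0.
  pose (d := Cmod (p O)). fold d in H0.
  (* 1/L is the zero of the majorant |p_0| - M s y / (1 - s y). *)
  set (L := (s * (M + d) / d)%R).
  assert (HL : (L * d = s * (M + d))%R) by (unfold L; field; lra).
  assert (HLs : (s <= L)%R).
  { apply Rmult_le_reg_r with d; [exact H0|]. rewrite HL. nra. }
  exists L. split; [exact HLs|]. fold d.
  assert (Hd : (0 < / d)%R) by now apply Rinv_0_lt_compat.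
  repeat split; [lra|lra|].
  induction n as [n IH] using lt_wf_ind.
  destruct n as [|n].
  - unfold inv_coef. simpl. rewrite Cmod_inv by exact Hp. fold d. lra.
  - rewrite inv_coef_S, Cmod_mult, Cmod_opp, Cmod_inv by exact Hp. fold d.
    apply Rmult_le_compat_l; [lra|].
    apply Rle_trans with (/ d * (d * L ^ S n))%R; [|apply Req_le; field; lra].
    assert (H : forall m (u : nat -> C) r, (forall j, (j < S m)%nat ->
        (Cmod (u j) <= r * s ^ j * (M * s * / d * L ^ (m - j)))%R) ->
        (0 <= r)%R ->
        (Cmod (psum u (S m)) <= r * (/ d * (d * L ^ S m)))%R).
    { clear - H0 Hd HL HLs Hs HM.
      induction m as [|m IH]; intros u r Hu Hr.
      - simpl psum. specialize (Hu O ltac:(lia)). simpl in Hu.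
        replace (0 + u O) with (u O) by ring. eapply Rle_trans; [exact Hu|].
        replace (r * 1 * (M * s * / d * 1))%R with (r * / d * (M * s))%R by ring.
        replace (r * (/ d * (d * L ^ 1)))%R with (r * / d * (L * d))%R by (simpl; ring).
        apply Rmult_le_compat_l; [apply Rmult_le_pos; lra|]. rewrite HL. nra.
      - rewrite psum_head.
        assert (H1 : (Cmod (u O) <= r * / d * (M * s * L ^ S m))%R).
        { eapply Rle_trans; [apply (Hu O); lia|]. simpl Nat.sub. simpl (s ^ 0)%R.
          apply Req_le. ring. }
        assert (H2 : (Cmod (psum (fun k => u (S k)) (S m)) <= (r * s) * (/ d * (d * L ^ S m)))%R).
        { apply IH; [|nra]. intros j Hj. eapply Rle_trans; [apply (Hu (S j)); lia|].
          simpl Nat.sub. apply Req_le. simpl pow. ring. }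
        eapply Rle_trans; [apply Cmod_triangle|].
        eapply Rle_trans; [apply Rplus_le_compat; [exact H1|exact H2]|].
        apply Req_le.
        replace (r * (/ d * (d * L ^ S (S m))))%R
          with (r * / d * (L * d) * L ^ S m)%R by (simpl; ring).
        rewrite HL. ring. }
    eapply Rle_trans; [apply (H n _ 1%R)|].
    + intros j Hj. rewrite Cmod_mult.
      replace (1 * s ^ j * (M * s * / d * L ^ (n - j)))%R
        with ((M * s ^ S j) * (/ d * L ^ (n - j)))%R by (simpl; ring).
      apply Rmult_le_compat; auto using Cmod_ge_0. apply IH. lia.
    + lra.
    + apply Req_le. ring.
Qed.

(** * Analytic functions *)

(** [analytic_at] with an explicit majorant of the coefficients instead of a
    radius, which is the form that products and reciprocals propagate. *)
Definition expands (g : C -> C) (z : C) (a : nat -> C) (M s : R) : Prop :=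
  geom_bounded a M s /\
  forall y, (Cmod y * s < 1)%R -> g (z + y) = power_series a y.

Lemma is_pseries_csum (a : nat -> C) (y l : C) :
  @is_pseries C_AbsRing C_NormedModule a y l <-> csum (fun n => a n * y ^ n) l.
Proof.
  assert (H : forall n, @scal C_Ring C_NormedModule (pow_n (K := C_Ring) y n) (a n)
                = a n * y ^ n).
  { intros n. apply Cmult_comm. }
  split; apply is_series_ext; intros n; [apply H|symmetry; apply H].
Qed.

Lemma analytic_expands (g : C -> C) (z : C) :
  analytic_at g z <-> exists a M s, expands g z a M s.
Proof.
  split.
  - intros (a & r & Hr & H).
    destruct (csum_terms_bounded (fun n => a n * RtoC (r / 2) ^ n) (g (z + RtoC (r/2))))
      as [M [HM Hb]].
    { apply is_pseries_csum.
      replace (RtoC (r / 2)) with (z + RtoC (r / 2) - z) at 1 by ring.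
      apply H. replace (z + RtoC (r / 2) - z) with (RtoC (r / 2)) by ring.
      rewrite Cmod_R, Rabs_pos_eq; lra. }
    exists a, M, (2 / r)%R. split; [repeat split|].
    + exact HM.
    + apply Rdiv_lt_0_compat; lra.
    + intros n. specialize (Hb n). rewrite Cmod_mult, Cmod_pow, Cmod_R in Hb.
      rewrite Rabs_pos_eq in Hb by lra.
      assert (Hp : (0 < (2 / r) ^ n)%R) by (apply pow_lt, Rdiv_lt_0_compat; lra).
      replace (Cmod (a n)) with (Cmod (a n) * (r / 2) ^ n * (2 / r) ^ n)%R.
      * now apply Rmult_le_compat_r; [lra|].
      * rewrite Rmult_assoc, <- Rpow_mult_distr.
        replace (r / 2 * (2 / r))%R with 1%R by (field; lra). rewrite pow1. ring.
    + intros y Hy. symmetry. apply csum_CSeries. apply is_pseries_csum.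
      replace y with (z + y - z) at 1 by ring. apply H.
      replace (z + y - z) with y by ring.
      apply Rmult_lt_reg_r with (2 / r)%R; [apply Rdiv_lt_0_compat; lra|].
      eapply Rlt_trans; [exact Hy|]. replace (r * (2 / r))%R with 2%R by (field; lra). lra.
  - intros (a & M & s & Hb & H). pose proof Hb as (_ & Hs & _).
    exists a, (/ s)%R. split; [now apply Rinv_0_lt_compat|].
    intros y Hy. apply is_pseries_csum.
    assert (Hy' : (Cmod (y - z) * s < 1)%R).
    { apply mult_lt_of_lt_div; lra. }
    replace (g y) with (power_series a (y - z)).
    + now apply csum_power_series with M s.
    + rewrite <- H by exact Hy'. f_equal. ring.
Qed.

Lemma expands_weaken g z a M s t :
  expands g z a M s -> (s <= t)%R -> expands g z a M t.
Proof.
  intros [H1 H2] Ht. split; [now apply geom_bounded_weaken with s|].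
  intros y Hy. apply H2. pose proof (Cmod_ge_0 y).
  destruct H1 as (_ & Hs & _). nra.
Qed.

Lemma analytic_minus f g z :
  analytic_at f z -> analytic_at g z -> analytic_at (fun y => f y - g y) z.
Proof.
  intros Hf Hg. apply analytic_expands in Hf, Hg. apply analytic_expands.
  destruct Hf as (a & M & s & Hf). destruct Hg as (b & M' & t & Hg).
  apply (expands_weaken _ _ _ _ _ (Rmax s t)) in Hf; [|apply Rmax_l].
  apply (expands_weaken _ _ _ _ _ (Rmax s t)) in Hg; [|apply Rmax_r].
  exists (fun n => a n - b n), (M + M')%R, (Rmax s t).
  destruct Hf as [Ha Hf]. destruct Hg as [Hb Hg]. split.
  - destruct Ha as (HM & Hs & Ha). destruct Hb as (HM' & _ & Hb).
    repeat split; [lra|exact Hs|]. intros n. rewrite Rmult_plus_distr_r.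
    eapply Rle_trans; [apply Cmod_triangle|]. rewrite Cmod_opp.
    now apply Rplus_le_compat.
  - intros y Hy. rewrite Hf, Hg by exact Hy. symmetry. apply csum_CSeries.
    apply csum_ext with (fun n => a n * y ^ n - b n * y ^ n); [intros; ring|].
    apply csum_minus; eapply csum_power_series; eauto.
Qed.

Lemma analytic_mult f g z :
  analytic_at f z -> analytic_at g z -> analytic_at (fun y => f y * g y) z.
Proof.
  intros Hf Hg. apply analytic_expands in Hf, Hg. apply analytic_expands.
  destruct Hf as (a & M & s & Hf). destruct Hg as (b & M' & t & Hg).
  apply (expands_weaken _ _ _ _ _ (Rmax s t)) in Hf; [|apply Rmax_l].
  apply (expands_weaken _ _ _ _ _ (Rmax s t)) in Hg; [|apply Rmax_r].
  destruct Hf as [Ha Hf]. destruct Hg as [Hb Hg].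
  exists (conv a b), (M * M')%R, (2 * Rmax s t)%R. split.
  - now apply geom_bounded_conv.
  - intros y Hy. assert (Hy' : (Cmod y * Rmax s t < 1)%R).
    { pose proof (Cmod_ge_0 y). destruct Ha as (_ & Hs & _). nra. }
    rewrite Hf, Hg by exact Hy'. symmetry. apply csum_CSeries.
    eapply csum_product; eauto.
Qed.

Lemma analytic_inv g z :
  analytic_at g z -> g z <> 0 -> analytic_at (fun y => / g y) z.
Proof.
  intros Hg Hz. apply analytic_expands in Hg. apply analytic_expands.
  destruct Hg as (p & M & s & Hp & Hg).
  assert (H0 : p O <> 0).
  { replace (p O) with (g z); [exact Hz|]. replace z with (z + 0) by ring.
    now rewrite Hg, power_series_0 by (rewrite Cmod_0; lra). }
  destruct (geom_bounded_inv p M s H0 Hp) as (t & Ht & Hr).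
  exists (inv_coef p), (/ Cmod (p O))%R, t. split; [exact Hr|].
  intros y Hy. pose proof (geom_bounded_weaken _ _ _ _ Hp Ht) as Hpt.
  rewrite Hg.
  2:{ pose proof (Cmod_ge_0 y). destruct Hp as (_ & Hs & _). nra. }
  assert (Hprod : power_series p y * power_series (inv_coef p) y = 1).
  { eapply csum_unique; [eapply csum_product; eauto|].
    assert (H1 : csum (fun n => conv p (inv_coef p) n * y ^ n)
                   (conv p (inv_coef p) O * y ^ O)).
    { apply (csum_first (fun n => conv p (inv_coef p) n * y ^ n)).
      intros n. rewrite conv_inv_coef by exact H0. ring. }
    rewrite conv_inv_coef in H1 by exact H0. simpl in H1.
    now rewrite Cmult_1_l in H1. }
  assert (Hne : power_series p y <> 0).
  { intros E. rewrite E, Cmult_0_l in Hprod. apply C1_nz. congruence. }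
  replace (power_series (inv_coef p) y)
    with (/ power_series p y * (power_series p y * power_series (inv_coef p) y))
    by (field; exact Hne).
  rewrite Hprod. ring.
Qed.

(** ** Entire functions *)

(** The radius of convergence is infinite. *)
Definition entire (c : nat -> C) : Prop :=
  forall r : R, (0 < r)%R ->
    exists M, (0 <= M)%R /\ forall n, (Cmod (c n) * r ^ n <= M)%R.

Lemma entire_geom (c : nat -> C) (s : R) :
  entire c -> (0 < s)%R -> exists M, geom_bounded c M s.
Proof.
  intros Hc Hs. destruct (Hc (/ s)%R) as [M [HM Hb]]; [now apply Rinv_0_lt_compat|].
  exists M. repeat split; [exact HM|exact Hs|]. intros n. specialize (Hb n).
  assert (Hp : (0 < s ^ n)%R) by now apply pow_lt.
  replace (Cmod (c n)) with (Cmod (c n) * (/ s) ^ n * s ^ n)%R.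
  - apply Rmult_le_compat_r; [lra|exact Hb].
  - rewrite Rmult_assoc, <- Rpow_mult_distr, Rinv_l, pow1 by lra. ring.
Qed.

Lemma csum_entire (c : nat -> C) (y : C) :
  entire c -> csum (fun n => c n * y ^ n) (power_series c y).
Proof.
  intros Hc. pose proof (Cmod_ge_0 y).
  assert (Hi : (0 < / (Cmod y + 1))%R) by (apply Rinv_0_lt_compat; lra).
  destruct (entire_geom c (/ (Cmod y + 1)) Hc Hi) as [M HM].
  apply csum_power_series with M (/ (Cmod y + 1))%R; [exact HM|].
  apply Rmult_lt_reg_r with (Cmod y + 1)%R; [lra|].
  rewrite Rmult_assoc, Rinv_l by lra. lra.
Qed.

Lemma power_series_bounded (c : nat -> C) (r : R) :
  entire c -> (0 < r)%R ->
  exists K, (0 <= K)%R /\ forall u, (Cmod u <= r)%R -> (Cmod (power_series c u) <= K)%R.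
Proof.
  intros Hc Hr. destruct (entire_geom c (/ (2 * r)) Hc) as [M HM].
  { apply Rinv_0_lt_compat. lra. }
  pose proof HM as (HM0 & _ & Hb).
  exists (M * / (1 - / 2))%R. split.
  { apply Rmult_le_pos; [lra|]. replace (/ (1 - / 2))%R with 2%R by field. lra. }
  intros u Hu. apply (csum_geom (fun n => c n * u ^ n) M (/ 2)); [lra|].
  intros n. rewrite Cmod_mult, Cmod_pow.
  apply Rle_trans with (M * (/ (2 * r)) ^ n * r ^ n)%R.
  - apply Rmult_le_compat; auto using Cmod_ge_0.
    + apply pow_le, Cmod_ge_0.
    + apply pow_incr. split; [apply Cmod_ge_0|exact Hu].
  - rewrite Rmult_assoc, <- Rpow_mult_distr. apply Req_le. f_equal. f_equal. field. lra.
Qed.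

Lemma entire_lin (a b : C) (c d : nat -> C) :
  entire c -> entire d -> entire (fun n => a * c n + b * d n).
Proof.
  intros Hc Hd r Hr. destruct (Hc r Hr) as [M1 [H1 HM1]]. destruct (Hd r Hr) as [M2 [H2 HM2]].
  pose proof (Cmod_ge_0 a). pose proof (Cmod_ge_0 b).
  exists (Cmod a * M1 + Cmod b * M2)%R. split.
  { apply Rplus_le_le_0_compat; now apply Rmult_le_pos. }
  intros n. specialize (HM1 n). specialize (HM2 n).
  assert (0 <= r ^ n)%R by (apply pow_le; lra).
  apply Rle_trans with ((Cmod a * Cmod (c n) + Cmod b * Cmod (d n)) * r ^ n)%R.
  - apply Rmult_le_compat_r; [assumption|]. rewrite <- !Cmod_mult. apply Cmod_triangle.
  - nra.
Qed.

Lemma entire_bounded_mult (c d : nat -> C) (K : R) :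
  entire c -> (0 <= K)%R -> (forall n, (Cmod (d n) <= K)%R) -> entire (fun n => c n * d n).
Proof.
  intros Hc HK Hd r Hr. destruct (Hc r Hr) as [M [HM HMb]].
  exists (M * K)%R. split; [now apply Rmult_le_pos|]. intros n.
  rewrite Cmod_mult. replace (Cmod (c n) * Cmod (d n) * r ^ n)%R
    with (Cmod (c n) * r ^ n * Cmod (d n))%R by ring.
  apply Rmult_le_compat; auto using Cmod_ge_0.
  apply Rmult_le_pos; [apply Cmod_ge_0|apply pow_le; lra].
Qed.

Lemma entire_pow_mult (c : nat -> C) (x : C) : entire c -> entire (fun n => c n * x ^ n).
Proof.
  intros Hc r Hr. pose proof (Cmod_ge_0 x).
  destruct (Hc (r * (Cmod x + 1))%R) as [M [HM HMb]]; [nra|].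
  exists M. split; [exact HM|]. intros n. eapply Rle_trans; [|apply HMb].
  rewrite Cmod_mult, Cmod_pow, Rpow_mult_distr.
  replace (Cmod (c n) * (r ^ n * (Cmod x + 1) ^ n))%R
    with (Cmod (c n) * (Cmod x + 1) ^ n * r ^ n)%R by ring.
  apply Rmult_le_compat_r; [apply pow_le; lra|].
  apply Rmult_le_compat_l; [apply Cmod_ge_0|]. apply pow_incr. lra.
Qed.

(** The coefficient of [y^k] in [(z + y)^n]. *)
Fixpoint binom_coef (z : C) (n k : nat) : C :=
  match n with
  | O => match k with O => 1 | S _ => 0 end
  | S m => z * binom_coef z m k
           + match k with O => 0 | S j => binom_coef z m j end
  end.

Lemma binom_coef_big (z : C) n k : (n < k)%nat -> binom_coef z n k = 0.
Proof.
  revert k. induction n as [|n IH]; intros [|k] H; simpl; try lia; auto.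
  rewrite !IH by lia. ring.
Qed.

Lemma binom_coef_bound (z : C) n k : (Cmod (binom_coef z n k) <= (Cmod z + 1) ^ n)%R.
Proof.
  pose proof (Cmod_ge_0 z) as Hz.
  revert k. induction n as [|n IH]; intros k.
  - destruct k; simpl; rewrite ?Cmod_1, ?Cmod_0; lra.
  - simpl binom_coef. eapply Rle_trans; [apply Cmod_triangle|].
    rewrite Cmod_mult. simpl pow. rewrite Rmult_plus_distr_r.
    apply Rplus_le_compat.
    + apply Rmult_le_compat_l; auto.
    + destruct k; [rewrite Cmod_0|rewrite Rmult_1_l; apply IH].
      rewrite Rmult_1_l. apply pow_le. lra.
Qed.

Lemma binom_coef_sum (z y : C) n :
  csum (fun k => binom_coef z n k * y ^ k) ((z + y) ^ n).
Proof.
  induction n as [|n IH].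
  - replace ((z + y) ^ 0) with (binom_coef z 0 0 * y ^ 0) by (simpl; ring).
    apply (csum_first (fun k => binom_coef z 0 k * y ^ k)).
    intros k. simpl. ring.
  - rewrite Cpow_S.
    replace ((z + y) * (z + y) ^ n)
      with (z * (z + y) ^ n + (0 + y * (z + y) ^ n)) by ring.
    apply csum_ext with (fun k => z * (binom_coef z n k * y ^ k)
      + match k with O => 0 | S j => y * (binom_coef z n j * y ^ j) end).
    { intros [|k]; simpl; ring. }
    apply csum_plus; [now apply csum_scal|].
    apply (csum_cons (fun k => match k with O => 0 | S j => y * (binom_coef z n j * y ^ j) end)).
    now apply csum_scal.
Qed.

(** Expanding [(z + y)^n] turns the series in [z + y] into a double series; its
    majorant is geometric because an entire series converges at [4 (|z| + 1)]. *)
Lemma analytic_entire (c : nat -> C) (z : C) :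
  entire c -> analytic_at (power_series c) z.
Proof.
  intros Hc. apply analytic_expands.
  set (Z := (Cmod z + 1)%R). assert (HZ : (1 <= Z)%R).
  { unfold Z. pose proof (Cmod_ge_0 z). lra. }
  assert (Hs : (0 < / (4 * Z))%R) by (apply Rinv_0_lt_compat; lra).
  destruct (entire_geom c _ Hc Hs) as [M (HM & _ & Hb)].
  assert (Hu : forall n k, (Cmod (c n * binom_coef z n k)%C <= M * (/ 2) ^ n * (/ 2) ^ k)%R).
  { intros n k. destruct (Nat.lt_ge_cases n k) as [H|H].
    - rewrite binom_coef_big by exact H. rewrite Cmult_0_r, Cmod_0.
      apply Rmult_le_pos; [apply Rmult_le_pos; [lra|]|]; apply pow_le; lra.
    - rewrite Cmod_mult.
      apply Rle_trans with ((M * (/ (4 * Z)) ^ n) * Z ^ n)%R.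
      + apply Rmult_le_compat; auto using Cmod_ge_0, binom_coef_bound.
      + replace ((M * (/ (4 * Z)) ^ n) * Z ^ n)%R with (M * (/ 2) ^ n * (/ 2) ^ n)%R.
        * apply Rmult_le_compat_l; [apply Rmult_le_pos; [lra|apply pow_le; lra]|].
          replace n with (k + (n - k))%nat by lia. rewrite pow_add.
          rewrite <- (Rmult_1_r ((/ 2) ^ k)) at 2.
          apply Rmult_le_compat_l; [apply pow_le; lra|].
          rewrite <- (pow1 (n - k)). apply pow_incr. lra.
        * rewrite !Rmult_assoc. f_equal. rewrite <- !Rpow_mult_distr. f_equal.
          field. lra. }
  set (d := fun k => CSeries (fun n => c n * binom_coef z n k)).
  assert (Hd : forall k, csum (fun n => c n * binom_coef z n k) (d k)
                 /\ (Cmod (d k) <= (M * (/ 2) ^ k) * / (1 - / 2))%R).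
  { intros k. apply csum_geom; [lra|]. intros n. eapply Rle_trans; [apply Hu|].
    apply Req_le. ring. }
  exists d, (2 * M)%R, 1%R. split.
  - repeat split; [lra|lra|]. intros k. eapply Rle_trans; [apply Hd|].
    rewrite pow1. assert ((/ 2) ^ k <= 1)%R.
    { rewrite <- (pow1 k). apply pow_incr. lra. }
    replace (/ (1 - / 2))%R with 2%R by field. nra.
  - intros y Hy. rewrite Rmult_1_r in Hy.
    destruct (csum_interchange (fun n k => c n * binom_coef z n k * y ^ k)
      (fun n => M * (/ 2) ^ n)%R (fun k => 1 * (/ 2) ^ k)%R
      (fun n => c n * (z + y) ^ n) (fun k => d k * y ^ k)) as [S [H1 H2]].
    + intros n. apply Rmult_le_pos; [lra|apply pow_le; lra].
    + intros n. apply Rmult_le_pos; [lra|apply pow_le; lra].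
    + apply ex_series_geometric. lra.
    + apply ex_series_geometric. lra.
    + intros n k. rewrite Cmod_mult, Cmod_pow.
      assert (Cmod y ^ k <= 1)%R.
      { rewrite <- (pow1 k). apply pow_incr. split; [apply Cmod_ge_0|lra]. }
      assert (0 <= Cmod y ^ k)%R by apply pow_le, Cmod_ge_0.
      specialize (Hu n k). pose proof (Cmod_ge_0 (c n * binom_coef z n k)). nra.
    + intros n. apply csum_ext with (fun k => c n * (binom_coef z n k * y ^ k)).
      { intros k. ring. }
      apply csum_scal, binom_coef_sum.
    + intros k. rewrite (Cmult_comm (d k)).
      apply csum_ext with (fun n => y ^ k * (c n * binom_coef z n k)).
      { intros n. ring. }
      apply csum_scal, Hd.
    + unfold power_series at 1. rewrite (csum_CSeries _ _ H1).
      symmetry. exact (csum_CSeries _ _ H2).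
Qed.

(** ** Isolated zeros *)

Lemma geom_bounded_shift (a : nat -> C) (M s : R) (m : nat) :
  geom_bounded a M s -> geom_bounded (fun n => a (m + n)%nat) (M * s ^ m) s.
Proof.
  intros (HM & Hs & Hb). repeat split; [|exact Hs|].
  - apply Rmult_le_pos; [exact HM|apply pow_le; lra].
  - intros n. rewrite Rmult_assoc, <- pow_add. apply Hb.
Qed.

Lemma power_series_factor (a : nat -> C) (M s : R) (m : nat) (y : C) :
  geom_bounded a M s -> (forall n, (n < m)%nat -> a n = 0) -> (Cmod y * s < 1)%R ->
  power_series a y = y ^ m * power_series (fun n => a (m + n)%nat) y.
Proof.
  intros Ha H0 Hy. symmetry.
  pose proof (csum_scal (y ^ m) _ _
    (csum_power_series _ _ _ y (geom_bounded_shift a M s m Ha) Hy)) as Hs.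
  revert Hs. generalize (y ^ m * power_series (fun n => a (m + n)%nat) y). intros l Hs.
  symmetry. apply csum_CSeries.
  assert (Hm : csum (fun n => a (m + n)%nat * y ^ (m + n)) l).
  { apply csum_ext with (2 := Hs). intros n. rewrite Cpow_add_r. ring. }
  clear Ha Hy Hs. induction m as [|m IH]; [exact Hm|].
  apply IH; [intros n Hn; apply H0; lia|].
  replace l with (a (m + 0)%nat * y ^ (m + 0) + l).
  - apply (csum_cons (fun n => a (m + n)%nat * y ^ (m + n))).
    apply csum_ext with (2 := Hm). intros n. now rewrite Nat.add_succ_r.
  - rewrite Nat.add_0_r, H0 by lia. ring.
Qed.

Lemma power_series_near_0 (a : nat -> C) (M s : R) (y : C) :
  geom_bounded a M s -> (Cmod y * s < / 2)%R ->
  (Cmod (power_series a y - a O)%C <= 2 * (M * s * Cmod y))%R.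
Proof.
  intros Ha Hy. pose proof Ha as (HM & Hs & Hb). pose proof (Cmod_ge_0 y) as Hy0.
  pose proof (csum_behead _ _ (csum_power_series a M s y Ha ltac:(lra))) as Hf.
  cbv beta in Hf. replace (a O * y ^ 0) with (a O) in Hf by (simpl; ring).
  destruct (csum_geom (fun n => a (S n) * y ^ S n) (M * s * Cmod y) (Cmod y * s))
    as [H1 H2].
  - split; [apply Rmult_le_pos; lra|lra].
  - intros n. rewrite Cmod_mult, Cmod_pow.
    apply Rle_trans with (M * s ^ S n * Cmod y ^ S n)%R.
    + apply Rmult_le_compat_r; [apply pow_le; lra|]. apply Hb.
    + apply Req_le. rewrite Rpow_mult_distr. simpl pow. ring.
  - rewrite (csum_unique _ _ _ H1 Hf) in H2. eapply Rle_trans; [exact H2|].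
    rewrite (Rmult_comm 2). apply Rmult_le_compat_l.
    + apply Rmult_le_pos; [apply Rmult_le_pos|]; lra.
    + rewrite <- (Rinv_inv 2). apply Rinv_le_contravar; lra.
Qed.

(** One [d] serves all the sequences with a given majorant, so that limits may be
    taken while the coefficients vary as well. *)
Lemma power_series_near_0_uniform (M s e : R) :
  (0 <= M)%R -> (0 < s)%R -> (0 < e)%R ->
  exists d, (0 < d)%R /\ forall a y, geom_bounded a M s -> (Cmod y < d)%R ->
    (Cmod y * s < / 2)%R /\ (Cmod (power_series a y - a O)%C < e)%R.
Proof.
  intros HM Hs He. assert (HMs : (0 <= M * s)%R) by (apply Rmult_le_pos; lra).
  exists (Rmin (/ 2 / s) (e / (2 * M * s + 1))). split.
  { apply Rmin_pos; apply Rdiv_lt_0_compat; lra. }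
  intros a y Ha Hy. pose proof (Cmod_ge_0 y).
  assert (Hy1 : (Cmod y * s < / 2)%R).
  { apply mult_lt_of_lt_div; [lra|]. eapply Rlt_le_trans; [exact Hy|apply Rmin_l]. }
  assert (Hy2 : (Cmod y * (2 * M * s + 1) < e)%R).
  { apply mult_lt_of_lt_div; [lra|]. eapply Rlt_le_trans; [exact Hy|apply Rmin_r]. }
  split; [exact Hy1|]. pose proof (power_series_near_0 a M s y Ha Hy1). nra.
Qed.

Lemma power_series_family_lim (c : nat -> nat -> C) (w : nat -> C) (l : C) (M s : R) :
  (forall i, geom_bounded (c i) M s) -> (forall i, c i O = l) -> clim w 0 ->
  clim (fun i => power_series (c i) (w i)) l.
Proof.
  intros Hc H0 Hw e He. destruct (Hc O) as (HM & Hs & _).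
  destruct (power_series_near_0_uniform M s e HM Hs He) as [d [Hd H]].
  destruct (Hw d Hd) as [N HN]. exists N. intros i Hi. specialize (HN i Hi).
  replace (w i - 0) with (w i) in HN by ring. rewrite <- (H0 i). now apply H.
Qed.

Lemma power_series_lim (a : nat -> C) (w : nat -> C) (M s : R) :
  geom_bounded a M s -> clim w 0 -> clim (fun i => power_series a (w i)) (a O).
Proof. intros Ha. now apply (power_series_family_lim (fun _ => a)) with M s. Qed.

(** If [a m] is the first nonzero coefficient, the function is [y^m] times a
    series close to [a m]. *)
Lemma expands_dichotomy (h : C -> C) (z : C) (a : nat -> C) (M s : R) :
  expands h z a M s ->
  (forall n, a n = 0) \/
  exists e, (0 < e)%R /\ forall y, (0 < Cmod y < e)%R -> h (z + y) <> 0.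
Proof.
  intros [Ha Hh].
  destruct (classic (forall n, a n = 0)) as [H|H]; [now left|right].
  assert (Hm : exists m, a m <> 0 /\ forall n, (n < m)%nat -> a n = 0).
  { apply not_all_ex_not in H. destruct H as [n Hn]. revert Hn.
    induction n as [n IH] using lt_wf_ind. intros Hn.
    destruct (classic (forall k, (k < n)%nat -> a k = 0)) as [H|H].
    - now exists n.
    - apply not_all_ex_not in H. destruct H as [k Hk].
      apply imply_to_and in Hk. destruct Hk as [Hk1 Hk2]. eauto. }
  destruct Hm as [m [Hm H0]].
  pose proof (geom_bounded_shift a M s m Ha) as Ht. pose proof Ht as (HM & Hs & _).
  destruct (power_series_near_0_uniform _ s (Cmod (a m)) HM Hs) as [d [Hd Hn]].
  { now apply Cmod_gt_0. }
  exists d. split; [exact Hd|]. intros y [Hy0 Hyd] E.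
  destruct (Hn _ y Ht Hyd) as [Hy1 Hy2]. cbv beta in Hy2. rewrite Nat.add_0_r in Hy2.
  rewrite Hh, (power_series_factor a M s m y Ha H0) in E by lra.
  assert (Hy : y ^ m <> 0) by (apply Cpow_nz, Cmod_gt_0, Hy0).
  replace (power_series (fun n => a (m + n)%nat) y)
    with (y ^ m * power_series (fun n => a (m + n)%nat) y / y ^ m) in Hy2 by (field; exact Hy).
  rewrite E in Hy2. replace (0 / y ^ m - a m) with (- a m) in Hy2 by (field; exact Hy).
  rewrite Cmod_opp in Hy2. lra.
Qed.

Lemma expands_zero (h : C -> C) (z : C) (a : nat -> C) (M s : R) :
  expands h z a M s -> (forall n, a n = 0) ->
  forall y, (Cmod y * s < 1)%R -> h (z + y) = 0.
Proof.
  intros [Ha Hh] H0 y Hy. rewrite Hh by exact Hy. apply csum_CSeries.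
  apply csum_ext with (fun _ => 0); [|apply csum_zero].
  intros n. rewrite H0. ring.
Qed.

Lemma analytic_dichotomy (h : C -> C) (z : C) :
  analytic_at h z ->
  (exists e, (0 < e)%R /\ forall y, (Cmod y < e)%R -> h (z + y) = 0) \/
  (exists e, (0 < e)%R /\ forall y, (0 < Cmod y < e)%R -> h (z + y) <> 0).
Proof.
  intros H. apply analytic_expands in H. destruct H as (a & M & s & H).
  destruct (expands_dichotomy h z a M s H) as [H0|H0]; [left|now right].
  pose proof H as [(_ & Hs & _) _].
  exists (/ s)%R. split; [now apply Rinv_0_lt_compat|]. intros y Hy.
  apply (expands_zero h z a M s H H0).
  apply mult_lt_of_lt_div; lra.
Qed.

Lemma analytic_continuous (h : C -> C) (z : C) :
  analytic_at h z ->
  forall e, (0 < e)%R -> exists d, (0 < d)%R /\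
    forall y, (Cmod y < d)%R -> (Cmod (h (z + y) - h z)%C < e)%R.
Proof.
  intros H e He. apply analytic_expands in H. destruct H as (a & M & s & Ha & Hh).
  pose proof Ha as (HM & Hs & _).
  destruct (power_series_near_0_uniform M s e HM Hs He) as [d [Hd Hn]].
  exists d. split; [exact Hd|]. intros y Hy. destruct (Hn a y Ha Hy) as [H1 H2].
  rewrite Hh by lra. replace z with (z + 0) at 1 by ring.
  rewrite Hh, power_series_0 by (rewrite Cmod_0; lra). exact H2.
Qed.

(** * Analytic continuation *)

Lemma locally_Cmod (z : C) (P : C -> Prop) :
  @locally C_UniformSpace z P <->
  exists e, (0 < e)%R /\ forall y, (Cmod (y - z) < e)%R -> P y.
Proof.
  split.
  - intros [e He]. exists e. split; [apply cond_pos|]. intros y Hy. apply He.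
    now apply C_NormedModule_mixin_compat1.
  - intros [e [He H]].
    assert (Hs : (0 < sqrt 2)%R) by (apply sqrt_lt_R0; lra).
    assert (Hd : (0 < e / sqrt 2)%R) by now apply Rdiv_lt_0_compat.
    exists (mkposreal _ Hd). intros y Hy. apply H.
    eapply Rlt_le_trans; [exact (C_NormedModule_mixin_compat2 z y _ Hy)|].
    simpl. apply Req_le. field. lra.
Qed.

Lemma open_Cmod (D : C -> Prop) :
  @open C_UniformSpace D <->
  forall z, D z -> exists e, (0 < e)%R /\ forall y, (Cmod (y - z) < e)%R -> D y.
Proof.
  split; intros H z Hz; apply locally_Cmod; now apply H.
Qed.

Lemma near_point (z : C) (e d : R) :
  (0 < e)%R -> (0 < d)%R ->
  exists y : C, (0 < Cmod (y - z) < e)%R /\ (Cmod (y - z) < d)%R.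
Proof.
  intros He Hd. pose proof (Rmin_l e d). pose proof (Rmin_r e d).
  pose proof (Rmin_pos e d He Hd).
  exists (z + RtoC (Rmin e d / 2)).
  replace (z + RtoC (Rmin e d / 2) - z) with (RtoC (Rmin e d / 2)) by ring.
  rewrite Cmod_R, Rabs_pos_eq; lra.
Qed.

Lemma open_punctured (W : C -> Prop) :
  @open C_UniformSpace (fun z : C =>
    exists e, (0 < e)%R /\ forall y, (0 < Cmod (y - z) < e)%R -> W y).
Proof.
  apply open_Cmod. intros z [e [He Hz]]. exists e. split; [exact He|]. intros y Hy.
  destruct (Req_dec (Cmod (y - z)) 0) as [E|E].
  - apply Cmod_eq_0 in E. replace y with z; [now exists e|].
    replace z with (y - (y - z)) by ring. rewrite E. ring.
  - pose proof (Cmod_ge_0 (y - z)) as Hp.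
    set (d := Rmin (Cmod (y - z)) (e - Cmod (y - z))).
    assert (d <= Cmod (y - z))%R by apply Rmin_l.
    assert (d <= e - Cmod (y - z))%R by apply Rmin_r.
    exists d. split; [apply Rmin_pos; lra|]. intros x Hx. apply Hz.
    pose proof (Cmod_triangle (x - y) (y - z)) as T1.
    replace (x - y + (y - z)) with (x - z) in T1 by ring.
    pose proof (Cmod_triangle (- (x - y)) (x - z)) as T2.
    replace (- (x - y) + (x - z)) with (y - z) in T2 by ring.
    rewrite Cmod_opp in T2. lra.
Qed.

Lemma connected_cases (D U V : C -> Prop) :
  connected D -> @open C_UniformSpace U -> @open C_UniformSpace V ->
  (forall z, D z -> U z \/ V z) -> (forall z, D z -> U z -> V z -> False) ->
  (forall z, D z -> U z) \/ (forall z, D z -> V z).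
Proof.
  intros HD HU HV Hc Hd.
  destruct (classic (exists z, D z /\ U z)) as [H1|H1].
  - destruct (classic (exists z, D z /\ V z)) as [H2|H2].
    + destruct (HD U V HU HV Hc H1 H2) as (z & Hz & Hu & Hv). exfalso. eauto.
    + left. intros z Hz. destruct (Hc z Hz); [assumption|]. exfalso. eauto.
  - right. intros z Hz. destruct (Hc z Hz); [|assumption]. exfalso. eauto.
Qed.

Lemma connected_intro (D : C -> Prop) :
  (forall U V, @open C_UniformSpace U -> @open C_UniformSpace V ->
    (forall z, D z -> U z \/ V z) -> (forall z, D z -> U z -> V z -> False) ->
    (forall z, D z -> U z) \/ (forall z, D z -> V z)) ->
  connected D.
Proof.
  intros H U V HU HV Hc [u [Hu1 Hu2]] [v [Hv1 Hv2]].
  apply NNPP. intros Hno.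
  destruct (H U V HU HV Hc) as [H1|H1].
  - intros z H1 H2 H3. apply Hno. eauto.
  - apply Hno. exists v. auto.
  - apply Hno. exists u. auto.
Qed.

Lemma connected_union (A B : C -> Prop) (p : C) :
  connected A -> connected B -> A p -> B p -> connected (fun z => A z \/ B z).
Proof.
  intros HA HB Ap Bp. apply connected_intro. intros U V HU HV Hc Hd.
  destruct (connected_cases A U V HA HU HV) as [H1|H1]; eauto;
  destruct (connected_cases B U V HB HU HV) as [H2|H2]; eauto.
  - left. intros z [Hz|Hz]; auto.
  - exfalso. eauto.
  - exfalso. eauto.
  - right. intros z [Hz|Hz]; auto.
Qed.

Lemma connected_equiv (A B : C -> Prop) :
  (forall z, A z <-> B z) -> connected A -> connected B.
Proof.
  intros H HA U V HU HV Hc [u [Hu1 Hu2]] [v [Hv1 Hv2]].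
  destruct (HA U V HU HV) as (z & H1 & H2).
  - intros z Hz. apply Hc, H, Hz.
  - exists u. split; [now apply H|exact Hu2].
  - exists v. split; [now apply H|exact Hv2].
  - exists z. split; [now apply H|exact H2].
Qed.

Definition convex (D : C -> Prop) : Prop :=
  forall x y (t : R), D x -> D y -> (0 <= t <= 1)%R -> D (x + RtoC t * (y - x)).

(** On a segment from [U] to [V], consider the last point before which the
    segment stays in [U]. *)
Lemma convex_connected (D : C -> Prop) : convex D -> connected D.
Proof.
  intros HD U V HU HV Hc [u [Du Uu]] [v [Dv Vv]].
  apply NNPP. intros Hno.
  assert (Hd : forall z, D z -> U z -> V z -> False).
  { intros z H1 H2 H3. apply Hno. eauto. }
  set (p := fun t : R => u + RtoC t * (v - u)).
  assert (Dp : forall t, (0 <= t <= 1)%R -> D (p t)) by (intros t Ht; now apply HD).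
  assert (p0 : p 0%R = u) by (unfold p; ring).
  assert (p1 : p 1%R = v) by (unfold p; ring).
  assert (Hdist : forall t s, Cmod (p t - p s) = (Rabs (t - s) * Cmod (v - u))%R).
  { intros t s. unfold p.
    replace (u + RtoC t * (v - u) - (u + RtoC s * (v - u)))
      with (RtoC (t - s) * (v - u)) by (rewrite RtoC_minus; ring).
    now rewrite Cmod_mult, Cmod_R. }
  assert (Hnear : forall W, @open C_UniformSpace W -> forall t, W (p t) ->
    exists d, (0 < d)%R /\ forall s, (Rabs (s - t) < d)%R -> W (p s)).
  { intros W HW t Ht.
    destruct (proj1 (open_Cmod W) HW (p t) Ht) as [e [He HWe]]. pose proof (Cmod_ge_0 (v - u)).
    assert (Hq : (0 < Cmod (v - u) + 1)%R) by lra.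
    exists (e / (Cmod (v - u) + 1))%R. split; [now apply Rdiv_lt_0_compat|].
    intros s Hs. apply HWe. rewrite Hdist.
    apply Rmult_lt_compat_r with (r := (Cmod (v - u) + 1)%R) in Hs; [|lra].
    replace (e / (Cmod (v - u) + 1) * (Cmod (v - u) + 1))%R with e in Hs by (field; lra).
    pose proof (Rabs_pos (s - t)). nra. }
  set (E := fun t => (0 <= t <= 1)%R /\ forall s, (0 <= s <= t)%R -> U (p s)).
  destruct (completeness E) as [m [Hm1 Hm2]].
  { exists 1%R. intros t [Ht _]. lra. }
  { exists 0%R. split; [lra|]. intros s Hs. replace s with 0%R by lra. now rewrite p0. }
  assert (Hm : (0 <= m <= 1)%R).
  { split.
    - apply Hm1. split; [lra|]. intros s Hs. replace s with 0%R by lra. now rewrite p0.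
    - apply Hm2. intros t [Ht _]. lra. }
  assert (Hbelow : forall s, (0 <= s < m)%R -> U (p s)).
  { intros s Hs. apply NNPP. intros HnU.
    assert (m <= s)%R; [|lra]. apply Hm2. intros t [Ht1 Ht2].
    apply Rnot_lt_le. intros Hlt. apply HnU, Ht2. lra. }
  destruct (Hc (p m) (Dp m Hm)) as [HUm|HVm].
  - destruct (Hnear U HU m HUm) as [d [Hd0 HdU]].
    destruct (Req_dec m 1) as [->|Hne].
    + apply (Hd v Dv); [now rewrite <- p1|exact Vv].
    + set (t := Rmin 1 (m + d / 2)).
      assert (Ht1 : (t <= 1)%R) by apply Rmin_l.
      assert (Ht2 : (t <= m + d / 2)%R) by apply Rmin_r.
      assert (Ht3 : (m < t)%R) by (apply Rmin_glb_lt; lra).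
      assert (t <= m)%R; [|lra]. apply Hm1. split; [lra|].
      intros s Hs. destruct (Rlt_or_le s m); [apply Hbelow; lra|].
      apply HdU. rewrite Rabs_pos_eq; lra.
  - destruct (Hnear V HV m HVm) as [d [Hd0 HdV]].
    destruct (Req_dec m 0) as [E0|Hne].
    + apply (Hd u Du Uu). rewrite <- p0. now rewrite E0 in HVm.
    + set (s := Rmax 0 (m - d / 2)).
      assert (Hs1 : (0 <= s)%R) by apply Rmax_l.
      assert (Hs2 : (m - d / 2 <= s)%R) by apply Rmax_r.
      assert (Hs3 : (s < m)%R) by (apply Rmax_lub_lt; lra).
      apply (Hd (p s)); [apply Dp; lra|apply Hbelow; lra|].
      apply HdV. rewrite Rabs_left; lra.
Qed.

Definition half_disc (f : C -> R) (z : C) (e : R) (y : C) : Prop :=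
  (Cmod (y - z) < e)%R /\ (0 < f (y - z)%C)%R.

Lemma half_disc_convex (f : C -> R) (z : C) (e : R) :
  (forall x y (t : R), f (x + RtoC t * (y - x))%C = ((1 - t) * f x + t * f y)%R) ->
  convex (half_disc f z e).
Proof.
  intros Hf x y t [Hx1 Hx2] [Hy1 Hy2] Ht. unfold half_disc.
  replace (x + RtoC t * (y - x) - z)
    with ((x - z) + RtoC t * ((y - z) - (x - z))) by ring.
  split.
  - replace ((x - z) + RtoC t * ((y - z) - (x - z)))
      with (RtoC (1 - t) * (x - z) + RtoC t * (y - z)) by (rewrite RtoC_minus; ring).
    eapply Rle_lt_trans; [apply Cmod_triangle|].
    rewrite !Cmod_mult, !Cmod_R, !Rabs_pos_eq by lra.
    destruct (Req_dec t 0) as [->|]; [lra|]. nra.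
  - rewrite Hf. destruct (Req_dec t 0) as [->|]; [lra|]. nra.
Qed.

(** A punctured disc is the union of four half discs, each meeting the next. *)
Lemma punctured_disc_connected (z : C) (e : R) :
  (0 < e)%R -> connected (fun y => (0 < Cmod (y - z) < e)%R).
Proof.
  intros He.
  set (A := half_disc Re z e). set (B := half_disc Im z e).
  set (A' := half_disc (fun y => - Re y)%R z e).
  set (B' := half_disc (fun y => - Im y)%R z e).
  assert (cA : connected A).
  { apply convex_connected, half_disc_convex. intros x y t. destruct x, y. simpl. ring. }
  assert (cB : connected B).
  { apply convex_connected, half_disc_convex. intros x y t. destruct x, y. simpl. ring. }
  assert (cA' : connected A').
  { apply convex_connected, half_disc_convex. intros x y t. destruct x, y. simpl. ring. }
  assert (cB' : connected B').
  { apply convex_connected, half_disc_convex. intros x y t. destruct x, y. simpl. ring. }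
  assert (Hz : forall w : C, z + w - z = w) by (intros; ring).
  assert (Hq : forall a b : R, (Rabs a <= e / 4)%R -> (Rabs b <= e / 4)%R ->
    (Cmod (a, b) < e)%R).
  { intros a b Ha Hb.
    assert (E : (a, b) = RtoC a + Ci * RtoC b).
    { unfold Ci, RtoC, Cplus, Cmult. simpl. f_equal; ring. }
    rewrite E.
    eapply Rle_lt_trans; [apply Cmod_triangle|].
    rewrite Cmod_mult, Cmod_Ci, !Cmod_R. lra. }
  assert (P : Rabs (e / 4) = (e / 4)%R) by (apply Rabs_pos_eq; lra).
  assert (N : Rabs (- (e / 4)) = (e / 4)%R) by (rewrite Rabs_Ropp; exact P).
  apply connected_equiv with (fun y => ((A y \/ B y) \/ A' y) \/ B' y).
  - intros y. unfold A, A', B, B', half_disc. split.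
    + assert (H0 : (Re (y - z) <> 0 \/ Im (y - z) <> 0)%R -> (0 < Cmod (y - z))%R).
      { intros H. apply Cmod_gt_0. intros E. rewrite E in H. simpl in H. lra. }
      intros [[[[H1 H2]|[H1 H2]]|[H1 H2]]|[H1 H2]]; (split; [apply H0|exact H1]); lra.
    + intros [H1 H2]. apply Cmod_gt_0 in H1.
      destruct (Rtotal_order (Re (y - z)) 0) as [H|[H|H]].
      * left. right. split; [exact H2|lra].
      * destruct (Rtotal_order (Im (y - z)) 0) as [H'|[H'|H']].
        -- right. split; [exact H2|lra].
        -- exfalso. apply H1. destruct (y - z) as [c d]. simpl in H, H'.
           now rewrite H, H'.
        -- left. left. right. split; [exact H2|lra].
      * left. left. left. split; [exact H2|lra].
  - apply (connected_union _ _ (z + ((e/4)%R, (- (e/4))%R)));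
      [apply (connected_union _ _ (z + ((- (e/4))%R, (e/4)%R)));
        [apply (connected_union _ _ (z + ((e/4)%R, (e/4)%R)))| | |]| | |]; auto.
    all: unfold A, A', B, B', half_disc; rewrite ?Hz; simpl.
    + split; [apply Hq; lra|lra].
    + split; [apply Hq; lra|lra].
    + right. split; [apply Hq; lra|lra].
    + split; [apply Hq; lra|lra].
    + left. left. split; [apply Hq; lra|lra].
    + split; [apply Hq; lra|lra].
Qed.

(** A partition of [D] into two open parts extends to the plane, which is
    connected: the punctured disc around any point lies in one of the parts. *)
Lemma codiscrete_connected (D : C -> Prop) :
  (forall z, exists e, (0 < e)%R /\ forall y, (0 < Cmod (y - z) < e)%R -> D y) ->
  connected D.
Proof.
  intros HD. apply connected_intro. intros U V HU HV Hc Hd.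
  set (near := fun (W : C -> Prop) z => exists e, (0 < e)%R /\
    forall y, (0 < Cmod (y - z) < e)%R -> D y /\ W y).
  assert (Hcov : forall z, near U z \/ near V z).
  { intros z. destruct (HD z) as [e [He Hz]].
    destruct (connected_cases _ U V (punctured_disc_connected z e He) HU HV) as [H|H].
    - auto.
    - eauto.
    - left. exists e. auto.
    - right. exists e. auto. }
  assert (Hdis : forall z, near U z -> near V z -> False).
  { intros z [e [He H1]] [d [Hd0 H2]].
    destruct (near_point z e d He Hd0) as [y [Hy1 Hy2]].
    destruct (H1 y Hy1) as [H3 H4]. destruct (H2 y) as [_ H6]; [lra|].
    exact (Hd _ H3 H4 H6). }
  assert (Hlim : forall W z, @open C_UniformSpace W -> D z -> W z ->
    forall W', near W' z -> exists y, D y /\ W y /\ W' y).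
  { intros W z HW Dz Wz W' [e [He H1]].
    destruct (proj1 (open_Cmod W) HW z Wz) as [d [Hd0 H2]].
    destruct (near_point z e d He Hd0) as [y [Hy1 Hy2]].
    destruct (H1 y Hy1) as [H3 H4]. exists y. auto. }
  destruct (connected_cases (fun _ => True) (near U) (near V)) as [H|H]; eauto;
    try apply open_punctured.
  { apply convex_connected. intros x y t _ _ _. exact I. }
  - left. intros z Dz. destruct (Hc z Dz) as [|HVz]; [assumption|exfalso].
    destruct (Hlim V z HV Dz HVz U (H z I)) as (y & H1 & H2 & H3). eauto.
  - right. intros z Dz. destruct (Hc z Dz) as [HUz|]; [exfalso|assumption].
    destruct (Hlim U z HU Dz HUz V (H z I)) as (y & H1 & H2 & H3). eauto.
Qed.

(** The points near which [h] vanishes and those near which it has no other zero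
    form two disjoint open sets that cover [D]. *)
Lemma identity_theorem (D : C -> Prop) (h : C -> C) (z0 : C) :
  connected D -> (forall z, D z -> analytic_at h z) -> D z0 ->
  @locally C_UniformSpace z0 (fun y => h y = 0) -> forall z, D z -> h z = 0.
Proof.
  intros HD Ha H0 Hz0.
  set (U := fun z => exists e, (0 < e)%R /\ forall y, (Cmod (y - z) < e)%R -> h y = 0).
  set (V := fun z => exists e, (0 < e)%R /\ forall y, (0 < Cmod (y - z) < e)%R -> h y <> 0).
  assert (HU : @open C_UniformSpace U).
  { apply open_Cmod. intros z [e [He Hz]]. exists e. split; [exact He|]. intros y Hy.
    exists (e - Cmod (y - z))%R. split; [lra|]. intros x Hx. apply Hz.
    pose proof (Cmod_triangle (x - y) (y - z)) as T1.
    replace (x - y + (y - z)) with (x - z) in T1 by ring. lra. }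
  assert (HV : @open C_UniformSpace V) by apply (open_punctured (fun y => h y <> 0)).
  assert (Hself : forall z y : C, y = z + (y - z)) by (intros; ring).
  destruct (connected_cases D U V HD HU HV) as [H|H].
  - intros z Dz. destruct (analytic_dichotomy h z (Ha z Dz)) as [[e [He H]]|[e [He H]]].
    + left. exists e. split; [exact He|]. intros y Hy. rewrite (Hself z y). auto.
    + right. exists e. split; [exact He|]. intros y Hy. rewrite (Hself z y). auto.
  - intros z Dz [e [He H1]] [d [Hd0 H2]].
    destruct (near_point z d e Hd0 He) as [y [Hy1 Hy2]].
    exact (H2 y Hy1 (H1 y Hy2)).
  - intros z Dz. destruct (H z Dz) as [e [He Hz]]. apply Hz.
    replace (z - z) with (RtoC 0) by ring. rewrite Cmod_0. exact He.
  - exfalso. destruct (H z0 H0) as [e [He H1]].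
    apply locally_Cmod in Hz0. destruct Hz0 as [d [Hd0 H2]].
    destruct (near_point z0 e d He Hd0) as [y [Hy1 Hy2]].
    exact (H1 y Hy1 (H2 y Hy2)).
Qed.

(** This is the domain on which a quotient with denominator [p] is continued. *)
Lemma nonzero_set_connected (p : nat -> C) :
  entire p -> p O <> 0 -> connected (fun y => power_series p y <> 0).
Proof.
  intros Hp H0. apply codiscrete_connected. intros z.
  destruct (analytic_dichotomy _ z (analytic_entire p z Hp)) as [[e [He H]]|[e [He H]]].
  - exfalso. apply H0. rewrite <- power_series_0.
    apply (identity_theorem (fun _ => True) (power_series p) z); auto.
    + apply convex_connected. intros x y t _ _ _. exact I.
    + intros y _. now apply analytic_entire.
    + apply locally_Cmod. exists e. split; [exact He|]. intros y Hy.
      replace y with (z + (y - z)) by ring. auto.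
  - exists e. split; [exact He|]. intros y Hy.
    replace y with (z + (y - z)) by ring. auto.
Qed.

Lemma nonzero_set_open (p : nat -> C) :
  entire p -> @open C_UniformSpace (fun y => power_series p y <> 0).
Proof.
  intros Hp. apply open_Cmod. intros z Hz.
  destruct (analytic_continuous _ z (analytic_entire p z Hp) (Cmod (power_series p z)))
    as [d [Hd H]].
  { now apply Cmod_gt_0. }
  exists d. split; [exact Hd|]. intros y Hy E.
  specialize (H (y - z) Hy). replace (z + (y - z)) with y in H by ring.
  rewrite E in H. replace (0 - power_series p z) with (- power_series p z) in H by ring.
  rewrite Cmod_opp in H. lra.
Qed.

(** Any continuation [g] of [f] satisfies [g p = e] on its connected domain by
    the identity theorem, hence its value is forced wherever [p] is not zero. *)
Lemma continuation_quotient (f : C -> C) (e p : nat -> C) (z : C) :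
  entire e -> entire p -> p O <> 0 ->
  @locally C_UniformSpace (RtoC 0) (fun y => f y * power_series p y = power_series e y) ->
  power_series p z <> 0 ->
  continuation f z = power_series e z / power_series p z.
Proof.
  intros He Hp H0 Hf Hz.
  assert (Hex : is_continuation f z (power_series e z / power_series p z)).
  { exists (fun y => power_series p y <> 0), (fun y => power_series e y / power_series p y).
    repeat split.
    - now apply nonzero_set_open.
    - now apply nonzero_set_connected.
    - now rewrite power_series_0.
    - exact Hz.
    - intros y Hy. apply analytic_mult; [now apply analytic_entire|].
      apply analytic_inv; [now apply analytic_entire|exact Hy].
    - assert (Hloc : @locally C_UniformSpace (RtoC 0) (fun y => power_series p y <> 0)).
      { apply nonzero_set_open; [exact Hp|]. now rewrite power_series_0. }
      apply locally_Cmod in Hf, Hloc. apply locally_Cmod.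
      destruct Hf as [d1 [Hd1 H1]]. destruct Hloc as [d2 [Hd2 H2]].
      exists (Rmin d1 d2). split; [now apply Rmin_pos|]. intros y Hy.
      rewrite <- H1; [|eapply Rlt_le_trans; [exact Hy|apply Rmin_l]].
      field. apply H2. eapply Rlt_le_trans; [exact Hy|apply Rmin_r]. }
  assert (Hc : is_continuation f z (continuation f z)).
  { unfold continuation. apply epsilon_spec. eauto. }
  destruct Hc as (D & g & _ & HD & D0 & Dz & Hg & Hl & Hgz).
  rewrite <- Hgz.
  assert (Hid : g z * power_series p z - power_series e z = 0).
  { apply (identity_theorem D (fun y => g y * power_series p y - power_series e y) 0); auto.
    - intros y Hy. apply analytic_minus; [|now apply analytic_entire].
      apply analytic_mult; [now apply Hg|now apply analytic_entire].
    - apply locally_Cmod in Hf, Hl. apply locally_Cmod.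
      destruct Hf as [d1 [Hd1 H1]]. destruct Hl as [d2 [Hd2 H2]].
      exists (Rmin d1 d2). split; [now apply Rmin_pos|]. intros y Hy.
      rewrite H2, H1; [ring| |]; (eapply Rlt_le_trans; [exact Hy|]);
        [apply Rmin_l|apply Rmin_r]. }
  replace (power_series e z)
    with (g z * power_series p z - (g z * power_series p z - power_series e z)) by ring.
  rewrite Hid. field. exact Hz.
Qed.

(** * Integer powers and bilateral series *)

Lemma Ceq_of_minus (x y : C) : x - y = 0 -> x = y.
Proof. intros H. replace x with (x - y + y) by ring. rewrite H. ring. Qed.

Lemma opp_neq0 (x : C) : x <> 0 -> - x <> 0.
Proof. intros H E. apply H. replace x with (- - x) by ring. rewrite E. ring. Qed.

Lemma div_neq0 (x y : C) : x <> 0 -> y <> 0 -> x / y <> 0.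
Proof.
  intros Hx Hy E. apply Hx. replace x with (x / y * y) by (field; exact Hy).
  rewrite E. ring.
Qed.

Lemma CpowZ_of_nat (z : C) (n : nat) : CpowZ z (Z.of_nat n) = z ^ n.
Proof.
  destruct n as [|n]; [reflexivity|].
  change (CpowZ z (Z.of_nat (S n))) with (z ^ Pos.to_nat (Pos.of_succ_nat n)).
  now rewrite SuccNat2Pos.id_succ.
Qed.

Lemma CpowZ_opp_nat (z : C) (n : nat) : CpowZ z (- Z.of_nat n) = / z ^ n.
Proof.
  destruct n as [|n]; [simpl; field; apply C1_nz|].
  change (CpowZ z (- Z.of_nat (S n))) with (/ z ^ Pos.to_nat (Pos.of_succ_nat n)).
  now rewrite SuccNat2Pos.id_succ.
Qed.

Lemma CpowZ_succ (z : C) (k : Z) : z <> 0 -> CpowZ z (k + 1) = z * CpowZ z k.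
Proof.
  intros Hz. destruct (Z_le_gt_dec 0 k) as [H|H].
  - replace k with (Z.of_nat (Z.to_nat k)) by lia.
    replace (Z.of_nat (Z.to_nat k) + 1)%Z with (Z.of_nat (S (Z.to_nat k))) by lia.
    rewrite !CpowZ_of_nat. apply Cpow_S.
  - replace k with (- Z.of_nat (S (Z.to_nat (- k - 1))))%Z by lia.
    replace (- Z.of_nat (S (Z.to_nat (- k - 1))) + 1)%Z
      with (- Z.of_nat (Z.to_nat (- k - 1)))%Z by lia.
    rewrite !CpowZ_opp_nat, Cpow_S. field.
    split; [now apply Cpow_nz|exact Hz].
Qed.

Lemma CpowZ_neq0 (z : C) (k : Z) : z <> 0 -> CpowZ z k <> 0.
Proof.
  intros Hz. destruct k as [|p|p]; simpl.
  - exact C1_nz.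
  - now apply Cpow_nz.
  - intros H. apply C1_nz. transitivity (/ z ^ Pos.to_nat p * z ^ Pos.to_nat p).
    + field. now apply Cpow_nz.
    + rewrite H. ring.
Qed.

Lemma CpowZ_add (z : C) (j k : Z) : z <> 0 -> CpowZ z (j + k) = CpowZ z j * CpowZ z k.
Proof.
  intros Hz. revert j. apply Z.bi_induction.
  - intros x y ->. reflexivity.
  - simpl. ring.
  - intros j. replace (Z.succ j + k)%Z with (j + k + 1)%Z by lia.
    replace (Z.succ j) with (j + 1)%Z by lia. rewrite !CpowZ_succ by exact Hz.
    split; intros H.
    + rewrite H. ring.
    + replace (CpowZ z (j + k)) with (/ z * (z * CpowZ z (j + k))) by (field; exact Hz).
      rewrite H. field. exact Hz.
Qed.

Lemma CpowZ_opp (z : C) (k : Z) : z <> 0 -> CpowZ z (- k) = / CpowZ z k.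
Proof.
  intros Hz. pose proof (CpowZ_neq0 z k Hz) as H.
  replace (CpowZ z (- k)) with (/ CpowZ z k * (CpowZ z k * CpowZ z (- k))) by (field; exact H).
  rewrite <- CpowZ_add by exact Hz. replace (k + - k)%Z with 0%Z by lia. simpl. ring.
Qed.

Lemma CpowZ_mult (x y : C) (k : Z) :
  x <> 0 -> y <> 0 -> CpowZ (x * y) k = CpowZ x k * CpowZ y k.
Proof.
  intros Hx Hy. destruct k as [|p|p]; simpl.
  - ring.
  - apply Cpow_mult_l.
  - rewrite Cpow_mult_l. field. split; now apply Cpow_nz.
Qed.

Lemma CpowZ_inv (x : C) (k : Z) : x <> 0 -> CpowZ (/ x) k = / CpowZ x k.
Proof.
  intros Hx. destruct k as [|p|p]; simpl.
  - field.
  - now apply Cpow_inv.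
  - rewrite Cpow_inv by exact Hx. reflexivity.
Qed.

Lemma CpowZ_pow (z : C) (k : Z) (m : nat) :
  z <> 0 -> CpowZ z k ^ m = CpowZ z (k * Z.of_nat m).
Proof.
  intros Hz. induction m as [|m IH].
  - replace (k * Z.of_nat 0)%Z with 0%Z by lia. reflexivity.
  - rewrite Cpow_S, IH, <- CpowZ_add by exact Hz. f_equal. lia.
Qed.

Definition csumZ (u : Z -> C) (l : C) : Prop :=
  exists l1 l2, csum (fun n => u (Z.of_nat n)) l1 /\
    csum (fun n => u (- Z.of_nat (S n))%Z) l2 /\ l = l1 + l2.

Lemma csumZ_CSeriesZ (u : Z -> C) (l : C) : csumZ u l -> CSeriesZ u = l.
Proof.
  intros (l1 & l2 & H1 & H2 & ->). unfold CSeriesZ.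
  now rewrite (csum_CSeries _ _ H1), (csum_CSeries _ _ H2).
Qed.

Lemma csumZ_unique (u : Z -> C) (l m : C) : csumZ u l -> csumZ u m -> l = m.
Proof. intros H1 H2. now rewrite <- (csumZ_CSeriesZ _ _ H1), (csumZ_CSeriesZ _ _ H2). Qed.

Lemma csumZ_ext (u v : Z -> C) (l : C) :
  (forall k, u k = v k) -> csumZ u l -> csumZ v l.
Proof.
  intros H (l1 & l2 & H1 & H2 & ->). exists l1, l2. repeat split.
  - apply csum_ext with (2 := H1). auto.
  - apply csum_ext with (2 := H2). auto.
Qed.

Lemma csumZ_plus (u v : Z -> C) (l m : C) :
  csumZ u l -> csumZ v m -> csumZ (fun k => u k + v k) (l + m).
Proof.
  intros (l1 & l2 & H1 & H2 & ->) (m1 & m2 & H3 & H4 & ->).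
  exists (l1 + m1), (l2 + m2). repeat split.
  - now apply csum_plus.
  - now apply csum_plus.
  - ring.
Qed.

Lemma csumZ_scal (c : C) (u : Z -> C) (l : C) :
  csumZ u l -> csumZ (fun k => c * u k) (c * l).
Proof.
  intros (l1 & l2 & H1 & H2 & ->). exists (c * l1), (c * l2). repeat split.
  - now apply (csum_scal c (fun n => u (Z.of_nat n))).
  - now apply (csum_scal c (fun n => u (- Z.of_nat (S n))%Z)).
  - ring.
Qed.

Lemma csumZ_succ (u : Z -> C) (l : C) :
  csumZ u l -> csumZ (fun k => u (k + 1)%Z) l.
Proof.
  intros (l1 & l2 & H1 & H2 & ->). exists (l1 - u 0%Z), (u 0%Z + l2). repeat split.
  - apply csum_behead in H1. apply csum_ext with (2 := H1).
    intros n. f_equal. lia.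
  - apply (csum_cons (fun n => u (- Z.of_nat (S n) + 1)%Z)).
    apply csum_ext with (2 := H2). intros n. f_equal. lia.
  - ring.
Qed.

Lemma csumZ_pred (u : Z -> C) (l : C) :
  csumZ u l -> csumZ (fun k => u (k - 1)%Z) l.
Proof.
  intros (l1 & l2 & H1 & H2 & ->).
  exists (u (-1)%Z + l1), (l2 - u (-1)%Z). repeat split.
  - apply (csum_cons (fun n => u (Z.of_nat n - 1)%Z)).
    apply csum_ext with (2 := H1). intros n. f_equal. lia.
  - apply csum_behead in H2. apply csum_ext with (2 := H2).
    intros n. f_equal. lia.
  - ring.
Qed.

Lemma csumZ_shift (u : Z -> C) (l : C) (j : Z) :
  csumZ u l -> csumZ (fun k => u (k + j)%Z) l.
Proof.
  intros H. destruct (Z_le_gt_dec 0 j) as [Hj|Hj].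
  - replace j with (Z.of_nat (Z.to_nat j)) by lia.
    induction (Z.to_nat j) as [|n IH].
    + apply csumZ_ext with (2 := H). intros k. f_equal. lia.
    + apply csumZ_succ in IH. apply csumZ_ext with (2 := IH). intros k. f_equal. lia.
  - replace j with (- Z.of_nat (Z.to_nat (- j)))%Z by lia.
    induction (Z.to_nat (- j)) as [|n IH].
    + apply csumZ_ext with (2 := H). intros k. f_equal. lia.
    + apply csumZ_pred in IH. apply csumZ_ext with (2 := IH). intros k. f_equal. lia.
Qed.

Lemma csumZ_nonneg (u : Z -> C) (l : C) :
  (forall k, (k < 0)%Z -> u k = 0) -> csum (fun n => u (Z.of_nat n)) l -> csumZ u l.
Proof.
  intros H0 H. exists l, 0. repeat split; [exact H| |ring].
  apply csum_ext with (fun _ => 0); [|apply csum_zero].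
  intros n. symmetry. apply H0. lia.
Qed.

Lemma csumZ_geom (u : Z -> C) (M rho : R) :
  (0 <= M)%R -> (0 <= rho < 1)%R ->
  (forall k, (Cmod (u k) <= M * rho ^ Z.abs_nat k)%R) ->
  csumZ u (CSeriesZ u).
Proof.
  intros HM Hr Hu. exists (CSeries (fun n => u (Z.of_nat n))),
    (CSeries (fun n => u (- Z.of_nat (S n))%Z)).
  repeat split.
  - apply (csum_geom _ M rho Hr). intros n.
    eapply Rle_trans; [apply Hu|]. apply Req_le. do 2 f_equal. lia.
  - apply (csum_geom _ M rho Hr). intros n.
    eapply Rle_trans; [apply Hu|].
    replace (Z.abs_nat (- Z.of_nat (S n))) with (S n) by lia.
    simpl. pose proof (pow_le rho n (proj1 Hr)).
    assert (0 <= M * rho ^ n)%R by now apply Rmult_le_pos. nra.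
Qed.

Lemma csumZ_interchange (u : Z -> nat -> C) (M rho : R) (be : nat -> R)
    (f : Z -> C) (g : nat -> C) :
  (0 <= M)%R -> (0 <= rho < 1)%R -> (forall m, (0 <= be m)%R) -> ex_series be ->
  (forall k m, (Cmod (u k m) <= M * rho ^ Z.abs_nat k * be m)%R) ->
  (forall k, csum (u k) (f k)) ->
  (forall m, csumZ (fun k => u k m) (g m)) ->
  exists S, csumZ f S /\ csum g S.
Proof.
  intros HM Hr Hbe0 Hbe Hu Hf Hg.
  assert (Hpos : forall n, (0 <= M * rho ^ n)%R).
  { intros n. apply Rmult_le_pos; [exact HM|apply pow_le; lra]. }
  destruct (csum_interchange (fun n m => u (Z.of_nat n) m) (fun n => M * rho ^ n)%R be
    (fun n => f (Z.of_nat n)) (fun m => CSeries (fun n => u (Z.of_nat n) m)))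
    as [S1 [H1 H2]]; auto.
  { now apply ex_series_geometric. }
  { intros n m. eapply Rle_trans; [apply Hu|]. apply Req_le. do 3 f_equal. lia. }
  { intros m. destruct (Hg m) as (l1 & l2 & H1 & H2 & _).
    now rewrite (csum_CSeries _ _ H1). }
  destruct (csum_interchange (fun n m => u (- Z.of_nat (S n))%Z m) (fun n => M * rho ^ n)%R be
    (fun n => f (- Z.of_nat (S n))%Z) (fun m => CSeries (fun n => u (- Z.of_nat (S n))%Z m)))
    as [S2 [H3 H4]]; auto.
  { now apply ex_series_geometric. }
  { intros n m. eapply Rle_trans; [apply Hu|].
    replace (Z.abs_nat (- Z.of_nat (S n))) with (S n) by lia.
    apply Rmult_le_compat_r; [apply Hbe0|]. specialize (Hpos n). simpl. nra. }
  { intros m. destruct (Hg m) as (l1 & l2 & H5 & H6 & _).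
    now rewrite (csum_CSeries _ _ H6). }
  exists (S1 + S2). split.
  - exists S1, S2. auto.
  - apply csum_ext with (2 := csum_plus _ _ _ _ H2 H4).
    intros m. destruct (Hg m) as (l1 & l2 & H5 & H6 & ->).
    now rewrite (csum_CSeries _ _ H5), (csum_CSeries _ _ H6).
Qed.

(** * The theta function *)

Section QCalculus.

Variable q : C.
Hypothesis hq : (0 < Cmod q < 1)%R.

Lemma q_neq0 : q <> 0.
Proof. apply Cmod_gt_0, hq. Qed.

Local Hint Resolve q_neq0 : core.

Lemma Cpow_small (n : nat) : (Cmod (q ^ n) <= 1)%R.
Proof. rewrite Cmod_pow, <- (pow1 n). apply pow_incr. lra. Qed.

Lemma is_lim_seq_Cmod_qpow : is_lim_seq (fun n => Cmod q ^ n)%R 0.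
Proof. apply is_lim_seq_geom. rewrite Rabs_pos_eq; lra. Qed.

Lemma Cpow_eventually_small (e : R) :
  (0 < e)%R -> exists N, forall n, (N <= n)%nat -> (Cmod q ^ n < e)%R.
Proof.
  intros He.
  destruct (proj2 (is_lim_seq_spec _ _) is_lim_seq_Cmod_qpow (mkposreal e He)) as [N HN].
  exists N. intros n Hn. specialize (HN n Hn). simpl in HN.
  rewrite Rminus_0_r in HN. eapply Rle_lt_trans; [apply Rle_abs|exact HN].
Qed.

Lemma clim_geom (y : C) : clim (fun n => y * q ^ n) 0.
Proof.
  apply clim_le with (fun n => Cmod y * Cmod q ^ n)%R.
  - intros n. replace (y * q ^ n - 0) with (y * q ^ n) by ring.
    rewrite Cmod_mult, Cmod_pow. lra.
  - replace (Finite 0) with (Finite (Cmod y * 0)) by (f_equal; ring).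
    apply is_lim_seq_mult'; [apply is_lim_seq_const|exact is_lim_seq_Cmod_qpow].
Qed.

Lemma one_minus_qpow (n : nat) : 1 - q * q ^ n <> 0.
Proof.
  intros H. assert (E : q * q ^ n = 1).
  { replace (q * q ^ n) with (1 - (1 - q * q ^ n)) by ring. rewrite H. ring. }
  assert (H0 : Cmod (q * q ^ n) = 1%R) by (rewrite E; apply Cmod_1).
  rewrite Cmod_mult in H0. pose proof (Cpow_small n). pose proof (Cmod_ge_0 (q ^ n)). nra.
Qed.

(** ** Superexponential decay *)

(** Equal to [K^n |q|^(n(n-1)/2)]; the recursive form matches that of [phi11]. *)
Fixpoint majorant (K : R) (n : nat) : R :=
  match n with O => 1 | S m => K * Cmod q ^ m * majorant K m end%R.

Lemma majorant_ge0 (K : R) (n : nat) : (0 <= K)%R -> (0 <= majorant K n)%R.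
Proof.
  intros HK. induction n as [|n IH]; simpl; [lra|].
  apply Rmult_le_pos; [|exact IH]. apply Rmult_le_pos; [exact HK|].
  apply pow_le. lra.
Qed.

Lemma majorant_bounded (K r : R) :
  (0 <= K)%R -> (0 < r)%R ->
  exists M, (0 <= M)%R /\ forall n, (majorant K n * r ^ n <= M)%R.
Proof.
  intros HK Hr.
  destruct (Cpow_eventually_small (/ (K * r + 1))) as [N HN].
  { apply Rinv_0_lt_compat. nra. }
  assert (Hs : forall n, (N <= n)%nat ->
    (majorant K (S n) * r ^ S n <= majorant K n * r ^ n)%R).
  { intros n Hn. specialize (HN n Hn). simpl.
    assert (Hp : (0 <= majorant K n * r ^ n)%R).
    { apply Rmult_le_pos; [now apply majorant_ge0|apply pow_le; lra]. }
    assert (Hk : (K * r * Cmod q ^ n <= 1)%R).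
    { apply Rmult_lt_compat_r with (r := (K * r + 1)%R) in HN; [|nra].
      rewrite Rinv_l in HN by nra. assert (0 <= Cmod q ^ n)%R by (apply pow_le; lra). nra. }
    replace (K * Cmod q ^ n * majorant K n * (r * r ^ n))%R
      with (K * r * Cmod q ^ n * (majorant K n * r ^ n))%R by ring.
    nra. }
  apply (eventually_bounded (fun n => majorant K n * r ^ n)%R N (majorant K N * r ^ N)).
  intros n Hn. induction Hn as [|n Hn IH]; [lra|].
  eapply Rle_trans; [now apply Hs|exact IH].
Qed.

Lemma entire_majorant (c : nat -> C) (M K : R) :
  (0 <= M)%R -> (0 <= K)%R -> (forall n, (Cmod (c n) <= M * majorant K n)%R) -> entire c.
Proof.
  intros HM HK Hc r Hr. destruct (majorant_bounded K r HK Hr) as [M' [HM' H]].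
  exists (M * M')%R. split; [now apply Rmult_le_pos|]. intros n.
  apply Rle_trans with (M * majorant K n * r ^ n)%R.
  - apply Rmult_le_compat_r; [apply pow_le; lra|apply Hc].
  - rewrite Rmult_assoc. now apply Rmult_le_compat_l.
Qed.

Definition tri (k : Z) : C := CpowZ q (k * (k - 1) / 2).

Lemma half_product (k : Z) : (2 * (k * (k - 1) / 2) = k * (k - 1))%Z.
Proof.
  destruct (Z.Even_or_Odd k) as [[j ->]|[j ->]].
  - replace (2 * j * (2 * j - 1))%Z with ((j * (2 * j - 1)) * 2)%Z by ring.
    rewrite Z.div_mul by lia. ring.
  - replace ((2 * j + 1) * (2 * j + 1 - 1))%Z with (((2 * j + 1) * j) * 2)%Z by ring.
    rewrite Z.div_mul by lia. ring.
Qed.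

Lemma tri_add (j k : Z) : tri (j + k) = tri j * tri k * CpowZ q (j * k).
Proof.
  unfold tri. rewrite <- !CpowZ_add by auto. f_equal.
  pose proof (half_product (j + k)). pose proof (half_product j).
  pose proof (half_product k). nia.
Qed.

Lemma tri_0 : tri 0 = 1.
Proof. reflexivity. Qed.

Lemma tri_1 : tri 1 = 1.
Proof. reflexivity. Qed.

Lemma tri_m1 : tri (-1) = q.
Proof. unfold tri. simpl. ring. Qed.

Lemma tri_succ (k : Z) : tri (k + 1) = CpowZ q k * tri k.
Proof. rewrite tri_add, tri_1, Z.mul_1_r. ring. Qed.

Lemma tri_neq0 (k : Z) : tri k <> 0.
Proof. now apply CpowZ_neq0. Qed.

Lemma tri_majorant (n : nat) :
  (Cmod (tri (Z.of_nat n)) <= majorant 1 n)%R /\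
  (Cmod (tri (- Z.of_nat n)) <= majorant 1 n)%R.
Proof.
  induction n as [|n [IH1 IH2]].
  - simpl. change (tri 0) with (RtoC 1). rewrite Cmod_1. lra.
  - assert (0 <= Cmod q ^ n)%R by (apply pow_le; lra).
    pose proof (majorant_ge0 1 n ltac:(lra)). simpl majorant. split.
    + replace (Z.of_nat (S n)) with (Z.of_nat n + 1)%Z by lia.
      rewrite tri_succ, CpowZ_of_nat, Cmod_mult, Cmod_pow, Rmult_1_l.
      now apply Rmult_le_compat_l.
    + assert (E : tri (- Z.of_nat (S n)) = q ^ S n * tri (- Z.of_nat n)).
      { replace (- Z.of_nat n)%Z with (- Z.of_nat (S n) + 1)%Z by lia.
        rewrite tri_succ, CpowZ_opp_nat. field. apply Cpow_nz. auto. }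
      rewrite E, Cmod_mult, Cmod_pow, Rmult_1_l.
      assert (Cmod q ^ S n <= Cmod q ^ n)%R by (simpl; nra).
      apply Rmult_le_compat; auto using Cmod_ge_0. apply pow_le. lra.
Qed.

Lemma theta_term_bound (x : C) (rho : R) :
  x <> 0 -> (0 < rho)%R ->
  exists M, (0 <= M)%R /\
    forall k, (Cmod (tri k * CpowZ x k)%C <= M * rho ^ Z.abs_nat k)%R.
Proof.
  intros Hx Hr. assert (Hc : (0 < Cmod x)%R) by now apply Cmod_gt_0.
  destruct (majorant_bounded 1 (Cmod x / rho)) as [M1 [H1 HM1]];
    [lra|now apply Rdiv_lt_0_compat|].
  destruct (majorant_bounded 1 (/ (Cmod x * rho))) as [M2 [H2 HM2]];
    [lra|apply Rinv_0_lt_compat; nra|].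
  exists (M1 + M2)%R. split; [lra|]. intros k.
  assert (Hpr : forall n, (0 < rho ^ n)%R) by (intros; now apply pow_lt).
  assert (Hpc : forall n, (0 < Cmod x ^ n)%R) by (intros; now apply pow_lt).
  destruct (Z_le_gt_dec 0 k) as [Hk|Hk].
  - replace k with (Z.of_nat (Z.abs_nat k)) at 1 2 by lia.
    set (n := Z.abs_nat k). specialize (HM1 n). specialize (Hpr n). specialize (Hpc n).
    rewrite CpowZ_of_nat, Cmod_mult, Cmod_pow.
    apply Rle_trans with (majorant 1 n * Cmod x ^ n)%R.
    + apply Rmult_le_compat_r; [lra|apply tri_majorant].
    + unfold Rdiv in HM1. rewrite Rpow_mult_distr, pow_inv in HM1.
      replace (majorant 1 n * Cmod x ^ n)%R
        with (majorant 1 n * (Cmod x ^ n * / rho ^ n) * rho ^ n)%R by (field; lra).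
      apply Rmult_le_compat_r; lra.
  - replace k with (- Z.of_nat (Z.abs_nat k))%Z at 1 2 by lia.
    set (n := Z.abs_nat k). specialize (HM2 n). specialize (Hpr n). specialize (Hpc n).
    rewrite CpowZ_opp_nat, Cmod_mult, Cmod_inv, Cmod_pow by now apply Cpow_nz.
    apply Rle_trans with (majorant 1 n * / Cmod x ^ n)%R.
    + apply Rmult_le_compat_r; [apply Rlt_le, Rinv_0_lt_compat; lra|apply tri_majorant].
    + rewrite pow_inv, Rpow_mult_distr in HM2.
      replace (majorant 1 n * / Cmod x ^ n)%R
        with (majorant 1 n * / (Cmod x ^ n * rho ^ n) * rho ^ n)%R by (field; lra).
      apply Rmult_le_compat_r; lra.
Qed.

Lemma csumZ_theta (x : C) : x <> 0 -> csumZ (fun k => tri k * CpowZ x k) (theta q x).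
Proof.
  intros Hx. destruct (theta_term_bound x (/ 2) Hx ltac:(lra)) as [M [HM H]].
  apply (csumZ_geom (fun k => tri k * CpowZ x k) M (/ 2)); [exact HM|lra|exact H].
Qed.

Lemma theta_q (x : C) : x <> 0 -> theta q (q * x) = theta q x / x.
Proof.
  intros Hx.
  assert (Hqx : q * x <> 0) by now apply Cmult_neq_0.
  apply csumZ_unique with (fun k => tri k * CpowZ (q * x) k).
  - now apply csumZ_theta.
  - pose proof (csumZ_theta x Hx) as H. apply csumZ_succ in H.
    apply (csumZ_scal (/ x)) in H. replace (theta q x / x) with (/ x * theta q x) by (unfold Cdiv; ring).
    apply csumZ_ext with (2 := H). intros k.
    rewrite tri_succ, CpowZ_succ, CpowZ_mult by auto. field. exact Hx.
Qed.

Lemma theta_qpow (x : C) (k : Z) :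
  x <> 0 -> theta q (CpowZ q k * x) = theta q x / (CpowZ x k * tri k).
Proof.
  intros Hx. revert k. apply Z.bi_induction.
  - intros ? ? ->. reflexivity.
  - rewrite tri_0. simpl. replace (1 * x) with x by ring. field.
  - intros k. replace (Z.succ k) with (k + 1)%Z by lia.
    pose proof (CpowZ_neq0 q k q_neq0) as H1. pose proof (CpowZ_neq0 x k Hx) as H2.
    pose proof (tri_neq0 k) as H3.
    rewrite tri_succ, !CpowZ_succ by auto.
    replace (q * CpowZ q k * x) with (q * (CpowZ q k * x)) by ring.
    rewrite theta_q by now apply Cmult_neq_0.
    split; intros H.
    + rewrite H. field. auto.
    + replace (theta q (CpowZ q k * x))
        with (theta q (CpowZ q k * x) / (CpowZ q k * x) * (CpowZ q k * x)) by (field; auto).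
      rewrite H. field. auto.
Qed.

(** Column [m] consists of the terms of theta shifted by [sg * m] and multiplied
    by [d m].  The terms of theta decay faster than [2^(-|k|)], so the shift costs
    at most a factor [2^m]; this is where [K < 1/2] is used. *)
Lemma theta_columns (x : C) (d : nat -> C) (h : Z -> C) (sg : Z) (F K : R) :
  x <> 0 -> (Z.abs sg <= 1)%Z -> (0 <= F)%R -> (0 <= K < / 2)%R ->
  (forall m, (Cmod (d m) <= F * K ^ m)%R) ->
  (forall n, csum (fun m => tri (n + sg * Z.of_nat m) * CpowZ x (n + sg * Z.of_nat m) * d m)
               (h n)) ->
  csumZ h (theta q x * CSeries d).
Proof.
  intros Hx Hsg HF HK Hd Hh.
  destruct (theta_term_bound x (/ 2) Hx ltac:(lra)) as [M [HM HT]].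
  destruct (csum_geom d F K ltac:(lra) Hd) as [Hds _].
  destruct (csumZ_interchange
    (fun n m => tri (n + sg * Z.of_nat m) * CpowZ x (n + sg * Z.of_nat m) * d m)
    M (/ 2) (fun m => F * (2 * K) ^ m)%R h (fun m => theta q x * d m)) as [S [H1 H2]].
  - exact HM.
  - lra.
  - intros m. apply Rmult_le_pos; [exact HF|apply pow_le; lra].
  - apply ex_series_geometric. lra.
  - intros n m. rewrite Cmod_mult.
    set (k := (n + sg * Z.of_nat m)%Z).
    assert (Hk : (Z.abs_nat n <= Z.abs_nat k + m)%nat).
    { unfold k. assert (sg = -1 \/ sg = 0 \/ sg = 1)%Z as [->|[->| ->]] by lia; lia. }
    assert (Hp : ((/ 2) ^ Z.abs_nat k <= (/ 2) ^ Z.abs_nat n * 2 ^ m)%R).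
    { apply Rmult_le_reg_r with ((/ 2) ^ m)%R; [apply pow_lt; lra|].
      rewrite Rmult_assoc, <- Rpow_mult_distr. replace (2 * / 2)%R with 1%R by field.
      rewrite pow1, Rmult_1_r, <- pow_add.
      replace (Z.abs_nat k + m)%nat
        with (Z.abs_nat n + (Z.abs_nat k + m - Z.abs_nat n))%nat by lia.
      rewrite pow_add. rewrite <- (Rmult_1_r ((/ 2) ^ Z.abs_nat n)) at 2.
      apply Rmult_le_compat_l; [apply pow_le; lra|].
      rewrite <- (pow1 (Z.abs_nat k + m - Z.abs_nat n)). apply pow_incr. lra. }
    specialize (HT k). specialize (Hd m).
    apply Rle_trans with ((M * ((/ 2) ^ Z.abs_nat n * 2 ^ m)) * (F * K ^ m))%R.
    + apply Rmult_le_compat; auto using Cmod_ge_0.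
      eapply Rle_trans; [exact HT|]. now apply Rmult_le_compat_l.
    + apply Req_le. rewrite Rpow_mult_distr. ring.
  - exact Hh.
  - intros m. rewrite Cmult_comm.
    apply csumZ_ext with (fun n => d m *
      (tri (n + sg * Z.of_nat m) * CpowZ x (n + sg * Z.of_nat m))).
    { intros n. ring. }
    apply csumZ_scal. apply (csumZ_shift (fun k => tri k * CpowZ x k)).
    now apply csumZ_theta.
  - replace (theta q x * CSeries d) with S; [exact H1|].
    apply (csum_unique _ _ _ H2). now apply csum_scal.
Qed.

(** * Confluent series and infinite products *)

(** Coefficients of [1phi1(al; c; q, u)]. *)
Fixpoint phi11 (al c : C) (n : nat) : C :=
  match n with
  | O => 1
  | S m => - q ^ m * (1 - al * q ^ m) / ((1 - q * q ^ m) * (1 - c * q ^ m)) * phi11 al c m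
  end.

(** [(c; q)_n] is never zero, that is, [c] may be a lower entry of a series. *)
Definition regular (c : C) : Prop := forall n, 1 - c * q ^ n <> 0.

Lemma regular_q : regular q.
Proof. exact one_minus_qpow. Qed.

Lemma regular_0 : regular 0.
Proof. intros n. rewrite Cmult_0_l. replace (1 - 0) with (RtoC 1) by ring. exact C1_nz. Qed.

Lemma regular_mulq (c : C) : regular c -> regular (c * q).
Proof.
  intros H n. specialize (H (S n)). rewrite Cpow_S in H.
  now replace (c * q * q ^ n) with (c * (q * q ^ n)) by ring.
Qed.

Lemma regular_bound (c : C) :
  regular c -> exists d, (0 < d)%R /\ forall n, (d <= Cmod (1 - c * q ^ n))%R.
Proof.
  intros Hc. pose proof (Cmod_ge_0 c) as Hc0.
  destruct (Cpow_eventually_small (/ (2 * (Cmod c + 1)))) as [N HN].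
  { apply Rinv_0_lt_compat. lra. }
  assert (Hl : forall n, (N <= n)%nat -> (/ 2 <= Cmod (1 - c * q ^ n))%R).
  { intros n Hn. specialize (HN n Hn).
    pose proof (Cmod_triangle (1 - c * q ^ n) (c * q ^ n)) as T.
    replace (1 - c * q ^ n + c * q ^ n) with (RtoC 1) in T by ring.
    rewrite Cmod_1, Cmod_mult, Cmod_pow in T.
    assert ((Cmod c + 1) * Cmod q ^ n < / 2)%R.
    { apply Rmult_lt_compat_l with (r := (Cmod c + 1)%R) in HN; [|lra].
      replace ((Cmod c + 1) * / (2 * (Cmod c + 1)))%R with (/ 2)%R in HN by (field; lra). lra. }
    assert (0 <= Cmod q ^ n)%R by (apply pow_le; lra). nra. }
  assert (Hf : exists d, (0 < d <= / 2)%R /\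
    forall n, (n < N)%nat -> (d <= Cmod (1 - c * q ^ n))%R).
  { clear Hl HN. induction N as [|N [d [H1 H2]]].
    - exists (/ 2)%R. split; [lra|]. intros; lia.
    - exists (Rmin d (Cmod (1 - c * q ^ N))). split.
      + split; [apply Rmin_pos; [lra|now apply Cmod_gt_0]|].
        eapply Rle_trans; [apply Rmin_l|lra].
      + intros n Hn. destruct (Nat.eq_dec n N) as [->|]; [apply Rmin_r|].
        eapply Rle_trans; [apply Rmin_l|apply H2; lia]. }
  destruct Hf as [d [H1 H2]]. exists d. split; [lra|]. intros n.
  destruct (Nat.lt_ge_cases n N) as [H|H]; [now apply H2|].
  eapply Rle_trans; [|now apply Hl]. lra.
Qed.

(** Uniformity in [i] is what allows the limit [i -> oo] in [phi11_sum]. *)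
Lemma phi11_majorant (al c : C) :
  regular c -> exists K, (0 <= K)%R /\
    forall i n, (Cmod (phi11 al (c * q ^ i) n) <= majorant K n)%R.
Proof.
  intros Hc. destruct (regular_bound c Hc) as [d [Hd Hdc]].
  destruct (regular_bound q regular_q) as [d' [Hd' Hdq]].
  pose proof (Cmod_ge_0 al) as Ha.
  assert (Hdd : (0 < d' * d)%R) by now apply Rmult_lt_0_compat.
  assert (Hi : (0 < / (d' * d))%R) by now apply Rinv_0_lt_compat.
  set (K := ((1 + Cmod al) * / (d' * d))%R).
  assert (HK : (0 <= K)%R) by (apply Rmult_le_pos; lra).
  exists K. split; [exact HK|]. intros i n. induction n as [|n IH].
  - simpl. rewrite Cmod_1. lra.
  - simpl phi11. simpl majorant. rewrite Cmod_mult.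
    apply Rmult_le_compat; auto using Cmod_ge_0.
    specialize (Hdc (i + n)%nat). specialize (Hdq n).
    rewrite Cpow_add_r in Hdc.
    replace (c * (q ^ i * q ^ n)) with (c * q ^ i * q ^ n) in Hdc by ring.
    assert (Hne : (1 - q * q ^ n) * (1 - c * q ^ i * q ^ n) <> 0).
    { apply Cmod_gt_0. rewrite Cmod_mult.
      apply Rmult_lt_0_compat; lra. }
    rewrite Cmod_div by exact Hne. rewrite !Cmod_mult, Cmod_opp, Cmod_pow.
    assert (H1 : (Cmod (1 - al * q ^ n) <= 1 + Cmod al)%R).
    { eapply Rle_trans; [apply Cmod_triangle|].
      rewrite Cmod_opp, Cmod_1, Cmod_mult. pose proof (Cpow_small n). nra. }
    assert (H2 : (/ (Cmod (1 - q * q ^ n) * Cmod (1 - c * q ^ i * q ^ n)) <= / (d' * d))%R).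
    { apply Rinv_le_contravar; [exact Hdd|]. apply Rmult_le_compat; lra. }
    assert (H3 : (0 <= Cmod q ^ n)%R) by (apply pow_le; lra).
    unfold K, Rdiv.
    replace ((1 + Cmod al) * / (d' * d) * Cmod q ^ n)%R
      with (Cmod q ^ n * (1 + Cmod al) * / (d' * d))%R by ring.
    apply Rmult_le_compat; [|apply Rlt_le, Rinv_0_lt_compat, Rmult_lt_0_compat; lra| |exact H2].
    + apply Rmult_le_pos; [exact H3|apply Cmod_ge_0].
    + now apply Rmult_le_compat_l.
Qed.

Lemma entire_phi11 (al c : C) : regular c -> entire (phi11 al c).
Proof.
  intros Hc. destruct (phi11_majorant al c Hc) as [K [HK H]].
  apply entire_majorant with 1%R K; [lra|exact HK|].
  intros n. specialize (H O n). simpl in H. rewrite Cmult_1_r in H. lra.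
Qed.

Lemma csum_scaled_arg (c : nat -> C) (u t : C) :
  entire c -> csum (fun n => c n * u ^ n * t ^ n) (power_series c (t * u)).
Proof.
  intros Hc. apply csum_ext with (2 := csum_entire c (t * u) Hc).
  intros n. rewrite Cpow_mult_l. ring.
Qed.

Lemma phi11_equation (al c u : C) :
  regular c ->
  power_series (phi11 al c) u - (1 + c / q) * power_series (phi11 al c) (q * u)
  + c / q * power_series (phi11 al c) (q * q * u)
  = - u * power_series (phi11 al c) (q * u)
    + al * u * power_series (phi11 al c) (q * q * u).
Proof.
  intros Hc. pose proof (entire_phi11 al c Hc) as He.
  set (f := phi11 al c) in *.
  pose proof (csum_entire f u He) as S0.
  pose proof (csum_scaled_arg f u q He) as S1.
  pose proof (csum_scaled_arg f u (q * q) He) as S2.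
  apply csum_unique with (fun n => f n * u ^ n + - (1 + c / q) * (f n * u ^ n * q ^ n)
    + c / q * (f n * u ^ n * (q * q) ^ n)).
  - replace (power_series f u - (1 + c / q) * power_series f (q * u)
      + c / q * power_series f (q * q * u))
      with (power_series f u + - (1 + c / q) * power_series f (q * u)
      + c / q * power_series f (q * q * u)) by ring.
    apply csum_plus; [apply csum_plus; [exact S0|]|]; now apply csum_scal.
  - set (v := fun n => f n * u ^ n + - (1 + c / q) * (f n * u ^ n * q ^ n)
      + c / q * (f n * u ^ n * (q * q) ^ n)).
    replace (- u * power_series f (q * u) + al * u * power_series f (q * q * u))
      with (v O + (- u * power_series f (q * u) + al * u * power_series f (q * q * u))).
    2:{ unfold v. simpl. unfold Cdiv. ring. }
    apply csum_cons.
    apply csum_ext with (fun n => - u * (f n * u ^ n * q ^ n)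
      + al * u * (f n * u ^ n * (q * q) ^ n)).
    2:{ apply csum_plus; now apply csum_scal. }
    intros n. unfold v. unfold f; simpl phi11; fold f.
    rewrite !Cpow_mult_l, !Cpow_S.
    pose proof (one_minus_qpow n) as H1. pose proof (Hc n) as H2.
    field. auto.
Qed.

(** By Euler's formula [(y; q)_oo = 1phi1(0; 0; q, y)], which makes the infinite
    product an entire power series and its functional equation a case of
    [phi11_equation]. *)
Definition euler : nat -> C := phi11 0 0.

Lemma entire_euler : entire euler.
Proof. apply entire_phi11, regular_0. Qed.

Notation P := (power_series euler).

Lemma P_0 : P 0 = 1.
Proof. apply power_series_0. Qed.

Lemma P_shift (y : C) : P y = (1 - y) * P (q * y).
Proof.
  pose proof (phi11_equation 0 0 y regular_0) as H. fold euler in H.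
  unfold Cdiv in H.
  replace (P y) with (P y - (1 + 0 * / q) * P (q * y) + 0 * / q * P (q * q * y)
    + P (q * y)) by ring.
  rewrite H. ring.
Qed.

Lemma P_qpoch (y : C) (n : nat) : P y = qpoch q y n * P (y * q ^ n).
Proof.
  induction n as [|n IH].
  - simpl. rewrite Cmult_1_r. ring.
  - rewrite IH, (P_shift (y * q ^ n)). simpl qpoch. rewrite Cpow_S.
    replace (q * (y * q ^ n)) with (y * (q * q ^ n)) by ring. ring.
Qed.

Lemma phi11_family_lim (al c : C) (w : nat -> C) :
  regular c -> clim w 0 -> clim (fun i => power_series (phi11 al (c * q ^ i)) (w i)) 1.
Proof.
  intros Hc Hw. destruct (phi11_majorant al c Hc) as [K [HK H]].
  destruct (majorant_bounded K 1 HK ltac:(lra)) as [M [HM HMb]].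
  apply (power_series_family_lim (fun i => phi11 al (c * q ^ i)) w 1 M 1); auto.
  intros i. repeat split; [exact HM|lra|]. intros n. eapply Rle_trans; [apply H|].
  specialize (HMb n). rewrite pow1 in *. lra.
Qed.

Lemma entire_lim (c : nat -> C) (w : nat -> C) :
  entire c -> clim w 0 -> clim (fun i => power_series c (w i)) (c O).
Proof.
  intros Hc. destruct (entire_geom c 1 Hc ltac:(lra)) as [M HM].
  now apply power_series_lim with M 1%R.
Qed.

Lemma clim_P_qpow (y : C) : clim (fun n => P (y * q ^ n)) 1.
Proof. apply (entire_lim euler); [apply entire_euler|apply clim_geom]. Qed.

Lemma clim_qpoch (y : C) : clim (qpoch q y) (P y).
Proof.
  assert (Hl : clim (fun n => P y * / P (y * q ^ n)) (P y * / 1)).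
  { apply clim_mult; [apply clim_const|]. apply clim_inv; [exact C1_nz|apply clim_P_qpow]. }
  replace (P y * / 1) with (P y) in Hl by (field; exact C1_nz).
  intros e He. destruct (Hl e He) as [N1 H1].
  destruct (clim_P_qpow y (/ 2)%R ltac:(lra)) as [N2 H2].
  exists (N1 + N2)%nat. intros n Hn. specialize (H1 n ltac:(lia)). specialize (H2 n ltac:(lia)).
  replace (qpoch q y n) with (P y * / P (y * q ^ n)); [exact H1|].
  assert (Hne : P (y * q ^ n) <> 0).
  { intros E. rewrite E in H2. replace (0 - 1) with (- (1)) in H2 by ring.
    rewrite Cmod_m1 in H2. lra. }
  rewrite (P_qpoch y n). field. exact Hne.
Qed.

Lemma qpoch_inf_P (y : C) : qpoch_inf q y = P y.
Proof. apply clim_Clim, clim_qpoch. Qed.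

Lemma qpoch_neq0 (y : C) (n : nat) : regular y -> qpoch q y n <> 0.
Proof.
  intros H. induction n as [|n IH]; simpl; [exact C1_nz|]. now apply Cmult_neq_0.
Qed.

Lemma P_neq0 (y : C) : regular y -> P y <> 0.
Proof.
  intros H. destruct (clim_P_qpow y (/ 2)%R ltac:(lra)) as [N HN].
  rewrite (P_qpoch y N). apply Cmult_neq_0; [now apply qpoch_neq0|].
  intros E. specialize (HN N (le_n N)). rewrite E in HN.
  replace (0 - 1) with (- (1)) in HN by ring. rewrite Cmod_m1 in HN. lra.
Qed.

(** ** The sum of the confluent series at [c / al] *)

Lemma phi11_shift_c (al c : C) (n : nat) :
  regular c ->
  phi11 al (c * q) n * (1 - c * q ^ n) = (1 - c) * phi11 al c n.
Proof.
  intros Hc. induction n as [|n IH].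
  - simpl. ring.
  - simpl phi11.
    pose proof (one_minus_qpow n) as H1. pose proof (Hc n) as H2. pose proof (Hc (S n)) as H3.
    rewrite Cpow_S in H3.
    assert (H4 : 1 - c * q * q ^ n <> 0).
    { now replace (c * q * q ^ n) with (c * (q * q ^ n)) by ring. }
    replace (phi11 al c n) with (phi11 al c n * (1 - c) / (1 - c)).
    2:{ field. specialize (Hc O). simpl in Hc. now rewrite Cmult_1_r in Hc. }
    rewrite (Cmult_comm (phi11 al c n)), <- IH.
    assert (H5 : 1 - c <> 0).
    { specialize (Hc O). simpl in Hc. now rewrite Cmult_1_r in Hc. }
    rewrite Cpow_S. field. auto.
Qed.

(** The termwise difference is [(1 - c) (T m - T (S m))] with [T] as below, and
    [T 0 = 0]. *)
Lemma phi11_sum_step (al c : C) :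
  al <> 0 -> regular c ->
  (1 - c) * power_series (phi11 al c) (c / al)
  = (1 - c / al) * power_series (phi11 al (c * q)) (c * q / al).
Proof.
  intros Ha Hc.
  pose proof (entire_phi11 al c Hc) as E1.
  pose proof (entire_phi11 al (c * q) (regular_mulq c Hc)) as E2.
  set (x := c / al).
  replace (c * q / al) with (q * x) by (unfold x; field; exact Ha).
  set (T := fun m => (1 - q ^ m) * (phi11 al c m * x ^ m)).
  set (l := power_series (phi11 al c) x - power_series (phi11 al c) (q * x)).
  assert (HT : csum T l).
  { apply csum_ext with (fun m => phi11 al c m * x ^ m - phi11 al c m * x ^ m * q ^ m).
    { intros m. unfold T. ring. }
    apply csum_minus; [now apply csum_entire|now apply csum_scaled_arg]. }
  assert (HT1 : csum (fun m => (1 - c) * (T m - T (S m))) ((1 - c) * (l - (l - T O)))).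
  { apply csum_scal, csum_minus; [exact HT|now apply csum_behead]. }
  assert (HT0 : T O = 0) by (unfold T; simpl; ring).
  pose proof (csum_minus _ _ _ _ (csum_scal (1 - c) _ _ (csum_entire _ x E1))
    (csum_scal (1 - x) _ _ (csum_entire _ (q * x) E2))) as HD.
  assert (E : (1 - c) * power_series (phi11 al c) x
    - (1 - x) * power_series (phi11 al (c * q)) (q * x) = 0).
  { replace (RtoC 0) with ((1 - c) * (l - (l - T O))) by (rewrite HT0; ring).
    apply (csum_unique _ _ _ HD). apply csum_ext with (2 := HT1).
    intros m. unfold T. simpl phi11.
    pose proof (one_minus_qpow m) as H1. pose proof (Hc m) as H2.
    replace (phi11 al (c * q) m)
      with (phi11 al (c * q) m * (1 - c * q ^ m) / (1 - c * q ^ m)) by (field; exact H2).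
    rewrite phi11_shift_c by exact Hc.
    rewrite Cpow_mult_l, !Cpow_S.
    assert (Hx : c = x * al) by (unfold x; field; exact Ha).
    rewrite Hx in H2 |- *. field. auto. }
  replace ((1 - c) * power_series (phi11 al c) x)
    with ((1 - c) * power_series (phi11 al c) x
    - (1 - x) * power_series (phi11 al (c * q)) (q * x)
    + (1 - x) * power_series (phi11 al (c * q)) (q * x)) by ring.
  rewrite E. ring.
Qed.

Lemma regular_qpow (c : C) (n : nat) : regular c -> regular (c * q ^ n).
Proof.
  intros H m. specialize (H (n + m)%nat). rewrite Cpow_add_r in H.
  now replace (c * q ^ n * q ^ m) with (c * (q ^ n * q ^ m)) by ring.
Qed.

(** Iterating [c -> c q] produces the two infinite products, while the series
    with lower entry [c q^n] tends to its constant term. *)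
Lemma phi11_sum (al c : C) :
  al <> 0 -> regular c -> P c * power_series (phi11 al c) (c / al) = P (c / al).
Proof.
  intros Ha Hc.
  assert (Hit : forall n, qpoch q c n * power_series (phi11 al c) (c / al)
    = qpoch q (c / al) n * power_series (phi11 al (c * q ^ n)) (c / al * q ^ n)).
  { induction n as [|n IH].
    - simpl. rewrite !Cmult_1_r. reflexivity.
    - simpl qpoch.
      pose proof (phi11_sum_step al (c * q ^ n) Ha (regular_qpow c n Hc)) as H.
      replace (c * q ^ n / al) with (c / al * q ^ n) in H by (field; exact Ha).
      replace (c * q ^ n * q / al) with (c / al * q ^ S n) in H
        by (rewrite Cpow_S; field; exact Ha).
      replace (c * q ^ n * q) with (c * q ^ S n) in H by (rewrite Cpow_S; ring).
      replace (qpoch q c n * (1 - c * q ^ n) * power_series (phi11 al c) (c / al))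
        with ((1 - c * q ^ n) * (qpoch q c n * power_series (phi11 al c) (c / al))) by ring.
      rewrite IH.
      replace ((1 - c * q ^ n) * (qpoch q (c / al) n
        * power_series (phi11 al (c * q ^ n)) (c / al * q ^ n)))
        with (qpoch q (c / al) n * ((1 - c * q ^ n)
        * power_series (phi11 al (c * q ^ n)) (c / al * q ^ n))) by ring.
      rewrite H. ring. }
  apply clim_unique with
    (fun n => qpoch q c n * power_series (phi11 al c) (c / al)).
  - apply clim_mult; [apply clim_qpoch|apply clim_const].
  - replace (P (c / al)) with (P (c / al) * 1) by ring.
    apply clim_ext with (fun n => qpoch q (c / al) n
      * power_series (phi11 al (c * q ^ n)) (c / al * q ^ n)).
    { intros n. now rewrite Hit. }
    apply clim_mult; [apply clim_qpoch|].
    apply phi11_family_lim; [exact Hc|apply clim_geom].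
Qed.

(** * Laurent coefficients of the solutions at infinity *)

Definition off_spiral (c : C) : Prop := forall k : Z, c <> CpowZ q k.

Lemma off_spiral_regular (c : C) : off_spiral c -> regular c.
Proof.
  intros H n E. apply (H (- Z.of_nat n)%Z). rewrite CpowZ_opp_nat.
  assert (Hq : q ^ n <> 0) by now apply Cpow_nz.
  replace c with (c * q ^ n / q ^ n) by (field; exact Hq).
  replace (c * q ^ n) with (1 - (1 - c * q ^ n)) by ring. rewrite E. field. exact Hq.
Qed.

Lemma off_spiral_mulq (c : C) : off_spiral c -> off_spiral (c * q).
Proof.
  intros H k E. apply (H (k - 1)%Z).
  replace c with (c * q / q) by (field; auto). rewrite E.
  replace k with (k - 1 + 1)%Z at 1 by lia. rewrite CpowZ_succ by auto. field. auto.
Qed.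

Lemma off_spiral_inv (A B : C) :
  A <> 0 -> B <> 0 -> off_spiral (A / B) -> off_spiral (B / A).
Proof.
  intros HA HB H k E. apply (H (- k)%Z). rewrite CpowZ_opp by auto.
  rewrite <- E. field. auto.
Qed.

Lemma off_spiral_minus (A B : C) : B <> 0 -> off_spiral (A / B) -> A - B <> 0.
Proof.
  intros HB H E. apply (H 0%Z). simpl. replace A with (A - B + B) by ring. rewrite E.
  field. exact HB.
Qed.

(** By Heine's transformation this is the numerator in
    [2phi1(A, 0; A q/B; q, w) = 1phi1(q/B; A q/B; q, A w) / (w; q)_oo], the form of the
    Laplace transforms.  The numbers [1phi1(q/B; A q/B; q, A q^(k+1))] are at the same
    time, up to elementary factors, the Laurent coefficients of a solution at infinity. *)
Definition out_num (A B : C) : nat -> C := phi11 (q / B) (A / B * q).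

Lemma entire_out_num (A B : C) : off_spiral (A / B) -> entire (out_num A B).
Proof. intros H. now apply entire_phi11, off_spiral_regular, off_spiral_mulq. Qed.

Lemma out_num_equation (A B u : C) :
  B <> 0 -> off_spiral (A / B) ->
  B * power_series (out_num A B) u - (A + B - B * u) * power_series (out_num A B) (q * u)
  + (A - q * u) * power_series (out_num A B) (q * q * u) = 0.
Proof.
  intros HB H.
  pose proof (phi11_equation (q / B) (A / B * q) u
    (off_spiral_regular _ (off_spiral_mulq _ H))) as E.
  fold (out_num A B) in E. revert E.
  generalize (power_series (out_num A B) u) (power_series (out_num A B) (q * u))
    (power_series (out_num A B) (q * q * u)). intros s0 s1 s2 E.
  replace (B * s0 - (A + B - B * u) * s1 + (A - q * u) * s2)
    with (B * (s0 - (1 + A / B * q / q) * s1 + A / B * q / q * s2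
           - (- u * s1 + q / B * u * s2))) by (field; auto).
  rewrite E. ring.
Qed.

Lemma out_num_sum (A B : C) :
  A <> 0 -> B <> 0 -> off_spiral (A / B) -> P (A / B * q) * power_series (out_num A B) A = P A.
Proof.
  intros HA HB H. unfold out_num.
  replace A with (A / B * q / (q / B)) at 3 4 by (field; auto).
  apply phi11_sum.
  - intros E. apply (Cmult_neq_0 (q / B) B).
    + intros E'. apply q_neq0. replace q with (q / B * B) by (field; exact HB).
      rewrite E'. ring.
    + exact HB.
    + rewrite E. ring.
  - now apply off_spiral_regular, off_spiral_mulq.
Qed.

Definition casoratian (A B : C) (n : nat) : C :=
  B * power_series (out_num A B) (A * q ^ n) * power_series (out_num B A) (B * q ^ S n)
  - A * power_series (out_num A B) (A * q ^ S n) * power_series (out_num B A) (B * q ^ n).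

(** Up to power factors the two families solve one second-order recurrence, so that
    their Casoratian satisfies a first-order recurrence. *)
Lemma casoratian_step (A B : C) (n : nat) :
  A <> 0 -> B <> 0 -> off_spiral (A / B) ->
  casoratian A B n = (1 - q * q ^ n) * casoratian A B (S n).
Proof.
  intros HA HB H.
  pose proof (out_num_equation A B (A * q ^ n) HB H) as E1.
  pose proof (out_num_equation B A (B * q ^ n) HA (off_spiral_inv A B HA HB H)) as E2.
  unfold casoratian. rewrite !Cpow_S.
  replace (A * (q * (q * q ^ n))) with (q * q * (A * q ^ n)) by ring.
  replace (B * (q * (q * q ^ n))) with (q * q * (B * q ^ n)) by ring.
  replace (A * (q * q ^ n)) with (q * (A * q ^ n)) by ring.
  replace (B * (q * q ^ n)) with (q * (B * q ^ n)) by ring.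
  revert E1 E2.
  generalize (power_series (out_num A B) (A * q ^ n)) (power_series (out_num A B) (q * (A * q ^ n)))
    (power_series (out_num A B) (q * q * (A * q ^ n)))
    (power_series (out_num B A) (B * q ^ n)) (power_series (out_num B A) (q * (B * q ^ n)))
    (power_series (out_num B A) (q * q * (B * q ^ n))).
  intros a0 a1 a2 b0 b1 b2 E1 E2.
  apply Ceq_of_minus.
  transitivity (b1 * (B * a0 - (A + B - B * (A * q ^ n)) * a1 + (A - q * (A * q ^ n)) * a2)
    - a1 * (A * b0 - (B + A - A * (B * q ^ n)) * b1 + (B - q * (B * q ^ n)) * b2)).
  - ring.
  - rewrite E1, E2. ring.
Qed.

(** Both series tend to [1], which gives the limit of the Casoratian, and the
    recurrence relates this limit to the initial value. *)
Lemma casoratian_value (A B : C) :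
  A <> 0 -> B <> 0 -> off_spiral (A / B) -> casoratian A B 0 = P q * (B - A).
Proof.
  intros HA HB H.
  assert (Hn : forall n, casoratian A B 0 = qpoch q q n * casoratian A B n).
  { induction n as [|n IH]; [simpl; ring|].
    rewrite IH, casoratian_step by assumption. simpl qpoch. ring. }
  apply clim_unique with (fun _ : nat => casoratian A B 0); [apply clim_const|].
  apply clim_ext with (fun n => qpoch q q n * casoratian A B n).
  { intros n. symmetry. apply Hn. }
  apply clim_mult; [apply clim_qpoch|].
  pose proof (entire_lim _ _ (entire_out_num A B H) (clim_geom A)) as L1.
  pose proof (entire_lim _ _ (entire_out_num B A (off_spiral_inv A B HA HB H)) (clim_geom B)) as L2.
  pose proof (clim_shift _ _ L1) as L1'. pose proof (clim_shift _ _ L2) as L2'.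
  replace (B - A) with (B * 1 * 1 + (- A) * 1 * 1) by ring.
  apply clim_ext with (fun n =>
    B * power_series (out_num A B) (A * q ^ n) * power_series (out_num B A) (B * q ^ S n)
    + (- A) * power_series (out_num A B) (A * q ^ S n) * power_series (out_num B A) (B * q ^ n)).
  { intros n. unfold casoratian. ring. }
  apply clim_plus; (apply clim_mult; [apply clim_mult; [apply clim_const|]|]); assumption.
Qed.

(** By [weight_out_num] the two weights are, up to a common factor and one sign,
    the values at [-1] of the two solutions in exchanged order: this is why the
    combination [laurent] vanishes at [-1]. *)
Definition weight (A B : C) : C := P B / (P (B / A) * P q).

Lemma weight_out_num (A B : C) :
  A <> 0 -> B <> 0 -> off_spiral (A / B) ->
  weight A B = A * power_series (out_num B A) B / ((A - B) * P q).
Proof.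
  intros HA HB H. pose proof (off_spiral_inv A B HA HB H) as H'.
  unfold weight. rewrite <- (out_num_sum B A HB HA H'), (P_shift (B / A)).
  replace (q * (B / A)) with (B / A * q) by ring.
  pose proof (P_neq0 _ (off_spiral_regular _ (off_spiral_mulq _ H'))) as H1.
  pose proof (P_neq0 q regular_q) as H2.
  pose proof (off_spiral_minus A B HB H) as H3.
  field. auto.
Qed.

(** Laurent coefficients in [z] of [theta(-A z) 2phi1(q/B, 0; A q/B; q, q/z)]. *)
Definition branch (A B : C) (k : Z) : C :=
  tri k * CpowZ (- A) k * power_series (out_num A B) (A * CpowZ q (k + 1)).

Definition laurent (A B : C) (k : Z) : C :=
  weight A B * branch A B k + weight B A * branch B A k.

Lemma branch_step (A B : C) (k : Z) :
  A <> 0 -> B <> 0 -> off_spiral (A / B) ->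
  branch A B (k + 2) * (1 - CpowZ q (k + 2))
  = - (A + B - A * B * CpowZ q (k + 1)) * CpowZ q (k + 1) * branch A B (k + 1)
    - A * B * CpowZ q (2 * k + 1) * branch A B k.
Proof.
  intros HA HB H.
  pose proof (out_num_equation A B (A * CpowZ q (k + 1)) HB H) as E.
  pose proof (opp_neq0 A HA) as HA'.
  unfold branch.
  replace (k + 2)%Z with (k + 1 + 1)%Z by lia.
  replace (2 * k + 1)%Z with (k + k + 1)%Z by lia.
  rewrite !tri_succ, !CpowZ_succ, !CpowZ_add in * by auto.
  simpl (CpowZ q 1) in *. 
  revert E. generalize (CpowZ q k) (CpowZ (- A) k) (tri k). intros Q a t.
  replace (q * (A * (q * Q))) with (A * (q * (q * Q))) by ring.
  replace (q * q * (A * (q * Q))) with (A * (q * (q * (q * Q)))) by ring.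
  generalize (power_series (out_num A B) (A * (q * Q)))
   (power_series (out_num A B) (A * (q * (q * Q))))
   (power_series (out_num A B) (A * (q * (q * (q * Q))))). intros s0 s1 s2 E.
  apply Ceq_of_minus.
  transitivity (t * a * A * q * Q * Q *
    (B * s0 - (A + B - B * (A * (q * Q))) * s1 + (A - A * (q * (q * Q))) * s2)).
  - ring.
  - rewrite E. ring.
Qed.

Lemma laurent_step (A B : C) (k : Z) :
  A <> 0 -> B <> 0 -> off_spiral (A / B) ->
  laurent A B (k + 2) * (1 - CpowZ q (k + 2))
  = - (A + B - A * B * CpowZ q (k + 1)) * CpowZ q (k + 1) * laurent A B (k + 1)
    - A * B * CpowZ q (2 * k + 1) * laurent A B k.
Proof.
  intros HA HB H. unfold laurent.
  pose proof (branch_step A B k HA HB H) as E1.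
  pose proof (branch_step B A k HB HA (off_spiral_inv A B HA HB H)) as E2.
  transitivity (weight A B * (branch A B (k + 2) * (1 - CpowZ q (k + 2)))
    + weight B A * (branch B A (k + 2) * (1 - CpowZ q (k + 2)))); [ring|].
  rewrite E1, E2. ring.
Qed.

Lemma laurent_m1 (A B : C) :
  A <> 0 -> B <> 0 -> off_spiral (A / B) -> laurent A B (-1) = 0.
Proof.
  intros HA HB H. pose proof (off_spiral_inv A B HA HB H) as H'.
  unfold laurent, branch.
  rewrite (weight_out_num A B), (weight_out_num B A) by assumption.
  rewrite tri_m1. simpl.
  replace (A * 1) with A by ring. replace (B * 1) with B by ring.
  pose proof (P_neq0 q regular_q) as H2.
  pose proof (off_spiral_minus A B HB H) as H3.
  pose proof (off_spiral_minus B A HA H') as H4.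
  pose proof (opp_neq0 A HA) as HA'.
  pose proof (opp_neq0 B HB) as HB'.
  field. auto.
Qed.

(** After substitution of the weights the left side is the Casoratian at [0]
    divided by its value. *)
Lemma laurent_0 (A B : C) :
  A <> 0 -> B <> 0 -> off_spiral (A / B) -> laurent A B 0 = 1.
Proof.
  intros HA HB H. pose proof (off_spiral_inv A B HA HB H) as H'.
  pose proof (casoratian_value A B HA HB H) as W. unfold casoratian in W.
  unfold laurent, branch.
  rewrite (weight_out_num A B), (weight_out_num B A) by assumption.
  rewrite tri_0. simpl in *. rewrite !Cmult_1_r in *.
  pose proof (P_neq0 q regular_q) as H2.
  pose proof (off_spiral_minus A B HB H) as H3.
  pose proof (off_spiral_minus B A HA H') as H4.
  match goal with |- ?l = _ => transitivity
    ((B * power_series (out_num A B) A * power_series (out_num B A) (B * q) -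
    A * power_series (out_num A B) (A * q) * power_series (out_num B A) B) / (P q * (B - A))) end.
  - field. auto.
  - rewrite W. field. auto.
Qed.

(** The leading factor [1 - q^(k+2)] of the recurrence vanishes at [k = -2], so
    that the value [0] at [-1] propagates to all negative indices. *)
Lemma laurent_neg (A B : C) (k : Z) :
  A <> 0 -> B <> 0 -> off_spiral (A / B) -> (k < 0)%Z -> laurent A B k = 0.
Proof.
  intros HA HB H Hk.
  assert (Hn : forall n, laurent A B (-1 - Z.of_nat n) = 0 /\
    laurent A B (-1 - Z.of_nat (S n)) = 0).
  { assert (Hs : forall j, laurent A B (j + 2) * (1 - CpowZ q (j + 2)) = 0 ->
      laurent A B (j + 1) = 0 -> laurent A B j = 0).
    { intros j E1 E2. pose proof (laurent_step A B j HA HB H) as E.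
      rewrite E1, E2 in E. pose proof (CpowZ_neq0 q (2 * j + 1) q_neq0) as Hq.
      replace (laurent A B j) with (- (- (A + B - A * B * CpowZ q (j + 1)) * CpowZ q (j + 1) * 0
        - A * B * CpowZ q (2 * j + 1) * laurent A B j) / (A * B * CpowZ q (2 * j + 1)))
        by (field; auto).
      rewrite <- E. field. auto. }
    induction n as [|n [IH1 IH2]].
    - split; [now apply laurent_m1|]. apply Hs.
      + simpl. ring.
      + now apply laurent_m1.
    - split; [exact IH2|]. apply Hs.
      + replace (-1 - Z.of_nat (S (S n)) + 2)%Z with (-1 - Z.of_nat n)%Z by lia.
        rewrite IH1. ring.
      + now replace (-1 - Z.of_nat (S (S n)) + 1)%Z with (-1 - Z.of_nat (S n))%Z by lia. }
  replace k with (-1 - Z.of_nat (Z.to_nat (-1 - k)))%Z by lia. apply Hn.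
Qed.

(** Taylor coefficients of [(z; q)_oo 2phi1(A, B; 0; q, z)], as [phi21_germ_lower0]
    shows. *)
Definition phi21_num (A B : C) (n : nat) : C := laurent A B (Z.of_nat n).

Lemma entire_tri : entire (fun n => tri (Z.of_nat n)).
Proof.
  apply entire_majorant with 1%R 1%R; [lra|lra|].
  intros n. rewrite Rmult_1_l. apply tri_majorant.
Qed.

Lemma entire_branch (A B : C) : off_spiral (A / B) -> entire (fun n => branch A B (Z.of_nat n)).
Proof.
  intros H. destruct (power_series_bounded (out_num A B) (Cmod A + 1) (entire_out_num A B H)) as [K [HK HKb]].
  { pose proof (Cmod_ge_0 A). lra. }
  unfold branch. apply (entire_bounded_mult _ _ K); [|exact HK|].
  - pose proof (entire_pow_mult _ (- A) entire_tri) as He.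
    intros r Hr. destruct (He r Hr) as [M HM]. exists M.
    setoid_rewrite CpowZ_of_nat. exact HM.
  - intros n. apply HKb. replace (Z.of_nat n + 1)%Z with (Z.of_nat (S n)) by lia.
    rewrite CpowZ_of_nat, Cmod_mult. pose proof (Cmod_ge_0 A).
    pose proof (Cpow_small (S n)). nra.
Qed.

Lemma entire_phi21_num (A B : C) :
  A <> 0 -> B <> 0 -> off_spiral (A / B) -> entire (phi21_num A B).
Proof.
  intros HA HB H. unfold phi21_num, laurent.
  apply (entire_lin _ _ (fun n => branch A B (Z.of_nat n)) (fun n => branch B A (Z.of_nat n))).
  - now apply entire_branch.
  - now apply entire_branch, off_spiral_inv.
Qed.

Lemma csumZ_laurent (A B y : C) :
  A <> 0 -> B <> 0 -> off_spiral (A / B) ->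
  csumZ (fun k => laurent A B k * CpowZ y k) (power_series (phi21_num A B) y).
Proof.
  intros HA HB H. apply csumZ_nonneg.
  - intros k Hk. rewrite laurent_neg by assumption. ring.
  - apply csum_ext with (2 := csum_entire _ y (entire_phi21_num A B HA HB H)).
    intros n. now rewrite CpowZ_of_nat.
Qed.

Lemma phi21_num_equation (A B y : C) :
  A <> 0 -> B <> 0 -> off_spiral (A / B) ->
  power_series (phi21_num A B) y
  = (1 - (A + B) * y) * power_series (phi21_num A B) (q * y)
    + A * B * y * (1 - q * y) * power_series (phi21_num A B) (q * q * y).
Proof.
  intros HA HB H.
  destruct (Ceq_dec y 0) as [->|Hy].
  { replace (q * 0) with (RtoC 0) by ring. replace (q * q * 0) with (RtoC 0) by ring. ring. }
  set (U := fun z k => laurent A B k * CpowZ z k).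
  assert (HU : forall z j, csumZ (fun k => U z (k + j)%Z) (power_series (phi21_num A B) z)).
  { intros z j. apply csumZ_shift. now apply csumZ_laurent. }
  set (E0 := power_series (phi21_num A B) y) in *.
  set (E1 := power_series (phi21_num A B) (q * y)) in *.
  set (E2 := power_series (phi21_num A B) (q * q * y)) in *.
  assert (Hs : csumZ (fun k => U y (k + 2)%Z
      + (- (1) * U (q * y) (k + 2)%Z + ((A + B) * y * U (q * y) (k + 1)%Z
      + (- (A * B * y) * U (q * q * y) (k + 1)%Z + A * B * y * (q * y) * U (q * q * y) (k + 0)%Z))))
    (E0 + (- (1) * E1 + ((A + B) * y * E1 + (- (A * B * y) * E2 + A * B * y * (q * y) * E2))))).
  { apply csumZ_plus; [apply HU|]. apply csumZ_plus; [apply csumZ_scal, HU|].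
    apply csumZ_plus; [apply csumZ_scal, HU|].
    apply csumZ_plus; apply csumZ_scal, HU. }
  assert (Hz : csumZ (fun _ => 0) 0).
  { apply csumZ_nonneg; [auto|apply csum_zero]. }
  assert (E : E0 + (- (1) * E1 + ((A + B) * y * E1
    + (- (A * B * y) * E2 + A * B * y * (q * y) * E2))) = 0).
  { apply (csumZ_unique _ _ _ Hs). apply csumZ_ext with (2 := Hz).
    intros k. unfold U. pose proof (laurent_step A B k HA HB H) as L.
    assert (Hqy : q * y <> 0) by now apply Cmult_neq_0.
    assert (Hqq : q * q <> 0) by now apply Cmult_neq_0.
    rewrite !(CpowZ_mult (q * q) y), !(CpowZ_mult q y), !(CpowZ_mult q q) by auto.
    replace (k + 0)%Z with k by lia.
    replace (2 * k + 1)%Z with (k + k + 1)%Z in L by lia.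
    replace (k + 2)%Z with (k + 1 + 1)%Z in * by lia.
    rewrite !CpowZ_succ in * by auto. rewrite CpowZ_add in L by auto.
    revert L. generalize (laurent A B (k + 1 + 1)) (laurent A B (k + 1)) (laurent A B k).
    generalize (CpowZ q k) (CpowZ y k). intros Q Y r2 r1 r0 L.
    transitivity (y * y * Y * (r2 * (1 - q * (q * Q))
      - (- (A + B - A * B * (q * Q)) * (q * Q) * r1
        - A * B * (q * (Q * Q)) * r0))).
    - rewrite L. ring.
    - ring. }
  replace E0 with (E0 + (- (1) * E1 + ((A + B) * y * E1
    + (- (A * B * y) * E2 + A * B * y * (q * y) * E2)))
    + (E1 - (A + B) * y * E1 + A * B * y * E2 - A * B * y * (q * y) * E2)) by ring.
  rewrite E. ring.
Qed.

Lemma phi21_num_0 (A B : C) :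
  A <> 0 -> B <> 0 -> off_spiral (A / B) -> phi21_num A B 0 = 1.
Proof. exact (laurent_0 A B). Qed.

(** * Basic hypergeometric series as quotients of entire functions *)

Definition phi21_coef (A B K : C) (n : nat) : C :=
  (qpoch q A n * qpoch q B n) / (qpoch q K n * qpoch q q n).

Lemma phi21_coef_0 (A B K : C) : phi21_coef A B K O = 1.
Proof. unfold phi21_coef. simpl. field. Qed.

Lemma phi21_coef_S (A B K : C) (n : nat) :
  regular K ->
  phi21_coef A B K (S n) * ((1 - q * q ^ n) * (1 - K * q ^ n))
  = phi21_coef A B K n * ((1 - A * q ^ n) * (1 - B * q ^ n)).
Proof.
  intros HK. unfold phi21_coef. simpl qpoch.
  pose proof (qpoch_neq0 q n regular_q). pose proof (qpoch_neq0 K n HK).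
  pose proof (one_minus_qpow n). pose proof (HK n). field. auto.
Qed.

Lemma geom_bounded_phi21_coef (A B K : C) :
  regular K -> exists s, (0 < s)%R /\ geom_bounded (phi21_coef A B K) 1 s.
Proof.
  intros HK. destruct (regular_bound K HK) as [d [Hd Hdc]].
  destruct (regular_bound q regular_q) as [d' [Hd' Hdq]].
  pose proof (Cmod_ge_0 A) as HA. pose proof (Cmod_ge_0 B) as HB.
  assert (Hdd : (0 < d' * d)%R) by now apply Rmult_lt_0_compat.
  assert (Hn : (0 < (1 + Cmod A) * (1 + Cmod B))%R) by (apply Rmult_lt_0_compat; lra).
  set (s := ((1 + Cmod A) * (1 + Cmod B) / (d' * d))%R).
  assert (Hs : (0 < s)%R) by now apply Rdiv_lt_0_compat.
  exists s. split; [exact Hs|]. repeat split; [lra|exact Hs|].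
  induction n as [|n IH].
  - rewrite phi21_coef_0, Cmod_1. simpl. lra.
  - rewrite Rmult_1_l in *. simpl pow.
    pose proof (f_equal Cmod (phi21_coef_S A B K n HK)) as E. rewrite !Cmod_mult in E.
    specialize (Hdc n). specialize (Hdq n).
    assert (Hone : forall x, (Cmod (1 - x * q ^ n) <= 1 + Cmod x)%R).
    { intros x. eapply Rle_trans; [apply Cmod_triangle|].
      rewrite Cmod_opp, Cmod_1, Cmod_mult. pose proof (Cpow_small n).
      pose proof (Cmod_ge_0 x). nra. }
    assert (H1 : (d' * d <= Cmod (1 - q * q ^ n) * Cmod (1 - K * q ^ n))%R)
      by (apply Rmult_le_compat; lra).
    assert (H2 : (Cmod (1 - A * q ^ n) * Cmod (1 - B * q ^ n)
      <= (1 + Cmod A) * (1 + Cmod B))%R)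
      by (apply Rmult_le_compat; auto using Cmod_ge_0).
    apply Rmult_le_reg_r with (d' * d)%R; [exact Hdd|].
    apply Rle_trans with (Cmod (phi21_coef A B K (S n)) *
      (Cmod (1 - q * q ^ n) * Cmod (1 - K * q ^ n)))%R.
    { apply Rmult_le_compat_l; [apply Cmod_ge_0|exact H1]. }
    rewrite E.
    replace (s * s ^ n * (d' * d))%R with (s ^ n * ((1 + Cmod A) * (1 + Cmod B)))%R
      by (unfold s; field; lra).
    apply Rmult_le_compat; auto using Cmod_ge_0.
    apply Rmult_le_pos; apply Cmod_ge_0.
Qed.

Lemma Cmod_q_mult (y : C) : (Cmod (q * y) <= Cmod y)%R.
Proof. rewrite Cmod_mult. pose proof (Cmod_ge_0 y). nra. Qed.

Lemma phi21_equation (A B K y : C) (M s : R) :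
  regular K -> geom_bounded (phi21_coef A B K) M s -> (Cmod y * s < 1)%R ->
  (1 - y) * power_series (phi21_coef A B K) y
  = (1 + K / q - (A + B) * y) * power_series (phi21_coef A B K) (q * y)
    + (A * B * y - K / q) * power_series (phi21_coef A B K) (q * q * y).
Proof.
  intros HK Hb Hy. pose proof Hb as (_ & Hs & _).
  set (f := phi21_coef A B K) in *.
  pose proof (csum_power_series f M s y Hb Hy) as S0.
  assert (S1 : csum (fun n => f n * y ^ n * q ^ n) (power_series f (q * y))).
  { apply csum_ext with (fun n => f n * (q * y) ^ n).
    { intros n. rewrite Cpow_mult_l. ring. }
    apply csum_power_series with M s; [exact Hb|].
    pose proof (Cmod_q_mult y). nra. }
  assert (S2 : csum (fun n => f n * y ^ n * (q * q) ^ n) (power_series f (q * q * y))).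
  { apply csum_ext with (fun n => f n * (q * q * y) ^ n).
    { intros n. rewrite (Cpow_mult_l (q * q) y). ring. }
    apply csum_power_series with M s; [exact Hb|].
    replace (q * q * y) with (q * (q * y)) by ring.
    pose proof (Cmod_q_mult y). pose proof (Cmod_q_mult (q * y)). nra. }
  generalize dependent (power_series f y). intros g0 S0.
  generalize dependent (power_series f (q * y)). intros g1 S1.
  generalize dependent (power_series f (q * q * y)). intros g2 S2.
  set (v := fun n => f n * y ^ n + (- (1 + K / q) * (f n * y ^ n * q ^ n)
      + K / q * (f n * y ^ n * (q * q) ^ n))).
  assert (Hv : csum v (g0 + (- (1 + K / q) * g1 + K / q * g2))).
  { apply csum_plus; [exact S0|]. apply csum_plus; now apply csum_scal. }
  assert (Hv' : csum v (v O + (y * g0 + (- (A + B) * y * g1 + A * B * y * g2)))).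
  { apply csum_cons. apply csum_ext with (fun n => y * (f n * y ^ n)
      + (- (A + B) * y * (f n * y ^ n * q ^ n) + A * B * y * (f n * y ^ n * (q * q) ^ n))).
    2:{ apply csum_plus; [now apply csum_scal|]. apply csum_plus; now apply csum_scal. }
    intros n. unfold v. pose proof (phi21_coef_S A B K n HK) as E. fold f in E.
    rewrite !Cpow_mult_l, !Cpow_S.
    transitivity (y * y ^ n * (f n * ((1 - A * q ^ n) * (1 - B * q ^ n)))); [ring|].
    rewrite <- E. field. auto. }
  pose proof (csum_unique _ _ _ Hv Hv') as E.
  assert (H0 : v O = 0) by (unfold v; simpl; unfold Cdiv; ring).
  rewrite H0 in E.
  apply Ceq_of_minus.
  transitivity ((g0 + (- (1 + K / q) * g1 + K / q * g2))
    - (0 + (y * g0 + (- (A + B) * y * g1 + A * B * y * g2)))); [ring|].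
  rewrite E. ring.
Qed.

(** If [y^m] is the leading term of a solution, then letting [y -> 0] in the
    equation gives [(1 - q^m) (1 - k q^m) = 0], hence [m = 0]. *)
Lemma qdiff_unique (x : nat -> C) (M s : R) (k a b : C) :
  geom_bounded x M s -> x O = 0 -> regular (k * q) ->
  (forall y, (Cmod y * s < 1)%R ->
    power_series x y = (1 + k - a * y) * power_series x (q * y)
      + (b * y - k) * (1 - q * y) * power_series x (q * q * y)) ->
  forall n, x n = 0.
Proof.
  intros Hb H0 Hk Heq n.
  induction n as [n IH] using lt_wf_ind.
  destruct n as [|n]; [exact H0|].
  set (m := S n) in *. pose proof Hb as (HM & Hs & Hbx).
  set (t := fun j => x (m + j)%nat).
  pose proof (geom_bounded_shift x M s m Hb) as Ht. fold t in Ht.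
  assert (Hx : forall y, (Cmod y * s < 1)%R -> power_series x y = power_series t y * y ^ m).
  { intros y Hy. rewrite Cmult_comm. now apply power_series_factor with M s. }
  set (y0 := RtoC (/ (2 * s))).
  assert (Hy0 : y0 <> 0).
  { unfold y0. intros E. apply (Rinv_neq_0_compat (2 * s)); [lra|].
    now apply RtoC_inj. }
  assert (Hsm : forall j, (Cmod (y0 * q ^ j) * s < 1)%R).
  { intros j. rewrite Cmod_mult. unfold y0. rewrite Cmod_R, Rabs_pos_eq.
    2:{ apply Rlt_le, Rinv_0_lt_compat. lra. }
    pose proof (Cpow_small j). pose proof (Cmod_ge_0 (q ^ j)).
    replace (/ (2 * s) * Cmod (q ^ j) * s)%R with (/ 2 * Cmod (q ^ j))%R by (field; lra). lra. }
  assert (Hlim : forall w, clim w 0 -> clim (fun j => power_series t (w j)) (t O)).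
  { intros w. now apply power_series_lim with (M * s ^ m)%R s. }
  pose proof (clim_geom y0) as L0. pose proof (clim_shift _ _ L0) as L1.
  pose proof (clim_shift _ _ L1) as L2. cbv beta in L1, L2.
  assert (E : t O = (1 + k - a * 0) * (q ^ m * t O)
    + (b * 0 - k) * (1 - q * 0) * ((q * q) ^ m * t O)).
  { apply clim_unique with (fun j => power_series t (y0 * q ^ j)); [now apply Hlim|].
    apply clim_ext with (fun j =>
      (1 + k + (- a) * (y0 * q ^ j)) * (q ^ m * power_series t (y0 * q ^ S j))
      + (b * (y0 * q ^ j) + - k) * (1 + (- q) * (y0 * q ^ j))
        * ((q * q) ^ m * power_series t (y0 * q ^ S (S j)))).
    - intros j. pose proof (Heq (y0 * q ^ j) (Hsm j)) as E.
      replace (q * q * (y0 * q ^ j)) with (y0 * q ^ S (S j)) in E by (rewrite !Cpow_S; ring).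
      replace (q * (y0 * q ^ j)) with (y0 * q ^ S j) in E at 1 by (rewrite !Cpow_S; ring).
      rewrite !Hx in E by apply Hsm.
      assert (Hp : (y0 * q ^ j) ^ m <> 0).
      { apply Cpow_nz, Cmult_neq_0; [exact Hy0|]. now apply Cpow_nz. }
      assert (E1 : (y0 * q ^ S j) ^ m = q ^ m * (y0 * q ^ j) ^ m).
      { rewrite <- Cpow_mult_l. f_equal. rewrite Cpow_S. ring. }
      assert (E2 : (y0 * q ^ S (S j)) ^ m = (q * q) ^ m * (y0 * q ^ j) ^ m).
      { rewrite <- Cpow_mult_l. f_equal. rewrite !Cpow_S. ring. }
      rewrite E1, E2 in E.
      replace (power_series t (y0 * q ^ j))
        with (power_series t (y0 * q ^ j) * (y0 * q ^ j) ^ m / (y0 * q ^ j) ^ m)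
        by (field; exact Hp).
      rewrite E. field. exact Hp.
    - replace (1 + k - a * 0) with (1 + k + (- a) * 0) by ring.
      replace (b * 0 - k) with (b * 0 + - k) by ring.
      replace (1 - q * 0) with (1 + (- q) * 0) by ring.
      repeat first [apply clim_plus|apply clim_mult|apply clim_const|exact L0
        |apply Hlim; assumption]. }
  assert (E' : t O * ((1 - q * q ^ n) * (1 - k * q * q ^ n)) = 0).
  { unfold m in E. rewrite Cpow_mult_l, !Cpow_S in E.
    replace (t O * ((1 - q * q ^ n) * (1 - k * q * q ^ n)))
      with (t O - ((1 + k - a * 0) * (q * q ^ n * t O)
        + (b * 0 - k) * (1 - q * 0) * (q * q ^ n * (q * q ^ n) * t O))) by ring.
    rewrite <- E. ring. }
  pose proof (one_minus_qpow n) as Hne1. pose proof (Hk n) as Hne2.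
  unfold t in E'. rewrite Nat.add_0_r in E'.
  replace (x m) with (x m * ((1 - q * q ^ n) * (1 - k * q * q ^ n))
    / ((1 - q * q ^ n) * (1 - k * q * q ^ n))) by (field; auto).
  rewrite E'. unfold Cdiv. ring.
Qed.

Lemma P_shift2 (y : C) : P (q * y) = (1 - q * y) * P (q * q * y).
Proof. rewrite P_shift. f_equal. f_equal. ring. Qed.

(** Multiplied by [(y; q)_oo], the equation of the hypergeometric series becomes
    the one assumed for [e]. *)
Lemma phi21_germ (A B K : C) (e : nat -> C) :
  regular K -> entire e -> e O = 1 ->
  (forall y, power_series e y
    = (1 + K / q - (A + B) * y) * power_series e (q * y)
      + (A * B * y - K / q) * (1 - q * y) * power_series e (q * q * y)) ->
  exists r, (0 < r)%R /\
    forall y, (Cmod y < r)%R -> power_series (phi21_coef A B K) y * P y = power_series e y.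
Proof.
  intros HK He He0 Heq.
  destruct (geom_bounded_phi21_coef A B K HK) as [s [Hs Hb]].
  destruct (entire_geom euler s entire_euler Hs) as [M1 HM1].
  destruct (entire_geom e (2 * s) He ltac:(lra)) as [M2 HM2].
  pose proof (geom_bounded_conv _ _ _ _ _ Hb HM1) as Hc.
  set (x := fun n => conv (phi21_coef A B K) euler n - e n).
  assert (Hx : geom_bounded x (1 * M1 + M2) (2 * s)).
  { destruct Hc as (H1 & H2 & H3). destruct HM2 as (H4 & _ & H5).
    repeat split; [lra|exact H2|]. intros n. unfold x. rewrite Rmult_plus_distr_r.
    eapply Rle_trans; [apply Cmod_triangle|]. rewrite Cmod_opp. now apply Rplus_le_compat. }
  assert (Hval : forall y, (Cmod y * (2 * s) < 1)%R ->
    power_series x y = power_series (phi21_coef A B K) y * P y - power_series e y).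
  { intros y Hy. apply csum_CSeries.
    apply csum_ext with (fun n => conv (phi21_coef A B K) euler n * y ^ n - e n * y ^ n).
    { intros n. unfold x. ring. }
    apply csum_minus; [|now apply csum_entire].
    apply csum_product with 1%R M1 s; auto. pose proof (Cmod_ge_0 y). nra. }
  assert (Hsq : forall y, (Cmod y * (2 * s) < 1)%R -> (Cmod (q * y) * (2 * s) < 1)%R).
  { intros y Hy. pose proof (Cmod_q_mult y). nra. }
  assert (Hzero : forall n, x n = 0).
  { apply (qdiff_unique x (1 * M1 + M2) (2 * s) (K / q) (A + B) (A * B) Hx).
    - unfold x, conv. simpl. rewrite phi21_coef_0, He0. unfold euler. simpl. ring.
    - replace (K / q * q) with K by (field; auto). exact HK.
    - intros y Hy.
      assert (Hq2 : (Cmod (q * q * y) * (2 * s) < 1)%R).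
      { replace (q * q * y) with (q * (q * y)) by ring. auto. }
      rewrite !Hval by auto. rewrite (Heq y).
      rewrite (P_shift2 y), (P_shift y), (P_shift2 y).
      assert (Hy' : (Cmod y * s < 1)%R) by (pose proof (Cmod_ge_0 y); nra).
      pose proof (phi21_equation A B K y 1 s HK Hb Hy') as E.
      transitivity ((1 - y) * power_series (phi21_coef A B K) y * ((1 - q * y) * P (q * q * y))
       - ((1 + K / q - (A + B) * y) * power_series e (q * y)
      + (A * B * y - K / q) * (1 - q * y) * power_series e (q * q * y))); [ring|].
      rewrite E. ring. }
  exists (/ (2 * s))%R. split; [apply Rinv_0_lt_compat; lra|].
  intros y Hy.
  assert (Hy' : (Cmod y * (2 * s) < 1)%R).
  { apply mult_lt_of_lt_div; lra. }
  apply Ceq_of_minus. rewrite <- Hval by exact Hy'. apply csum_CSeries.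
  apply csum_ext with (fun _ => 0); [|apply csum_zero].
  intros n. rewrite Hzero. ring.
Qed.

Lemma phi21_germ_lower0 (A B : C) :
  A <> 0 -> B <> 0 -> off_spiral (A / B) ->
  exists r, (0 < r)%R /\
    forall y, (Cmod y < r)%R -> power_series (phi21_coef A B 0) y * P y = power_series (phi21_num A B) y.
Proof.
  intros HA HB H. apply phi21_germ.
  - exact regular_0.
  - now apply entire_phi21_num.
  - now apply phi21_num_0.
  - intros y. rewrite phi21_num_equation at 1 by assumption. unfold Cdiv. ring.
Qed.

(** A limit case of Heine's transformation of [2phi1]. *)
Lemma phi21_germ_upper0 (a K : C) :
  a <> 0 -> regular K ->
  exists r, (0 < r)%R /\
    forall y, (Cmod y < r)%R ->
      power_series (phi21_coef a 0 K) y * P y = power_series (phi11 (K / a) K) (a * y).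
Proof.
  intros Ha HK.
  pose proof (entire_phi11 (K / a) K HK) as He.
  destruct (phi21_germ a 0 K (fun n => phi11 (K / a) K n * a ^ n)) as [r [Hr H]].
  - exact HK.
  - now apply entire_pow_mult.
  - simpl. ring.
  - intros y. rewrite !power_series_pow_mult.
    pose proof (phi11_equation (K / a) K (a * y) HK) as E.
    replace (q * (a * y)) with (a * (q * y)) in E by ring.
    replace (q * q * (a * y)) with (a * (q * q * y)) in E by ring.
    revert E.
    generalize (power_series (phi11 (K / a) K) (a * y))
      (power_series (phi11 (K / a) K) (a * (q * y)))
      (power_series (phi11 (K / a) K) (a * (q * q * y))). intros f0 f1 f2 E.
    apply Ceq_of_minus.
    transitivity (f0 - (1 + K / q) * f1 + K / q * f2
      - (- (a * y) * f1 + K / a * (a * y) * f2)).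
    + field. auto.
    + rewrite E. ring.
  - exists r. split; [exact Hr|]. intros y Hy. rewrite H by exact Hy.
    apply power_series_pow_mult.
Qed.

(** * Connection with the expansions at infinity *)

(** How an identity between functions that satisfy one second-order
    [q]-difference equation spreads from a disc to the plane. *)
Lemma scale_induction (Q : C -> Prop) (r : R) :
  (0 < r)%R ->
  (forall w : C, w <> 0 -> (Cmod w < r)%R -> Q w) ->
  (forall w : C, w <> 0 -> Q w -> Q (q * w) -> Q (w / q)) ->
  forall w : C, w <> 0 -> Q w.
Proof.
  intros Hr Hbase Hstep w Hw.
  assert (Hne : forall n, w * q ^ n <> 0) by (intros; apply Cmult_neq_0; [exact Hw|apply Cpow_nz, q_neq0]).
  destruct (clim_geom w r Hr) as [N HN].
  assert (H : forall j, (j <= N)%nat -> Q (w * q ^ (N - j)) /\ Q (w * q ^ S (N - j))).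
  { induction j as [|j IH]; intros Hj.
    - split; apply Hbase; auto.
      + specialize (HN (N - 0)%nat ltac:(lia)).
        now replace (w * q ^ (N - 0) - 0) with (w * q ^ (N - 0)) in HN by ring.
      + specialize (HN (S (N - 0))%nat ltac:(lia)).
        now replace (w * q ^ S (N - 0) - 0) with (w * q ^ S (N - 0)) in HN by ring.
    - destruct (IH ltac:(lia)) as [H1 H2].
      replace (N - j)%nat with (S (N - S j)) in H1, H2 by lia.
      split; [|exact H1].
      replace (w * q ^ (N - S j)) with (w * q ^ S (N - S j) / q)
        by (rewrite Cpow_S; field; auto).
      apply Hstep; auto.
      now replace (q * (w * q ^ S (N - S j))) with (w * q ^ S (S (N - S j)))
        by (rewrite !Cpow_S; ring). }
  destruct (H N (le_n N)) as [H1 _]. rewrite Nat.sub_diag in H1. simpl in H1.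
  now rewrite Cmult_1_r in H1.
Qed.

Lemma phi11_phi21_coef (al c : C) (n : nat) :
  regular c -> phi11 al c n = phi21_coef al 0 c n * (- (1)) ^ n * tri (Z.of_nat n).
Proof.
  intros Hc. induction n as [|n IH].
  - rewrite phi21_coef_0. simpl. rewrite tri_0. ring.
  - simpl phi11. rewrite IH.
    pose proof (phi21_coef_S al 0 c n Hc) as E.
    pose proof (one_minus_qpow n) as H1. pose proof (Hc n) as H2.
    replace (phi21_coef al 0 c (S n)) with (phi21_coef al 0 c (S n) * ((1 - q * q ^ n) * (1 - c * q ^ n))
      / ((1 - q * q ^ n) * (1 - c * q ^ n))) by (field; auto).
    rewrite E. replace (Z.of_nat (S n)) with (Z.of_nat n + 1)%Z by lia.
    rewrite tri_succ, CpowZ_of_nat, Cpow_S. field. auto.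
Qed.

Local Hint Resolve Cmult_neq_0 opp_neq0 div_neq0 : core.

Lemma csumZ_branch (A B : C) :
  A <> 0 -> B <> 0 -> off_spiral (A / B) ->
  exists r, (0 < r)%R /\ forall z : C, z <> 0 -> (Cmod (q / z)%C < r)%R ->
    csumZ (fun k => branch A B k * CpowZ z k)
      (theta q (- A * z) * power_series (phi21_coef (q / B) 0 (A / B * q)) (q / z)).
Proof.
  intros HA HB H.
  pose proof (off_spiral_regular _ (off_spiral_mulq _ H)) as HK.
  destruct (geom_bounded_phi21_coef (q / B) 0 (A / B * q) HK) as [s [Hs (_ & _ & Hb)]].
  exists (/ (2 * s))%R. split; [apply Rinv_0_lt_compat; lra|].
  intros z Hz Hw.
  assert (Hqz : (0 < Cmod (q / z))%R) by (apply Cmod_gt_0; auto).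
  assert (HAz : - A * z <> 0) by (apply Cmult_neq_0; [apply opp_neq0|]; assumption).
  apply (theta_columns (- A * z)
    (fun m => phi21_coef (q / B) 0 (A / B * q) m * (q / z) ^ m) _ 1 1 (s * Cmod (q / z))).
  - exact HAz.
  - lia.
  - lra.
  - split; [nra|]. rewrite Rmult_comm. apply mult_lt_of_lt_div; [exact Hs|].
    replace (/ 2 / s)%R with (/ (2 * s))%R by (field; lra). exact Hw.
  - intros m. rewrite Cmod_mult, Cmod_pow, Rpow_mult_distr.
    rewrite <- Rmult_assoc. apply Rmult_le_compat_r; [apply pow_le; lra|apply Hb].
  - intros n.
    apply csum_ext with (fun m => tri n * CpowZ (- A) n * CpowZ z n
      * (out_num A B m * (A * CpowZ q (n + 1)) ^ m)).
    { intros m. unfold out_num. rewrite phi11_phi21_coef by exact HK.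
      rewrite Z.mul_1_l, tri_add, (CpowZ_add (- A * z)), (CpowZ_mult (- A) z n), CpowZ_of_nat
        by auto.
      rewrite CpowZ_succ, !Cpow_mult_l by auto.
      rewrite <- (CpowZ_pow q n m) by auto.
      replace ((- A) ^ m) with ((- (1)) ^ m * A ^ m)
        by (rewrite <- Cpow_mult_l; f_equal; ring).
      replace ((q / z) ^ m) with (q ^ m / z ^ m).
      2:{ unfold Cdiv. now rewrite Cpow_mult_l, Cpow_inv. }
      field. now apply Cpow_nz. }
    replace (branch A B n * CpowZ z n) with (tri n * CpowZ (- A) n * CpowZ z n
      * power_series (out_num A B) (A * CpowZ q (n + 1))) by (unfold branch; ring).
    apply csum_scal, csum_entire, entire_out_num, H.
Qed.

(** By Heine's transformation
    [1phi1(A; A q/B; q, q w/B) = (w; q)_oo 2phi1(q/B, 0; A q/B; q, w)]. *)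
Definition out_conf (A B : C) : nat -> C := phi11 A (A / B * q).

Definition out_branch (A B w : C) : C :=
  theta q (- A * (q / w)) * power_series (out_conf A B) (q / B * w).

Lemma out_branch_step (A B w : C) :
  A <> 0 -> B <> 0 -> w <> 0 -> off_spiral (A / B) ->
  A * B * q / (w * w) * out_branch A B (w / q)
  = (1 - (A + B) / w) * out_branch A B w - (1 - w) * out_branch A B (q * w).
Proof.
  intros HA HB Hw H.
  pose proof (phi11_equation A (A / B * q) (w / B)
    (off_spiral_regular _ (off_spiral_mulq _ H))) as E.
  fold (out_conf A B) in E. unfold out_branch.
  set (X := - A / w).
  assert (HX : X <> 0) by (unfold X; auto).
  replace (- A * (q / (q * w))) with X by (unfold X; field; auto).
  replace (- A * (q / w)) with (q * X) by (unfold X; field; auto).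
  replace (- A * (q / (w / q))) with (q * (q * X)) by (unfold X; field; auto).
  rewrite !theta_q by auto.
  replace (q / B * (w / q)) with (w / B) by (field; auto).
  replace (q / B * w) with (q * (w / B)) by (field; auto).
  replace (q / B * (q * w)) with (q * q * (w / B)) by (field; auto).
  revert E.
  generalize (power_series (out_conf A B) (w / B)) (power_series (out_conf A B) (q * (w / B)))
    (power_series (out_conf A B) (q * q * (w / B))) (theta q X). intros s0 s1 s2 t E.
  apply Ceq_of_minus.
  transitivity (t * B / A * (s0 - (1 + A / B * q / q) * s1 + A / B * q / q * s2
    - (- (w / B) * s1 + A * (w / B) * s2))).
  - unfold X. field. auto.
  - rewrite E. ring.
Qed.

(** Here [w = q/z], where [z] is the variable of the series.  For small [w] the
    right side is [(w)_oo] times the sum of the two Laurent series.  The factor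
    [(w)_oo] removes the singular points of the [q]-difference equation, which
    therefore carries the identity to all [w]. *)
Theorem connection (A B w : C) :
  A <> 0 -> B <> 0 -> off_spiral (A / B) -> w <> 0 ->
  P w * power_series (phi21_num A B) (q / w)
  = weight A B * out_branch A B w + weight B A * out_branch B A w.
Proof.
  intros HA HB H Hw. pose proof (off_spiral_inv A B HA HB H) as H'.
  destruct (csumZ_branch A B HA HB H) as [r1 [Hr1 S1]].
  destruct (csumZ_branch B A HB HA H') as [r2 [Hr2 S2]].
  destruct (phi21_germ_upper0 (q / B) (A / B * q)) as [r3 [Hr3 S3]]; auto.
  { now apply off_spiral_regular, off_spiral_mulq. }
  destruct (phi21_germ_upper0 (q / A) (B / A * q)) as [r4 [Hr4 S4]]; auto.
  { now apply off_spiral_regular, off_spiral_mulq. }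
  revert w Hw.
  apply scale_induction with (Rmin (Rmin r1 r2) (Rmin r3 r4)).
  - repeat apply Rmin_pos; assumption.
  - intros w Hw Hlt.
    pose proof (Rmin_l (Rmin r1 r2) (Rmin r3 r4)). pose proof (Rmin_r (Rmin r1 r2) (Rmin r3 r4)).
    pose proof (Rmin_l r1 r2). pose proof (Rmin_r r1 r2).
    pose proof (Rmin_l r3 r4). pose proof (Rmin_r r3 r4).
    assert (Hqw : q / (q / w) = w) by (field; auto).
    specialize (S1 (q / w)). specialize (S2 (q / w)). rewrite Hqw in S1, S2.
    specialize (S1 ltac:(auto) ltac:(lra)). specialize (S2 ltac:(auto) ltac:(lra)).
    specialize (S3 w ltac:(lra)). specialize (S4 w ltac:(lra)).
    replace (A / B * q / (q / B)) with A in S3 by (field; auto).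
    replace (B / A * q / (q / A)) with B in S4 by (field; auto).
    fold (out_conf A B) in S3. fold (out_conf B A) in S4.
    unfold out_branch. rewrite <- S3, <- S4.
    pose proof (csumZ_plus _ _ _ _ (csumZ_scal (weight A B) _ _ S1)
      (csumZ_scal (weight B A) _ _ S2)) as S12.
    assert (E : power_series (phi21_num A B) (q / w)
      = weight A B * (theta q (- A * (q / w)) * power_series (phi21_coef (q / B) 0 (A / B * q)) w)
      + weight B A * (theta q (- B * (q / w)) * power_series (phi21_coef (q / A) 0 (B / A * q)) w)).
    { apply (csumZ_unique _ _ _ (csumZ_laurent A B (q / w) HA HB H)).
      apply csumZ_ext with (2 := S12). intros k. unfold laurent. ring. }
    rewrite E. ring.
  - intros w Hw H1 H2.
    pose proof (out_branch_step A B w HA HB Hw H) as C1.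
    pose proof (out_branch_step B A w HB HA Hw H') as C2.
    pose proof (phi21_num_equation A B (/ w) HA HB H) as E.
    replace (q * / w) with (q / w) in E by reflexivity.
    replace (q * q * / w) with (q / (w / q)) in E by (field; auto).
    replace (q / (q * w)) with (/ w) in H2 by (field; auto).
    assert (P1 : P w = (1 - w) * P (q * w)) by apply P_shift.
    assert (P2 : P (w / q) = (1 - w / q) * P w).
    { rewrite (P_shift (w / q)). f_equal. f_equal. field. auto. }
    assert (Hk : A * B * q / (w * w) <> 0) by auto.
    rewrite P2.
    revert C1 C2 E H1 H2 P1.
    generalize (out_branch A B (w / q)) (out_branch A B w) (out_branch A B (q * w))
      (out_branch B A (w / q)) (out_branch B A w) (out_branch B A (q * w))
      (power_series (phi21_num A B) (q / (w / q))) (power_series (phi21_num A B) (q / w))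
      (power_series (phi21_num A B) (/ w)) (weight A B) (weight B A) (P w) (P (q * w)).
    intros a0 a1 a2 b0 b1 b2 e0 e1 e2 ka kb p0 p1 C1 C2 E H1 H2 P1.
    replace ((1 - w / q) * p0 * e0) with
      (((1 - (A + B) / w) * (p0 * e1) - (1 - w) * (p1 * e2)) / (A * B * q / (w * w))).
    + rewrite H1, H2.
      transitivity ((ka * ((1 - (A + B) / w) * a1 - (1 - w) * a2)
        + kb * ((1 - (B + A) / w) * b1 - (1 - w) * b2)) / (A * B * q / (w * w))).
      * field. auto.
      * rewrite <- C1, <- C2. field. auto.
    + replace ((1 - w) * (p1 * e2)) with (p0 * e2) by (rewrite P1; ring).
      rewrite E. field. auto.
Qed.

Lemma exists_off_spiral : exists b : C, b <> 0 /\ off_spiral (1 / b).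
Proof.
  (* |q|^(1/2) is not the modulus of an integral power of q. *)
  set (s := sqrt (Cmod q)).
  assert (Hs : (0 < s < 1)%R).
  { split; [apply sqrt_lt_R0; lra|]. rewrite <- sqrt_1. apply sqrt_lt_1; lra. }
  assert (Hss : (s * s = Cmod q)%R) by (apply sqrt_sqrt; lra).
  assert (Hb : RtoC s <> 0).
  { intros E. apply RtoC_inj in E. lra. }
  exists (RtoC s). split; [exact Hb|]. intros k E.
  apply (f_equal Cmod) in E.
  rewrite Cmod_div, Cmod_1, Cmod_R, Rabs_pos_eq in E by (auto; lra).
  assert (H1 : (1 < 1 / s)%R).
  { apply Rmult_lt_reg_r with s; [lra|]. unfold Rdiv. rewrite Rmult_assoc, Rinv_l; lra. }
  destruct (Z_le_gt_dec 0 k) as [Hk|Hk].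
  - replace k with (Z.of_nat (Z.to_nat k)) in E by lia. rewrite CpowZ_of_nat in E.
    pose proof (Cpow_small (Z.to_nat k)). lra.
  - replace k with (- Z.of_nat (S (Z.to_nat (- k - 1))))%Z in E by lia.
    rewrite CpowZ_opp_nat, Cmod_inv, Cpow_S, Cmod_mult in E by (apply Cpow_nz; auto).
    set (n := Z.to_nat (- k - 1)) in E.
    assert (Hn : (0 < Cmod (q ^ n))%R) by (apply Cmod_gt_0, Cpow_nz; auto).
    pose proof (Cpow_small n).
    apply (f_equal Rinv) in E. rewrite Rinv_inv in E.
    replace (/ (1 / s))%R with s in E by (field; lra). nra.
Qed.

(** The case [A = 1] of [connection]: the series on the left and the first one on
    the right reduce to [1], the weight of the second is zero, and [B] disappears. *)
Theorem jacobi_triple_product (z : C) :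
  z <> 0 -> theta q (- z) = P q * P z * P (q / z).
Proof.
  intros Hz. destruct exists_off_spiral as [b [Hb H]].
  assert (H' : off_spiral (b / 1)).
  { apply off_spiral_inv; auto. exact C1_nz. }
  assert (Hqz : q / z <> 0) by auto.
  pose proof (connection 1 b (q / z) C1_nz Hb H Hqz) as E.
  replace (q / (q / z)) with z in E by (field; auto).
  (* The recurrence of [laurent] with A = 1 combines two consecutive instances of
     the recurrence of [euler]. *)
  assert (He : forall n, phi21_num 1 b n = euler n /\ phi21_num 1 b (S n) = euler (S n)).
  { assert (E0 : phi21_num 1 b 0 = 1) by (apply phi21_num_0; auto; exact C1_nz).
    assert (E1 : forall n k, k = (Z.of_nat n - 1)%Z ->
      laurent 1 b (k + 1) = euler n ->
      laurent 1 b k = match n with O => 0 | S m => euler m end ->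
      phi21_num 1 b (S n) = euler (S n)).
    { intros n k Hk L1 L0. unfold phi21_num.
      replace (Z.of_nat (S n)) with (k + 2)%Z by lia.
      pose proof (laurent_step 1 b k C1_nz Hb H) as L. rewrite L1, L0 in L.
      replace (k + 2)%Z with (Z.of_nat n + 1)%Z in * by lia.
      replace (k + 1)%Z with (Z.of_nat n) in * by lia.
      replace (2 * k + 1)%Z with (Z.of_nat n + k)%Z in L by lia.
      rewrite CpowZ_succ, CpowZ_add, !CpowZ_of_nat in L by auto.
      pose proof (one_minus_qpow n) as H1.
      replace (laurent 1 b (Z.of_nat n + 1))
        with (laurent 1 b (Z.of_nat n + 1) * (1 - q * q ^ n) / (1 - q * q ^ n)) by (field; auto).
      rewrite L. unfold euler. simpl phi11.
      assert (Hd : 1 - 0 * q ^ n <> 0) by apply regular_0.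
      destruct n as [|m].
      - simpl in H1 |- *. rewrite Cmult_1_r in H1. field. exact H1.
      - replace k with (Z.of_nat m) by lia. rewrite CpowZ_of_nat.
        assert (Hd' : 1 - 0 * q ^ m <> 0) by apply regular_0.
        pose proof (one_minus_qpow m) as H2. rewrite Cpow_S in *.
        simpl phi11. field. auto. }
    induction n as [|n [IH1 IH2]].
    - split; [exact E0|]. apply (E1 O (-1)%Z); [reflexivity|exact E0|].
      apply laurent_m1; auto. exact C1_nz.
    - split; [exact IH2|]. apply (E1 (S n) (Z.of_nat n)); [lia| |exact IH1].
      replace (Z.of_nat n + 1)%Z with (Z.of_nat (S n)) by lia. exact IH2. }
  replace (power_series (phi21_num 1 b) z) with (P z) in E.
  2:{ unfold power_series. f_equal. apply functional_extensionality. intros n.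
      now rewrite (proj1 (He n)). }
  assert (P1 : P 1 = 0) by (rewrite P_shift; ring).
  pose proof (P_neq0 q regular_q) as Hq.
  pose proof (P_neq0 _ (off_spiral_regular _ H')) as Hb1.
  assert (W : weight b 1 = 0) by (unfold weight; rewrite P1; unfold Cdiv; ring).
  assert (W' : weight 1 b = / P q).
  { unfold weight. replace (b / 1) with b in * by field. field. auto. }
  assert (Hpsi : power_series (out_conf 1 b) (q / b * (q / z)) = 1).
  { assert (Hn : forall n, phi11 1 (1 / b * q) (S n) = 0).
    { induction n as [|n IH].
      - simpl. unfold Cdiv. ring.
      - change (phi11 1 (1 / b * q) (S (S n))) with
          (- q ^ S n * (1 - 1 * q ^ S n) / ((1 - q * q ^ S n) * (1 - 1 / b * q * q ^ S n))
            * phi11 1 (1 / b * q) (S n)).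
        rewrite IH. ring. }
    assert (Hf : csum (fun n => phi11 1 (1 / b * q) n * (q / b * (q / z)) ^ n) (1 * 1)).
    { apply (csum_first (fun n => phi11 1 (1 / b * q) n * (q / b * (q / z)) ^ n)).
      intros n. rewrite Hn. ring. }
    rewrite Cmult_1_r in Hf. exact (csum_CSeries _ _ Hf). }
  rewrite W, W' in E. unfold out_branch in E at 1. rewrite Hpsi in E.
  replace (- (1) * (q / (q / z))) with (- z) in E by (field; auto).
  transitivity (P q * (P (q / z) * P z)); [|ring]. rewrite E. field. exact Hq.
Qed.

Lemma theta_neq0 (z : C) : z <> 0 -> ~ in_spiral q (- (1)) z -> theta q z <> 0.
Proof.
  intros Hz H. replace z with (- - z) by ring.
  rewrite jacobi_triple_product by auto.
  apply Cmult_neq_0; [apply Cmult_neq_0; [apply P_neq0, regular_q|]|]; apply P_neq0; intros n E.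
  - apply H. exists (- Z.of_nat n)%Z. rewrite CpowZ_opp_nat.
    assert (Hq : q ^ n <> 0) by now apply Cpow_nz.
    apply Ceq_of_minus. transitivity ((1 - - z * q ^ n) / q ^ n); [field; exact Hq|].
    rewrite E. unfold Cdiv. ring.
  - apply H. exists (Z.of_nat (S n)). rewrite CpowZ_of_nat, Cpow_S.
    apply Ceq_of_minus. transitivity (z * (1 - q / - z * q ^ n)); [field; exact Hz|].
    rewrite E. ring.
Qed.

Lemma theta_inv (x : C) : x <> 0 -> theta q (q / x) = theta q x.
Proof.
  intros Hx.
  replace (q / x) with (- (q / - x)) by (field; exact Hx).
  replace x with (- - x) at 2 by ring.
  rewrite !jacobi_triple_product by auto.
  replace (q / (q / - x)) with (- x) by (field; auto). ring.
Qed.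

(** * Values of the continued functions *)

Lemma P_nonzero_near_0 : @locally C_UniformSpace (RtoC 0) (fun y => P y <> 0).
Proof.
  apply nonzero_set_open; [apply entire_euler|]. rewrite P_0. exact C1_nz.
Qed.

Lemma phi21_quotient (A B K y : C) (e : nat -> C) (r : R) :
  entire e -> (0 < r)%R ->
  (forall y, (Cmod y < r)%R -> power_series (phi21_coef A B K) y * P y = power_series e y) ->
  P y <> 0 -> phi21 q A B K y = power_series e y / P y.
Proof.
  intros He Hr H Hy.
  apply (continuation_quotient (power_series (phi21_coef A B K)) e euler y); auto.
  - apply entire_euler.
  - exact C1_nz.
  - apply locally_Cmod. exists r. split; [exact Hr|]. intros z Hz. apply H.
    now replace (z - 0) with z in Hz by ring.
Qed.

Lemma phi21_lower0 (A B y : C) :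
  A <> 0 -> B <> 0 -> off_spiral (A / B) -> P y <> 0 ->
  phi21 q A B 0 y = power_series (phi21_num A B) y / P y.
Proof.
  intros HA HB H Hy. destruct (phi21_germ_lower0 A B HA HB H) as [r [Hr Hq]].
  apply phi21_quotient with r; auto. now apply entire_phi21_num.
Qed.

Lemma phi21_upper0 (a b y : C) :
  a <> 0 -> b <> 0 -> off_spiral (a / b) -> P y <> 0 ->
  phi21 q a 0 (a * q / b) y = power_series (out_num a b) (a * y) / P y.
Proof.
  intros Ha Hb H Hy.
  replace (a * q / b) with (a / b * q) by (field; exact Hb).
  destruct (phi21_germ_upper0 a (a / b * q) Ha) as [r [Hr Hq]].
  { now apply off_spiral_regular, off_spiral_mulq. }
  rewrite <- power_series_pow_mult.
  apply phi21_quotient with r; auto.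
  - now apply entire_pow_mult, entire_out_num.
  - intros z Hz. rewrite Hq, power_series_pow_mult by exact Hz.
    unfold out_num. now replace (a / b * q / a) with (q / b) by (field; auto).
Qed.

Lemma f21_continuation (A B y : C) :
  A <> 0 -> B <> 0 -> off_spiral (A / B) ->
  continuation (fun y => qpoch_inf q y * phi21 q A B 0 y) y = power_series (phi21_num A B) y.
Proof.
  intros HA HB H.
  set (one := fun n : nat => match n with O => RtoC 1 | S _ => 0 end).
  assert (Hone : forall z, power_series one z = 1).
  { intros z. apply csum_CSeries.
    assert (Hf : csum (fun n => one n * z ^ n) (1 * 1)).
    { apply (csum_first (fun n => one n * z ^ n)). intros n. simpl. ring. }
    now rewrite Cmult_1_r in Hf. }
  assert (Eone : entire one).
  { intros r Hr. exists 1%R. split; [lra|]. intros [|n]; simpl.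
    - rewrite Cmod_1. lra.
    - rewrite Cmod_0. lra. }
  rewrite (continuation_quotient _ (phi21_num A B) one y).
  - rewrite Hone. field.
  - now apply entire_phi21_num.
  - exact Eone.
  - exact C1_nz.
  - destruct (proj1 (locally_Cmod _ _) P_nonzero_near_0) as [r [Hr Hn]].
    apply locally_Cmod. exists r. split; [exact Hr|]. intros z Hz.
    specialize (Hn z Hz). rewrite qpoch_inf_P, phi21_lower0, Hone by assumption.
    field. exact Hn.
  - rewrite Hone. exact C1_nz.
Qed.

Lemma qpoch_0 (n : nat) : qpoch q 0 n = 1.
Proof. induction n as [|n IH]; simpl; [reflexivity|]. rewrite IH. ring. Qed.

Lemma Cpow_m1_sqr (n : nat) : (- (1)) ^ n * (- (1)) ^ n = 1.
Proof.
  rewrite <- Cpow_mult_l. replace (- (1) * - (1)) with (RtoC 1) by ring.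
  apply Cpow_1_l.
Qed.

Lemma qBorel_phi20 (a b : C) (n : nat) :
  qBorel q (phi20 q a b) n = phi21_coef a b 0 n * (- (1)) ^ n.
Proof.
  unfold qBorel, phi20, phi21_coef. rewrite qpoch_0.
  assert (Ht : qtri q n <> 0) by now apply Cpow_nz.
  pose proof (qpoch_neq0 q n regular_q) as Hq.
  assert (Hm : (- (1)) ^ n <> 0).
  { apply Cpow_nz, opp_neq0, C1_nz. }
  pose proof (Cpow_m1_sqr n) as Hs. revert Ht Hq Hm Hs.
  generalize ((- (1)) ^ n) (qtri q n) (qpoch q q n) (qpoch q a n) (qpoch q b n).
  intros m t u v w Ht Hq Hm Hs.
  transitivity (v * w / u / m * (m * m)).
  - rewrite Hs. field. auto.
  - field. auto.
Qed.

Lemma borel_continuation (a b y : C) :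
  a <> 0 -> b <> 0 -> off_spiral (a / b) -> P (- y) <> 0 ->
  continuation (power_series (qBorel q (phi20 q a b))) y
  = power_series (phi21_num a b) (- y) / P (- y).
Proof.
  intros Ha Hb H Hy.
  assert (Hneg : forall c z, power_series (fun n => c n * (- (1)) ^ n) z = power_series c (- z)).
  { intros c z. rewrite power_series_pow_mult. f_equal. ring. }
  rewrite <- !Hneg.
  destruct (phi21_germ_lower0 a b Ha Hb H) as [r [Hr Hq]].
  apply continuation_quotient.
  - now apply entire_pow_mult, entire_phi21_num.
  - apply entire_pow_mult, entire_euler.
  - simpl. rewrite Cmult_1_r. exact C1_nz.
  - apply locally_Cmod. exists r. split; [exact Hr|]. intros z Hz.
    rewrite !Hneg. replace (z - 0) with z in Hz by ring.
    rewrite <- Hq by now rewrite Cmod_opp. rewrite <- (Hneg (phi21_coef a b 0)). f_equal.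
    unfold power_series. f_equal. apply functional_extensionality. intros n.
    now rewrite qBorel_phi20.
  - now rewrite Hneg.
Qed.

(** * The q-Laplace transform *)

Lemma tri_opp (m : nat) : tri (- Z.of_nat m) = tri (Z.of_nat m) * q ^ m.
Proof.
  rewrite <- CpowZ_of_nat. unfold tri. rewrite <- CpowZ_add by auto. f_equal.
  pose proof (half_product (Z.of_nat m)). pose proof (half_product (- Z.of_nat m)). nia.
Qed.

(** Values of the continued Borel transform at the points of [lam q^Z]. *)
Definition borel_value (a b lam : C) (k : Z) : C :=
  power_series (phi21_num a b) (- (CpowZ q k * lam)) / P (- (CpowZ q k * lam)).

Definition laplace_weight (a b lam : C) : C :=
  P q * weight a b * (theta q (a * lam) / theta q lam).

Lemma P_spiral_neq0 (lam : C) (k : Z) :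
  lam <> 0 -> theta q lam <> 0 ->
  P (- (CpowZ q k * lam)) <> 0 /\ P (q / - (CpowZ q k * lam)) <> 0 /\
  theta q (CpowZ q k * lam) = P q * P (- (CpowZ q k * lam)) * P (q / - (CpowZ q k * lam)).
Proof.
  intros Hl Ht. pose proof (CpowZ_neq0 q k q_neq0) as Hk.
  assert (E : theta q (CpowZ q k * lam)
    = P q * P (- (CpowZ q k * lam)) * P (q / - (CpowZ q k * lam))).
  { rewrite <- jacobi_triple_product by auto. f_equal. ring. }
  assert (Hne : theta q (CpowZ q k * lam) <> 0).
  { rewrite theta_qpow by exact Hl. apply div_neq0; [exact Ht|].
    apply Cmult_neq_0; [now apply CpowZ_neq0|apply tri_neq0]. }
  repeat split; [| |exact E]; intros E0; apply Hne; rewrite E, E0; ring.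
Qed.

Lemma borel_value_formula (a b lam : C) (k : Z) :
  a <> 0 -> b <> 0 -> off_spiral (a / b) -> lam <> 0 -> theta q lam <> 0 ->
  borel_value a b lam k
  = laplace_weight a b lam * (CpowZ (/ a) k
      * power_series (out_conf a b) (- (q * q / (b * lam)) * CpowZ q (- k)))
    + laplace_weight b a lam * (CpowZ (/ b) k
      * power_series (out_conf b a) (- (q * q / (a * lam)) * CpowZ q (- k))).
Proof.
  intros Ha Hb H Hl Ht.
  destruct (P_spiral_neq0 lam k Hl Ht) as (P1 & P2 & J).
  pose proof (CpowZ_neq0 q k q_neq0) as Hk.
  set (y := - (CpowZ q k * lam)) in *.
  assert (Hy : y <> 0) by (unfold y; auto).
  assert (Hqy : q / y <> 0) by auto.
  pose proof (connection a b (q / y) Ha Hb H Hqy) as E.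
  replace (q / (q / y)) with y in E by (field; auto).
  unfold out_branch in E. replace (q / (q / y)) with y in E by (field; auto).
  replace (- a * y) with (CpowZ q k * (a * lam)) in E by (unfold y; ring).
  replace (- b * y) with (CpowZ q k * (b * lam)) in E by (unfold y; ring).
  rewrite CpowZ_opp by auto.
  replace (- (q * q / (b * lam)) * / CpowZ q k) with (q / b * (q / y)) by (unfold y; field; auto).
  replace (- (q * q / (a * lam)) * / CpowZ q k) with (q / a * (q / y)) by (unfold y; field; auto).
  rewrite !theta_qpow, !CpowZ_mult in E by auto. rewrite theta_qpow in J by auto.
  rewrite !CpowZ_inv by auto. unfold borel_value, laplace_weight. fold y.
  pose proof (CpowZ_neq0 lam k Hl) as Hlk. pose proof (CpowZ_neq0 a k Ha) as Hak.
  pose proof (CpowZ_neq0 b k Hb) as Hbk. pose proof (tri_neq0 k) as Htk.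
  pose proof (P_neq0 q regular_q) as Hq.
  replace (power_series (phi21_num a b) y / P y)
    with (P (q / y) * power_series (phi21_num a b) y * P q / (P q * P y * P (q / y)))
    by (field; auto).
  rewrite <- J, E. field. repeat split; auto.
Qed.

Lemma borel_value_growth (a b lam : C) :
  a <> 0 -> b <> 0 -> off_spiral (a / b) -> lam <> 0 -> theta q lam <> 0 ->
  exists M r, (0 <= M)%R /\ (0 < r)%R /\
    forall k, (Cmod (borel_value a b lam k) <= M * r ^ Z.abs_nat k)%R.
Proof.
  intros Ha Hb H Hl Ht. pose proof (off_spiral_inv a b Ha Hb H) as H'.
  (* On the points that tend to 0 the Borel transform has the limit 1. *)
  destruct (clim_bounded (fun n => borel_value a b lam (Z.of_nat n)) (1 * / 1)) as [M1 [HM1 B1]].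
  { unfold borel_value, Cdiv. apply clim_mult.
    - apply clim_ext with (fun n => power_series (phi21_num a b) (- lam * q ^ n)).
      { intros n. rewrite CpowZ_of_nat. f_equal. ring. }
      rewrite <- (phi21_num_0 a b) by assumption.
      apply entire_lim; [now apply entire_phi21_num|apply clim_geom].
    - apply clim_inv; [exact C1_nz|].
      apply clim_ext with (fun n => P (- lam * q ^ n)).
      { intros n. rewrite CpowZ_of_nat. f_equal. ring. }
      apply clim_P_qpow. }
  (* On the others the connection formula bounds it geometrically. *)
  set (v := - (q * q / (b * lam))). set (v' := - (q * q / (a * lam))).
  destruct (power_series_bounded (out_conf a b) (Cmod v + 1)) as [K1 [HK1 C1]].
  { now apply entire_phi11, off_spiral_regular, off_spiral_mulq. }
  { pose proof (Cmod_ge_0 v). lra. }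
  destruct (power_series_bounded (out_conf b a) (Cmod v' + 1)) as [K2 [HK2 C2]].
  { now apply entire_phi11, off_spiral_regular, off_spiral_mulq. }
  { pose proof (Cmod_ge_0 v'). lra. }
  set (L1 := Cmod (laplace_weight a b lam)). set (L2 := Cmod (laplace_weight b a lam)).
  assert (HL1 : (0 <= L1)%R) by apply Cmod_ge_0.
  assert (HL2 : (0 <= L2)%R) by apply Cmod_ge_0.
  pose proof (Cmod_ge_0 a) as Ha0. pose proof (Cmod_ge_0 b) as Hb0.
  exists (M1 + L1 * K1 + L2 * K2)%R, (1 + Cmod a + Cmod b)%R.
  assert (HLK1 : (0 <= L1 * K1)%R) by now apply Rmult_le_pos.
  assert (HLK2 : (0 <= L2 * K2)%R) by now apply Rmult_le_pos.
  split; [lra|]. split; [lra|]. intros k.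
  set (r := (1 + Cmod a + Cmod b)%R).
  destruct (Z_le_gt_dec 0 k) as [Hk|Hk].
  - replace k with (Z.of_nat (Z.abs_nat k)) at 1 by lia.
    eapply Rle_trans; [apply B1|].
    assert (1 <= r ^ Z.abs_nat k)%R by (apply pow_R1_Rle; unfold r; lra). nra.
  - rewrite borel_value_formula by assumption. fold v v'.
    replace k with (- Z.of_nat (Z.abs_nat k))%Z at 1 2 3 4 by lia.
    set (n := Z.abs_nat k). rewrite !Z.opp_involutive, !CpowZ_opp_nat, !CpowZ_of_nat.
    assert (Hinv : forall c : C, c <> 0 -> / (/ c) ^ n = c ^ n).
    { intros c Hc. rewrite Cpow_inv by exact Hc. field. now apply Cpow_nz. }
    rewrite !Hinv by assumption.
    assert (Hr1 : forall c : C, (Cmod c <= r)%R -> (Cmod (c ^ n) <= r ^ n)%R).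
    { intros c Hc. rewrite Cmod_pow. apply pow_incr. split; [apply Cmod_ge_0|exact Hc]. }
    pose proof (Hr1 a ltac:(unfold r; lra)) as Ra. pose proof (Hr1 b ltac:(unfold r; lra)) as Rb.
    assert (Hv : forall c : C, (Cmod (c * q ^ n) <= Cmod c + 1)%R).
    { intros c. rewrite Cmod_mult. pose proof (Cpow_small n). pose proof (Cmod_ge_0 c). nra. }
    specialize (C1 _ (Hv v)). specialize (C2 _ (Hv v')).
    assert (Hrn : (0 <= r ^ n)%R) by (apply pow_le; unfold r; lra).
    eapply Rle_trans; [apply Cmod_triangle|]. rewrite !Cmod_mult. fold L1 L2.
    apply Rle_trans with (L1 * (r ^ n * K1) + L2 * (r ^ n * K2))%R.
    + apply Rplus_le_compat; (apply Rmult_le_compat_l; [assumption|]);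
        apply Rmult_le_compat; auto using Cmod_ge_0.
    + assert (0 <= M1 * r ^ n)%R by now apply Rmult_le_pos. lra.
Qed.

Definition lap_term (a b lam t : C) (k : Z) : C :=
  borel_value a b lam k * (tri k * CpowZ t k).

(** The Laplace transform without its factor [1 / theta(t)], at [t = lam / x]: the
    quasi-periodicity of theta makes the summands multiples of theta terms. *)
Definition lap_sum (a b lam t : C) : C := CSeriesZ (lap_term a b lam t).

Lemma csumZ_lap (a b lam t : C) :
  a <> 0 -> b <> 0 -> off_spiral (a / b) -> lam <> 0 -> theta q lam <> 0 -> t <> 0 ->
  csumZ (lap_term a b lam t) (lap_sum a b lam t).
Proof.
  intros Ha Hb H Hl Ht Ht0.
  destruct (borel_value_growth a b lam Ha Hb H Hl Ht) as (M & r & HM & Hr & HB).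
  destruct (theta_term_bound t (/ (2 * r)) Ht0) as [M' [HM' HT]].
  { apply Rinv_0_lt_compat. lra. }
  apply csumZ_geom with (M * M')%R (/ 2)%R.
  - now apply Rmult_le_pos.
  - lra.
  - intros k. unfold lap_term. rewrite Cmod_mult.
    eapply Rle_trans; [apply Rmult_le_compat; [apply Cmod_ge_0|apply Cmod_ge_0|apply HB|apply HT]|].
    apply Req_le. replace (/ 2)%R with (r * / (2 * r))%R by (field; lra).
    rewrite Rpow_mult_distr. ring.
Qed.

Lemma borel_value_step (a b lam : C) (k : Z) :
  a <> 0 -> b <> 0 -> off_spiral (a / b) -> lam <> 0 -> theta q lam <> 0 ->
  (1 + CpowZ q k * lam) * borel_value a b lam k
  = (1 + (a + b) * (CpowZ q k * lam)) * borel_value a b lam (k + 1)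
    - a * b * (CpowZ q k * lam) * borel_value a b lam (k + 1 + 1).
Proof.
  intros Ha Hb H Hl Ht. unfold borel_value.
  destruct (P_spiral_neq0 lam k Hl Ht) as (N0 & _).
  destruct (P_spiral_neq0 lam (k + 1) Hl Ht) as (N1 & _).
  destruct (P_spiral_neq0 lam (k + 1 + 1) Hl Ht) as (N2 & _).
  rewrite !CpowZ_succ in * by auto.
  set (y := - (CpowZ q k * lam)) in *.
  replace (- (q * CpowZ q k * lam)) with (q * y) in * by (unfold y; ring).
  replace (- (q * (q * CpowZ q k) * lam)) with (q * q * y) in * by (unfold y; ring).
  replace (CpowZ q k * lam) with (- y) by (unfold y; ring).
  rewrite (phi21_num_equation a b y) by assumption.
  pose proof (P_shift y) as S0. pose proof (P_shift2 y) as S1.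
  rewrite S0, S1 in N0. rewrite S1 in N1. rewrite S0, S1.
  assert (D1 : 1 - y <> 0) by (intros E; apply N0; rewrite E; ring).
  assert (D2 : 1 - q * y <> 0) by (intros E; apply N1; rewrite E; ring).
  field. auto.
Qed.

(** The sum over [k] of the equation [borel_value_step] multiplied by
    [tri k t^k], with shifted summation indices. *)
Lemma lap_sum_equation (a b lam t : C) :
  a <> 0 -> b <> 0 -> off_spiral (a / b) -> lam <> 0 -> theta q lam <> 0 -> t <> 0 ->
  (1 - (a + b) * lam / t) * lap_sum a b lam t + lam * lap_sum a b lam (q * t)
  = q / t * (1 - a * b * lam / t) * lap_sum a b lam (t / q).
Proof.
  intros Ha Hb H Hl Ht Ht0.
  assert (HS : forall (s : C) (j : Z), s <> 0 ->
    csumZ (fun k => lap_term a b lam s (k + j)%Z) (lap_sum a b lam s)).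
  { intros s j Hs. now apply csumZ_shift, csumZ_lap. }
  assert (Hqt : q * t <> 0) by auto.
  assert (Htq : t / q <> 0) by auto.
  pose proof (csumZ_plus _ _ _ _ (HS t 0%Z Ht0)
   (csumZ_plus _ _ _ _ (csumZ_scal lam _ _ (HS (q * t) 0%Z Hqt))
   (csumZ_plus _ _ _ _ (csumZ_scal (- (q / t)) _ _ (HS (t / q) 1%Z Htq))
   (csumZ_plus _ _ _ _ (csumZ_scal (- ((a + b) * lam / t)) _ _ (HS t 1%Z Ht0))
     (csumZ_scal (a * b * lam * q / (t * t)) _ _ (HS (t / q) 2%Z Htq)))))) as HZ.
  assert (Hz : csumZ (fun _ => 0) 0).
  { apply csumZ_nonneg; [auto|apply csum_zero]. }
  match type of HZ with csumZ _ ?l => assert (E : l = 0) end.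
  { apply (csumZ_unique _ _ _ HZ). apply csumZ_ext with (2 := Hz).
    intros k. unfold lap_term.
    pose proof (borel_value_step a b lam k Ha Hb H Hl Ht) as L.
    replace (k + 0)%Z with k by lia.
    replace (k + 2)%Z with (k + 1 + 1)%Z by lia.
    rewrite !tri_succ.
    replace (t / q) with (t * / q) by reflexivity.
    assert (Hiq : / q <> 0) by (intros E; apply C1_nz; rewrite <- (Cinv_r q), E by auto; ring).
    rewrite !CpowZ_succ by auto. rewrite !CpowZ_mult, !CpowZ_inv by auto.
    pose proof (CpowZ_neq0 q k q_neq0) as Hqk.
    revert L Hqk. generalize (borel_value a b lam k) (borel_value a b lam (k + 1))
      (borel_value a b lam (k + 1 + 1)) (tri k) (CpowZ q k) (CpowZ t k).
    intros g0 g1 g2 T Q Y L HQ.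
    transitivity (T * Y * ((1 + Q * lam) * g0
      - ((1 + (a + b) * (Q * lam)) * g1 - a * b * (Q * lam) * g2))).
    - rewrite L. ring.
    - field. auto. }
  apply Ceq_of_minus. rewrite <- E. field. auto.
Qed.

Definition lap_branch (a b lam w : C) : C :=
  theta q (b * lam * w / q) * power_series (out_num a b) (a * w).

Lemma lap_branch_step (a b lam w : C) :
  a <> 0 -> b <> 0 -> lam <> 0 -> w <> 0 -> off_spiral (a / b) ->
  q * q * q / (a * b * lam * (w * w)) * lap_branch a b lam (w / q)
  = ((a + b) * q / (a * b * w) - 1) * lap_branch a b lam w
    - lam * (1 - w) * lap_branch a b lam (q * w).
Proof.
  intros Ha Hb Hl Hw H.
  pose proof (out_num_equation a b (a * w / q) Hb H) as E. unfold lap_branch.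
  set (X := b * lam * w / (q * q)).
  assert (HX : X <> 0) by (unfold X; auto).
  replace (b * lam * (w / q) / q) with X by (unfold X; field; auto).
  replace (b * lam * w / q) with (q * X) by (unfold X; field; auto).
  replace (b * lam * (q * w) / q) with (q * (q * X)) by (unfold X; field; auto).
  rewrite !theta_q by auto.
  replace (a * (w / q)) with (a * w / q) by (field; auto).
  replace (q * (a * w / q)) with (a * w) in E by (field; auto).
  replace (q * q * (a * w / q)) with (a * (q * w)) in E by (field; auto).
  revert E.
  generalize (power_series (out_num a b) (a * w / q)) (power_series (out_num a b) (a * w))
    (power_series (out_num a b) (a * (q * w))) (theta q X). intros s0 s1 s2 T E.
  apply Ceq_of_minus.
  transitivity (T * (q * q * q) / (a * b * lam * (w * w)) / b *
    (b * s0 - (a + b - b * (a * w / q)) * s1 + (a - a * w) * s2)).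
  - unfold X. field. auto.
  - rewrite E. ring.
Qed.

(** Termwise Laplace transform of one of the two expansions at infinity.  Powers
    of [q^(-k)] shift the terms of theta, so that [theta_columns] applies; the sum
    over [k] converges for small [w] only. *)
Lemma csumZ_lap_branch (a b lam : C) :
  a <> 0 -> b <> 0 -> lam <> 0 -> off_spiral (a / b) ->
  exists r, (0 < r)%R /\ forall w : C, w <> 0 -> (Cmod w < r)%R ->
    csumZ (fun k => CpowZ (/ a) k
        * power_series (out_conf a b) (- (q * q / (b * lam)) * CpowZ q (- k))
        * (tri k * CpowZ (a * b * lam * w / q) k))
      (theta q (b * lam * w / q) * power_series (phi21_coef a 0 (a / b * q)) w).
Proof.
  intros Ha Hb Hl H.
  pose proof (off_spiral_regular _ (off_spiral_mulq _ H)) as HK.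
  destruct (geom_bounded_phi21_coef a 0 (a / b * q) HK) as [s [Hs (_ & _ & Hb')]].
  exists (/ (2 * s))%R. split; [apply Rinv_0_lt_compat; lra|].
  intros w Hw Hlt. pose proof (Cmod_ge_0 w) as Hw0.
  set (x := b * lam * w / q). assert (Hx : x <> 0) by (unfold x; auto).
  assert (Hia : / a <> 0) by (intros E; apply C1_nz; rewrite <- (Cinv_r a), E by auto; ring).
  apply (theta_columns x (fun m => phi21_coef a 0 (a / b * q) m * w ^ m) _ (-1) 1 (s * Cmod w)).
  - exact Hx.
  - lia.
  - lra.
  - split; [apply Rmult_le_pos; lra|]. rewrite Rmult_comm. apply mult_lt_of_lt_div; [exact Hs|].
    replace (/ 2 / s)%R with (/ (2 * s))%R by (field; lra). exact Hlt.
  - intros m. rewrite Cmod_mult, Cmod_pow, Rpow_mult_distr.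
    rewrite <- Rmult_assoc. apply Rmult_le_compat_r; [apply pow_le; lra|apply Hb'].
  - intros n.
    assert (Exn : CpowZ (a * b * lam * w / q) n = CpowZ a n * CpowZ x n).
    { rewrite <- CpowZ_mult by auto. f_equal. unfold x. field. auto. }
    pose proof (CpowZ_neq0 a n Ha) as Han.
    replace (CpowZ (/ a) n * power_series (out_conf a b) (- (q * q / (b * lam)) * CpowZ q (- n))
      * (tri n * CpowZ (a * b * lam * w / q) n))
      with (tri n * CpowZ x n * power_series (out_conf a b) (- (q * q / (b * lam)) * CpowZ q (- n))).
    2:{ rewrite Exn, CpowZ_inv by auto. field. auto. }
    apply csum_ext with (fun m => tri n * CpowZ x n
      * (out_conf a b m * (- (q * q / (b * lam)) * CpowZ q (- n)) ^ m)).
    { intros m. unfold out_conf. rewrite phi11_phi21_coef by exact HK.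
      replace (-1 * Z.of_nat m)%Z with (- Z.of_nat m)%Z by lia.
      rewrite (tri_add n), (CpowZ_add x), tri_opp, CpowZ_opp_nat by auto.
      replace (n * - Z.of_nat m)%Z with (- n * Z.of_nat m)%Z by lia.
      rewrite <- CpowZ_pow, Cpow_mult_l by auto.
      assert (Hxm : x ^ m <> 0) by now apply Cpow_nz.
      assert (E : (- (1)) ^ m * (- (q * q / (b * lam))) ^ m * x ^ m = q ^ m * w ^ m).
      { rewrite <- !Cpow_mult_l. f_equal. unfold x. field. auto. }
      transitivity (tri n * CpowZ x n * phi21_coef a 0 (a / b * q) m * tri (Z.of_nat m)
        * CpowZ q (- n) ^ m
        * ((- (1)) ^ m * (- (q * q / (b * lam))) ^ m * x ^ m) / x ^ m).
      - field. exact Hxm.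
      - rewrite E. field. exact Hxm. }
    apply csum_scal, csum_entire, entire_phi11, HK.
Qed.

(** As in [connection], the formula holds for small [w] by term-by-term summation
    and spreads by the [q]-difference equation. *)
Lemma lap_sum_formula (a b lam w : C) :
  a <> 0 -> b <> 0 -> off_spiral (a / b) -> lam <> 0 -> theta q lam <> 0 -> w <> 0 ->
  P w * lap_sum a b lam (a * b * lam * w / q)
  = laplace_weight a b lam * lap_branch a b lam w
    + laplace_weight b a lam * lap_branch b a lam w.
Proof.
  intros Ha Hb H Hl Ht Hw. pose proof (off_spiral_inv a b Ha Hb H) as H'.
  destruct (csumZ_lap_branch a b lam Ha Hb Hl H) as [r1 [Hr1 S1]].
  destruct (csumZ_lap_branch b a lam Hb Ha Hl H') as [r2 [Hr2 S2]].
  destruct (phi21_germ_upper0 a (a / b * q)) as [r3 [Hr3 S3]]; auto.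
  { now apply off_spiral_regular, off_spiral_mulq. }
  destruct (phi21_germ_upper0 b (b / a * q)) as [r4 [Hr4 S4]]; auto.
  { now apply off_spiral_regular, off_spiral_mulq. }
  revert w Hw.
  apply scale_induction with (Rmin (Rmin r1 r2) (Rmin r3 r4)).
  - repeat apply Rmin_pos; assumption.
  - intros w Hw Hlt.
    pose proof (Rmin_l (Rmin r1 r2) (Rmin r3 r4)). pose proof (Rmin_r (Rmin r1 r2) (Rmin r3 r4)).
    pose proof (Rmin_l r1 r2). pose proof (Rmin_r r1 r2).
    pose proof (Rmin_l r3 r4). pose proof (Rmin_r r3 r4).
    specialize (S1 w Hw ltac:(lra)). specialize (S2 w Hw ltac:(lra)).
    specialize (S3 w ltac:(lra)). specialize (S4 w ltac:(lra)).
    replace (a / b * q / a) with (q / b) in S3 by (field; auto).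
    replace (b / a * q / b) with (q / a) in S4 by (field; auto).
    fold (out_num a b) in S3. fold (out_num b a) in S4.
    unfold lap_branch. rewrite <- S3, <- S4.
    replace (b * a * lam * w / q) with (a * b * lam * w / q) in S2 by (field; auto).
    assert (Ht0 : a * b * lam * w / q <> 0) by auto.
    pose proof (csumZ_plus _ _ _ _ (csumZ_scal (laplace_weight a b lam) _ _ S1)
      (csumZ_scal (laplace_weight b a lam) _ _ S2)) as S12.
    assert (E : lap_sum a b lam (a * b * lam * w / q)
      = laplace_weight a b lam
          * (theta q (b * lam * w / q) * power_series (phi21_coef a 0 (a / b * q)) w)
        + laplace_weight b a lam
          * (theta q (a * lam * w / q) * power_series (phi21_coef b 0 (b / a * q)) w)).
    { apply (csumZ_unique _ _ _ (csumZ_lap a b lam _ Ha Hb H Hl Ht Ht0)).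
      apply csumZ_ext with (2 := S12). intros k. unfold lap_term.
      rewrite borel_value_formula by assumption. ring. }
    rewrite E. ring.
  - intros w Hw H1 H2.
    pose proof (lap_branch_step a b lam w Ha Hb Hl Hw H) as C1.
    pose proof (lap_branch_step b a lam w Hb Ha Hl Hw H') as C2.
    assert (Ht0 : a * b * lam * w / q <> 0) by auto.
    pose proof (lap_sum_equation a b lam _ Ha Hb H Hl Ht Ht0) as E.
    replace (q * (a * b * lam * w / q)) with (a * b * lam * (q * w) / q) in E by (field; auto).
    replace (a * b * lam * w / q / q) with (a * b * lam * (w / q) / q) in E by (field; auto).
    assert (P1 : P w = (1 - w) * P (q * w)) by apply P_shift.
    assert (P2 : P (w / q) = (1 - w / q) * P w).
    { rewrite (P_shift (w / q)). f_equal. f_equal. field. auto. }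
    rewrite P2.
    revert C1 C2 E H1 H2 P1.
    generalize (lap_branch a b lam (w / q)) (lap_branch a b lam w) (lap_branch a b lam (q * w))
      (lap_branch b a lam (w / q)) (lap_branch b a lam w) (lap_branch b a lam (q * w))
      (lap_sum a b lam (a * b * lam * (w / q) / q)) (lap_sum a b lam (a * b * lam * w / q))
      (lap_sum a b lam (a * b * lam * (q * w) / q))
      (laplace_weight a b lam) (laplace_weight b a lam) (P w) (P (q * w)).
    intros a0 a1 a2 b0 b1 b2 e0 e1 e2 ka kb p0 p1 C1 C2 E H1 H2 P1.
    assert (Hk : q * q * q / (a * b * lam * (w * w)) <> 0) by auto 10.
    replace ((1 - w / q) * p0 * e0) with
      ((((a + b) * q / (a * b * w) - 1) * (p0 * e1) - lam * (1 - w) * (p1 * e2))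
        / (q * q * q / (a * b * lam * (w * w)))).
    + rewrite H1, H2.
      transitivity ((ka * (((a + b) * q / (a * b * w) - 1) * a1 - lam * (1 - w) * a2)
        + kb * (((b + a) * q / (b * a * w) - 1) * b1 - lam * (1 - w) * b2))
          / (q * q * q / (a * b * lam * (w * w)))).
      * field. auto 10.
      * rewrite <- C1, <- C2. field. auto 10.
    + replace (lam * (1 - w) * (p1 * e2)) with (p0 * (lam * e2)) by (rewrite P1; ring).
      replace (lam * e2) with
        (q / (a * b * lam * w / q) * (1 - a * b * lam / (a * b * lam * w / q)) * e0
         - (1 - (a + b) * lam / (a * b * lam * w / q)) * e1) by (rewrite <- E; ring).
      field. auto 10.
Qed.

(** * The two rows of the connection matrix *)

Lemma theta_mult_neq0 (c x : C) :
  c <> 0 -> x <> 0 -> ~ in_spiral q (- (1) / c) x -> theta q (c * x) <> 0.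
Proof.
  intros Hc Hx H. apply theta_neq0; auto. intros [k E]. apply H. exists k.
  replace x with (c * x / c) by (field; exact Hc). rewrite E. field. exact Hc.
Qed.

Lemma f20_connection (a b lam mu x : C) :
  a <> 0 -> b <> 0 -> off_spiral (a / b) -> lam <> 0 -> mu <> 0 -> x <> 0 ->
  theta q lam <> 0 -> theta q (lam / x) <> 0 -> theta q (mu * x) <> 0 ->
  theta q (a * mu * x) <> 0 -> theta q (b * mu * x) <> 0 ->
  P (q / (a * b * x)) <> 0 ->
  f20 q a b lam x = Clammu q lam mu a b x * Smu q mu a b x
    + Clammu q lam mu b a x * Smu q mu b a x.
Proof.
  intros Ha Hb H Hl Hmu Hx Ht Htx Tm Ta Tb HP.
  pose proof (off_spiral_inv a b Ha Hb H) as H'.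
  set (w := q / (a * b * x)) in *. assert (Hw : w <> 0) by (unfold w; auto).
  pose proof (lap_sum_formula a b lam w Ha Hb H Hl Ht Hw) as E.
  replace (a * b * lam * w / q) with (lam / x) in E by (unfold w; field; auto).
  unfold lap_branch in E.
  replace (b * lam * w / q) with (q / (q * a * x / lam)) in E by (unfold w; field; auto).
  replace (a * lam * w / q) with (q / (q * b * x / lam)) in E by (unfold w; field; auto).
  rewrite !theta_inv in E by auto.
  assert (Hlx : lam / x <> 0) by auto.
  assert (F : f20 q a b lam x = / theta q (lam / x) * lap_sum a b lam (lam / x)).
  { unfold f20, qLaplace. apply csumZ_CSeriesZ.
    apply csumZ_ext with (2 := csumZ_scal (/ theta q (lam / x)) _ _
      (csumZ_lap a b lam (lam / x) Ha Hb H Hl Ht Hlx)).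
    intros k. destruct (P_spiral_neq0 lam k Hl Ht) as (N & _).
    rewrite borel_continuation by assumption.
    replace (CpowZ q k * lam / x) with (CpowZ q k * (lam / x)) by (field; auto).
    rewrite theta_qpow by exact Hlx. unfold lap_term. fold (borel_value a b lam k).
    pose proof (tri_neq0 k). pose proof (CpowZ_neq0 _ k Hlx). field. auto. }
  rewrite F.
  unfold Clammu, Smu. rewrite !qpoch_inf_P.
  replace (q / (b * a * x)) with w by (unfold w; field; auto). fold w.
  rewrite !phi21_upper0 by assumption.
  replace (theta q (q * x / lam)) with (theta q (lam / x)).
  2:{ rewrite <- theta_inv by auto. f_equal. field. auto. }
  replace (lap_sum a b lam (lam / x)) with (P w * lap_sum a b lam (lam / x) / P w)
    by (field; exact HP).
  rewrite E. unfold laplace_weight, weight.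
  assert (N1 : P (b / a) <> 0) by now apply P_neq0, off_spiral_regular.
  assert (N2 : P (a / b) <> 0) by now apply P_neq0, off_spiral_regular.
  pose proof (P_neq0 q regular_q) as N3.
  field. repeat split; assumption.
Qed.

Lemma f21_connection (a b mu x : C) :
  a <> 0 -> b <> 0 -> off_spiral (a / b) -> mu <> 0 -> x <> 0 ->
  theta q (- q * x) <> 0 -> theta q (mu * x) <> 0 ->
  theta q (a * mu * x) <> 0 -> theta q (b * mu * x) <> 0 ->
  P (q / (a * b * x)) <> 0 ->
  f21 q a b x = Cmu q mu a b x * Smu q mu a b x + Cmu q mu b a x * Smu q mu b a x.
Proof.
  intros Ha Hb H Hmu Hx Tq Tm Ta Tb HP.
  pose proof (off_spiral_inv a b Ha Hb H) as H'.
  set (w := q / (a * b * x)) in *. assert (Hw : w <> 0) by (unfold w; auto).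
  assert (HA : q / a <> 0) by auto. assert (HB : q / b <> 0) by auto.
  assert (HAB : off_spiral (q / a / (q / b))).
  { replace (q / a / (q / b)) with (b / a) by (field; auto). exact H'. }
  pose proof (connection (q / a) (q / b) w HA HB HAB Hw) as E.
  unfold out_branch, weight, out_conf in E.
  replace (q / w) with (a * b * x) in E by (unfold w; field; auto).
  replace (- (q / a) * (a * b * x)) with (- b * q * x) in E by (field; auto).
  replace (- (q / b) * (a * b * x)) with (- a * q * x) in E by (field; auto).
  replace (q / a / (q / b)) with (b / a) in E by (field; auto).
  replace (q / b / (q / a)) with (a / b) in E by (field; auto).
  replace (q / (q / b) * w) with (b * w) in E by (field; auto).
  replace (q / (q / a) * w) with (a * w) in E by (field; auto).
  fold (out_num a b) in E. fold (out_num b a) in E.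
  unfold f21. rewrite f21_continuation by assumption.
  unfold Cmu, Smu. rewrite !qpoch_inf_P.
  replace (q / (b * a * x)) with w by (unfold w; field; auto). fold w.
  rewrite !phi21_upper0 by assumption.
  replace (power_series (phi21_num (q / a) (q / b)) (a * b * x))
    with (P w * power_series (phi21_num (q / a) (q / b)) (a * b * x) / P w) by (field; exact HP).
  rewrite E.
  assert (N1 : P (b / a) <> 0) by now apply P_neq0, off_spiral_regular.
  assert (N2 : P (a / b) <> 0) by now apply P_neq0, off_spiral_regular.
  pose proof (P_neq0 q regular_q) as N3.
  field. repeat split; assumption.
Qed.

End QCalculus.

Theorem theorem2 (q a b lam mu x : C)
  (hq : (0 < Cmod q < 1)%R)
  (ha : a <> 0) (hb : b <> 0)
  (hab : forall k : Z, a / b <> CpowZ q k)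
  (hlam : lam <> 0) (hmu : mu <> 0) (hx : x <> 0)
  (hx1 : ~ in_spiral q 1 x)
  (hxa : ~ in_spiral q (- mu / a) x)
  (hxb : ~ in_spiral q (- mu / b) x)
  (hxlam : ~ in_spiral q (- lam) x)
  (* the terms of the identity are defined: no zero of theta(lam), theta(mu x),
     theta(a mu x), theta(b mu x), and q/(abx) not a pole of the 2phi1 in S *)
  (dlam : ~ in_spiral q (- (1)) lam)
  (dmu : ~ in_spiral q (- (1) / mu) x)
  (dmua : ~ in_spiral q (- (1) / (a * mu)) x)
  (dmub : ~ in_spiral q (- (1) / (b * mu)) x)
  (dS : forall k : nat, q / (a * b * x) * q ^ k <> 1) :
  [ [ f20 q a b lam x ],
    [ f21 q a b x ] ] =
  @Mmult C_Ring 2 2 1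
    [ [ Clammu q lam mu a b x, Clammu q lam mu b a x ],
      [ Cmu q mu a b x, Cmu q mu b a x ] ]
    [ [ Smu q mu a b x ],
      [ Smu q mu b a x ] ].
Proof.
  pose proof (q_neq0 q hq) as Hq.
  assert (Tl : theta q lam <> 0) by now apply theta_neq0.
  assert (Tm : theta q (mu * x) <> 0) by now apply theta_mult_neq0.
  assert (Ta : theta q (a * mu * x) <> 0).
  { apply theta_mult_neq0; auto. now apply Cmult_neq_0. }
  assert (Tb : theta q (b * mu * x) <> 0).
  { apply theta_mult_neq0; auto. now apply Cmult_neq_0. }
  assert (Tq : theta q (- q * x) <> 0).
  { apply theta_mult_neq0; auto; [now apply opp_neq0|]. intros [k E]. apply hx1.
    exists (k - 1)%Z. rewrite E.
    replace k with (k - 1 + 1)%Z at 1 by lia. rewrite CpowZ_succ by exact Hq.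
    field. exact Hq. }
  assert (Tx : theta q (lam / x) <> 0).
  { apply theta_neq0; [exact hq|now apply div_neq0|]. intros [k E]. apply hxlam.
    exists (- k)%Z. rewrite CpowZ_opp by exact Hq.
    pose proof (CpowZ_neq0 q k Hq) as Hk.
    replace (- lam) with (- (lam / x * x)) by (field; exact hx).
    rewrite E. field. exact Hk. }
  assert (HP : power_series (euler q) (q / (a * b * x)) <> 0).
  { apply P_neq0; [exact hq|]. intros n E. apply (dS n). symmetry.
    now apply Ceq_of_minus. }
  pose proof (f20_connection q hq a b lam mu x ha hb hab hlam hmu hx Tl Tx Tm Ta Tb HP) as E1.
  pose proof (f21_connection q hq a b mu x ha hb hab hmu hx Tq Tm Ta Tb HP) as E2.
  rewrite E1, E2.
  unfold Mmult, mk_matrix. cbn [mk_Tn Init.Nat.pred].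
  now rewrite !sum_Sn, !sum_O.
Qed.
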